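(* Let $E$ be a real Hausdorff locally convex topological vector space, $n\in\mathbb{N}$, $k\in\mathbb{N}_0$, let $U\subseteq\mathbb{R}^n$ be a locally convex subset with dense interior, and let $A\subseteq U$ be a relatively closed, locally compact subset. Then the continuous linear map \[\rho^k_{A,U}\colon C^k(U,E)\to\mathcal{E}^k(A,E),\quad f\mapsto((\partial^\alpha f)|_A)_{|\alpha|\le k}\] has a continuous linear right inverse $\Phi^k_{U,A}\colon\mathcal{E}^k(A,E)\to C^k(U,E)$, i.e. $\rho^k_{A,U}\circ\Phi^k_{U,A}=\mathrm{id}_{\mathcal{E}^k(A,E)}$.
   Context: ''Locally convex space'' means real Hausdorff locally convex topological vector space. $\mathbb{N}=\{1,2,\dots\}$, $\mathbb{N}_0=\mathbb{N}\cup\{0\}$, $\|\cdot\|$ is the Euclidean norm on $\mathbb{R}^n$; $\alpha,\beta$ denote multi-indices in $(\mathbb{N}_0)^n$. Subsets carry the induced topology. Sets. A subset $U\subseteq\mathbb{R}^n$ is called locally convex if each $x\in U$ has a convex neighbourhood in $U$ (for the induced topology). It has dense interior if its interior $U^\circ$ in $\mathbb{R}^n$ is dense in $U$. $C^k$-functions. Let $U\subseteq\mathbb{R}^n$ be locally convex with dense interior, $k\in\mathbb{N}_0\cup\{\infty\}$. A function $f\colon U\to E$ is $C^0$ if it is continuous. For $k\ge1$, $f$ is $C^k$ if $f$ is continuous and for all $l\in\mathbb{N}$ with $l\le k$ the iterated directional derivatives $d^{(l)}f(x,y_1,\dots,y_l)=(D_{y_l}\cdots D_{y_1}f)(x)$,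 where $(D_yf)(x)=\lim_{t\to0}\frac{f(x+ty)-f(x)}{t}$, exist for all $x\in U^\circ$, $y_i\in\mathbb{R}^n$, the function $d^{(l)}f\colon U^\circ\times(\mathbb{R}^n)^l\to E$ is continuous and it has a (necessarily unique) continuous extension $d^{(l)}f\colon U\times(\mathbb{R}^n)^l\to E$. For $|\alpha|\le k$, $\partial^\alpha f\colon U\to E$ is the continuous extension to $U$ of the iterated partial derivative of $f|_{U^\circ}$ ($\partial^0f=f$). $C^k(U,E)$ is the vector space of $C^k$-functions $U\to E$, with the compact-open $C^k$-topology: the locally convex topology generated by the seminorms $\|f\|_{C^l,q,K}=\max_{|\alpha|\le l}\sup_{x\in K}q(\partial^\alpha f(x))$, for $l\in\mathbb{N}_0$ with $l\le k$, continuous seminorms $q$ on $E$, compact $K\subseteq U$. Whitney jets. For an arbitrary subset $A\subseteq\mathbb{R}^n$, a $k$-jet on $A$ is a family $f=(f_\alpha)_{|\alpha|\le k}$ of functions $f_\alpha\colon A\to E$. Put $\partial^\alpha f=(f_{\alpha+\beta})_{|\beta|\le k-|\alpha|}$. For $l\in\mathbb{N}_0$, $l\le k$, $y\in A$, put $R^l_yf(x)=f_0(x)-\sum_{|\alpha|\le l}\frac{(x-y)^\alpha}{\alpha!}f_\alpha(y)$ for $x\in A$; thus $R_y^{l-|\alpha|}\partial^\alpha f(x)=f_\alpha(x)-\sum_{|\beta|\le l-|\alpha|}\frac{(x-y)^\beta}{\beta!}f_{\alpha+\beta}(y)$. The jet $f$ is a Whitney $k$-jet if for all $l\in\mathbb{N}_0$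 with $l\le k$, $|\alpha|\le l$, continuous seminorms $q$ on $E$, compact $K\subseteq A$ and $\varepsilon>0$ there is $\delta>0$ with $q(R_y^{l-|\alpha|}\partial^\alpha f(x))\le\varepsilon\|x-y\|^{l-|\alpha|}$ for all $x,y\in K$ with $0<\|x-y\|<\delta$. $\mathcal{E}^k(A,E)$ is the vector space of Whitney $k$-jets on $A$ with values in $E$, with the locally convex topology generated by the seminorms \[\|f\|_{\mathcal{E}^l,q,K}=\max_{|\alpha|\le l}\sup_{x\in K}q(f_\alpha(x))+\max_{|\alpha|\le l}\sup\Big\{\tfrac{q(R_y^{l-|\alpha|}\partial^\alpha f(x))}{\|x-y\|^{l-|\alpha|}}\colon x\ne y\text{ in }K\Big\}\] for $l\in\mathbb{N}_0$ with $l\le k$, continuous seminorms $q$ on $E$, compact $K\subseteq A$. *)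

(* Defs.v *)
From HB Require Import structures.
From mathcomp Require Import all_boot all_order all_algebra.
From mathcomp Require Import all_classical all_reals all_analysis.
(* Only the multi-indices are used; the notations of mpoly clash with those of
   MathComp-Analysis. *)
From mathcomp Require mpoly.
Import -(notations) mpoly.
Import Order.TTheory GRing.Theory Num.Theory numFieldNormedType.Exports.

Set Implicit Arguments.
Unset Strict Implicit.
Unset Printing Implicit Defensive.

Local Open Scope classical_set_scope.
Local Open Scope ring_scope.

HB.mixin Record Topological_isHausdorff T & Topological T := {
  hausdorff_subproof : hausdorff_space T
}.

#[short(type="lcsType")]
HB.structure Definition LCSpace (R : numDomainType) :=
  {E of Tvs R E & Topological_isHausdorff E}.

Lemma lcs_hausdorff (R : numDomainType) (E : lcsType R) : hausdorff_space E.
Proof. exact: hausdorff_subproof. Qed.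

Definition continuous_seminorm (R : realType) (E : lcsType R) (q : E -> R) :=
  [/\ continuous q,
      (forall u v, q (u + v) <= q u + q v) &
      (forall (c : R) u, q (c *: u) = `|c| * q u)].

(* Subbase of the topology generated by a family P of seminorms on V: all
   translates of open balls. *)
Definition seminorm_subbase (R : realType) (V : zmodType) (P : set (V -> R)) :
    set (set V) :=
  [set B | exists p f r, [/\ P p, 0 < r & B = [set g | p (g - f) < r]]].

Section Euclidean.
Context {R : realType} {n : nat}.
Implicit Types (x : 'rV[R]_n) (U : set 'rV[R]_n).

(* The library norm on 'rV[R]_n is the maximum norm (same topology). *)
Definition enorm x : R := Num.sqrt (\sum_i x 0 i ^+ 2).

Definition mpow x (a : multinom n) : R := \prod_i x 0 i ^+ a i.

Definition mfact (a : multinom n) : nat := (\prod_i (a i)`!)%N.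

Definition locally_convex_subset U :=
  forall x, U x ->
    exists C, [/\ C `<=` U, convex_set C & within U (nbhs x) C].

Definition dense_interior U := U `<=` closure U°.

(* Subsets are used as types (with the induced topology) through the coercion
   [set_type]. *)
Definition set_incl (A U : set 'rV[R]_n) (AU : A `<=` U) (x : A) : U :=
  exist _ (\val x) (mem_set (AU _ (set_valP x))).

End Euclidean.

Section DirectionalDerivatives.
Context {R : realType} {n : nat} {E : lcsType R}.
Implicit Types (F : 'rV[R]_n -> E) (D : set 'rV[R]_n) (x y : 'rV[R]_n).

(* The library's ['D_y F] is restricted to normed codomains. *)
Definition is_dirderiv F y x (l : E) :=
  t^-1 *: (F (x + t *: y) - F x) @[t --> (0 : R)^'] --> l.

Definition dirderiv y F x : E := xget 0 [set l | is_dirderiv F y x l].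

(* iter_dirderiv [:: y_1; ...; y_l] F = D_{y_l} ( ... (D_{y_1} F)) *)
Definition iter_dirderiv (ys : seq 'rV[R]_n) F : 'rV[R]_n -> E :=
  foldl (fun G y => dirderiv y G) F ys.

Fixpoint iter_dirderivable D (ys : seq 'rV[R]_n) F : Prop :=
  if ys is y :: ys' then
    (forall x, D x -> exists l, is_dirderiv F y x l) /\
    iter_dirderivable D ys' (dirderiv y F)
  else True.

(* An element (y_1, ..., y_l) of (R^n)^l is the matrix with rows y_i. *)
Definition rowseq l (Y : 'M[R]_(l, n)) : seq 'rV[R]_n :=
  [seq row i Y | i <- enum 'I_l].

(* \partial_1^{a_1} ( ... (\partial_n^{a_n} F)) *)
Definition iter_partial (a : multinom n) F : 'rV[R]_n -> E :=
  foldr (fun i G => iter (a i) (dirderiv (delta_mx 0 i)) G) F (enum 'I_n).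

End DirectionalDerivatives.

Section CkFunctions.
Context {R : realType} {n : nat} (U : set 'rV[R]_n) (E : lcsType R).
Implicit Types (f g : U -> E) (k l : nat).

(* Derivatives are taken at interior points of U only, hence they do not
   depend on the values [valL_ 0 f] takes outside of U. *)
Definition is_Ck k f : Prop :=
  continuous f /\
  forall l, (1 <= l <= k)%N ->
    let dl x (Y : 'M[R]_(l, n)) := iter_dirderiv (rowseq Y) (valL_ 0 f) x in
    [/\ forall Y : 'M[R]_(l, n), iter_dirderivable U° (rowseq Y) (valL_ 0 f),
        continuous (fun z : set_type U° * 'M[R]_(l, n) => dl (\val z.1) z.2) &
        exists g : U * 'M[R]_(l, n) -> E, continuous g /\
          forall (x : U) Y, U° (\val x) -> g (x, Y) = dl (\val x) Y].

(* The continuous extension to U of the iterated partial derivative on the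
   interior. *)
Definition partial (a : multinom n) f : U -> E :=
  xget (fun=> 0) [set g | continuous g /\
    forall x : U, U° (\val x) -> g x = iter_partial a (valL_ 0 f) (\val x)].

Lemma valL0_lin (c : R) f g :
  valL_ 0 (c *: f + g) = c *: valL_ 0 f + valL_ 0 g :> ('rV[R]_n -> E).
Proof.
apply/funext => x; rewrite /valL_ oinv_set_val /=.
rewrite [RHS]/GRing.add /= /GRing.scale /=.
by case: insub => [u|] //=; rewrite scaler0 addr0.
Qed.

End CkFunctions.

Section Linearity.
Context {R : realType} {n : nat} {E : lcsType R}.
Implicit Types (F G H : 'rV[R]_n -> E) (D : set 'rV[R]_n).

Lemma cvg_lin (T : Type) (S : set_system T) {FS : Filter S} (c : R)
    (f g : T -> E) (u v : E) :
  f @ S --> u -> g @ S --> v -> (fun t => c *: f t + g t) @ S --> c *: u + v.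
Proof.
move=> fu gv.
have cf : (fun t => c *: f t) @ S --> c *: u.
  have /= := @cvg_comp2 T R^o E E S (nbhs (c : R^o)) (nbhs u) (nbhs (c *: u))
    _ _ _ (fun=> c) f (fun a b => a *: b) (cvg_cst _) fu.
  by apply; exact: (@scale_continuous R E (c, u)).
have /= := @cvg_comp2 T E E E S (nbhs (c *: u)) (nbhs v) (nbhs (c *: u + v))
    _ _ _ (fun t => c *: f t) g (fun a b => a + b) cf gv.
by apply; exact: (@add_continuous E (c *: u, v)).
Qed.

Lemma continuous_lin (T : topologicalType) (c : R) (f g : T -> E) :
  continuous f -> continuous g -> continuous (c *: f + g : T -> E).
Proof. by move=> cf cg x; apply: cvg_lin; [exact: cf|exact: cg]. Qed.

Lemma is_dirderiv_lin D c F G H y x u v :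
  open D -> {in D, forall z, H z = c *: F z + G z} -> D x ->
  is_dirderiv F y x u -> is_dirderiv G y x v ->
  is_dirderiv H y x (c *: u + v).
Proof.
move=> oD HE Dx Fu Gv; apply: cvg_trans (cvg_lin (c := c) Fu Gv).
apply: near_eq_cvg; rewrite near_withinE.
have nD : \forall t \near (0 : R), D (x + t *: y).
  have : {for (0 : R), continuous (fun t : R => x + t *: y)}.
    apply: cvgD; first exact: cvg_cst.
    by apply: cvgZr_tmp; exact: cvg_id.
  by apply; rewrite scale0r addr0; exact: open_nbhs_nbhs.
apply: filterS nD => t Dt _.
rewrite !HE ?inE//.
by rewrite scalerA mulrC -scalerA -scalerDr scalerBr opprD addrACA.
Qed.

Lemma dirderivP F y x :
  (exists l, is_dirderiv F y x l) -> is_dirderiv F y x (dirderiv y F x).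
Proof. by move=> dF; exact: (xgetPex 0 (P := [set l | is_dirderiv F y x l])). Qed.

Lemma dirderiv_unique F y x l : is_dirderiv F y x l -> dirderiv y F x = l.
Proof.
move=> Fl; apply: (cvg_unique (@lcs_hausdorff R E) _ Fl).
by apply: dirderivP; exists l.
Qed.

Lemma iter_dirderiv_lin D ys c F G H :
  open D -> {in D, forall z, H z = c *: F z + G z} ->
  iter_dirderivable D ys F -> iter_dirderivable D ys G ->
  iter_dirderivable D ys H /\
  {in D, forall z, iter_dirderiv ys H z =
                   c *: iter_dirderiv ys F z + iter_dirderiv ys G z}.
Proof.
move=> oD; elim: ys F G H => [//|y ys IH] F G H HE [dF dFs] [dG dGs] /=.
have dH x : D x ->
    is_dirderiv H y x (c *: dirderiv y F x + dirderiv y G x).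
  move=> Dx; apply: (is_dirderiv_lin oD HE Dx).
    exact/dirderivP/dF.
  exact/dirderivP/dG.
have [|sH EH] := IH _ _ (dirderiv y H) _ dFs dGs.
  by move=> z /[!inE] /dH /dirderiv_unique.
split=> //; split=> // x /dH; by eexists; eassumption.
Qed.

Lemma is_Ck_lin (U : set 'rV[R]_n) k c (f g : U -> E) :
  is_Ck k f -> is_Ck k g -> is_Ck k (c *: f + g).
Proof.
move=> [cf df] [cg dg]; split; first exact: continuous_lin.
move=> l lk /=.
have [df1 df2 [f' [cf' f'E]]] := df l lk.
have [dg1 dg2 [g' [cg' g'E]]] := dg l lk.
have HE : {in (U° : set _), forall z, valL_ 0 (c *: f + g) z =
    c *: valL_ 0 f z + valL_ 0 g z :> E}.
  by move=> z _; rewrite valL0_lin.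
have lin Y := iter_dirderiv_lin (@open_interior _ U) HE (df1 Y) (dg1 Y).
split=> [Y||].
- by have [] := lin Y.
- rewrite (_ : (fun z => _) = c *: (fun z : set_type U° * 'M[R]_(l, n) =>
     iter_dirderiv (rowseq z.2) ('valL_0 f) (\val z.1)) +
    (fun z : set_type U° * 'M[R]_(l, n) =>
     iter_dirderiv (rowseq z.2) ('valL_0 g) (\val z.1))).
    exact: continuous_lin.
  apply/funext => -[x Y] /=; have [_ ->//] := lin Y.
  exact: valP.
- exists (c *: f' + g'); split; first exact: continuous_lin.
  move=> x Y Ux; have [_ ->] := lin Y; last by rewrite inE.
  by rewrite -f'E// -g'E.
Qed.

Lemma is_Ck0 (U : set 'rV[R]_n) k : is_Ck k (0 : U -> E).
Proof.
have d0 y x : is_dirderiv (0 : 'rV[R]_n -> E) y x 0.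
  rewrite /is_dirderiv (_ : (fun t : R => _) = fun=> 0); first exact: cvg_cst.
  by apply/funext => t; rewrite subrr scaler0.
have v0 : valL_ 0 (0 : U -> E) = 0 :> ('rV[R]_n -> E).
  by apply/funext => x; rewrite /valL_ /= oinv_set_val; case: insub.
have D0 y : dirderiv y (0 : 'rV[R]_n -> E) = 0.
  by apply/funext => x; exact: dirderiv_unique.
have it0 ys : iter_dirderiv ys (0 : 'rV[R]_n -> E) = 0.
  by elim: ys => //= y ys IH; rewrite D0.
split; first exact: cst_continuous.
move=> l _ /=; rewrite v0; split=> [Y||].
- elim: (rowseq Y) => //= y ys IH; rewrite D0; split=> // x _.
  by exists 0.
- rewrite (_ : (fun z => _) = fun=> 0); first exact: cst_continuous.
  by apply/funext => z; rewrite it0.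
- exists (fun=> 0); split; first exact: cst_continuous.
  by move=> x Y _; rewrite it0.
Qed.

End Linearity.

Section CkSpace.
Context {R : realType} {n : nat} (U : set 'rV[R]_n) (E : lcsType R) (k : nat).

Definition Ck_pred : {pred U -> E} := fun f => `[< is_Ck k f >].

Record Ck := MkCk { Ck_fun :> U -> E; _ : Ck_fun \in Ck_pred }.

HB.instance Definition _ := [isSub for Ck_fun].
HB.instance Definition _ := [Choice of Ck by <:].

Fact Ck_submod_closed : submod_closed Ck_pred.
Proof.
split; first by apply/asboolP; exact: is_Ck0.
by move=> c f g /asboolP fC /asboolP gC; apply/asboolP; exact: is_Ck_lin.
Qed.

HB.instance Definition _ := GRing.isSubmodClosed.Build R (U -> E) Ck_pred
  Ck_submod_closed.
HB.instance Definition _ := [SubChoice_isSubLmodule of Ck by <:].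

(* [sup set0 = 0], and the suprema are over bounded sets. *)
Definition Ck_norm (l : nat) (q : E -> R) (K : set U) (f : Ck) : R :=
  \big[Num.max/0]_(a : bmultinom n l.+1) sup [set q (partial a f x) | x in K].

Definition Ck_seminorms : set (Ck -> R) :=
  [set p | exists l q K,
    [/\ (l <= k)%N, continuous_seminorm q, compact K & p = Ck_norm l q K]].

HB.instance Definition _ :=
  isSubBaseTopological.Build Ck (seminorm_subbase Ck_seminorms) id.

End CkSpace.

Section WhitneyJets.
Context {R : realType} {n : nat} (A : set 'rV[R]_n) (E : lcsType R) (k : nat).

(* The multi-indices a with |a| <= k form [bmultinom n k.+1]. *)
Definition jet := bmultinom n k.+1 -> A -> E.

HB.instance Definition _ := GRing.Lmodule.on jet.

(* f_a for |a| <= k (and 0 for other a) *)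
Definition jcoef (f : jet) (a : multinom n) : A -> E := oapp f 0 (insub a).

(* R_y^{l - |a|} \partial^a f (x) *)
Definition remainder (f : jet) (l : nat) (a : multinom n) (y x : A) : E :=
  jcoef f a x -
  \sum_(b : bmultinom n (l - mdeg a).+1)
    (mpow (\val x - \val y) b / (mfact b)%:R) *: jcoef f (mnm_add a b) y.

Definition is_whitney (f : jet) : Prop :=
  forall (l : nat) (a : multinom n) (q : E -> R) (K : set A) (e : R),
    (l <= k)%N -> (mdeg a <= l)%N -> continuous_seminorm q -> compact K ->
    0 < e ->
    exists2 d : R, 0 < d & forall x y : A, K x -> K y ->
      0 < enorm (\val x - \val y) < d ->
      q (remainder f l a y x) <= e * enorm (\val x - \val y) ^+ (l - mdeg a).

Lemma jcoef_lin (c : R) (f g : jet) a x :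
  jcoef (c *: f + g) a x = c *: jcoef f a x + jcoef g a x.
Proof.
by rewrite /jcoef; case: insub => [b|] //=; rewrite scaler0 addr0.
Qed.

Lemma remainder_lin (c : R) (f g : jet) l a y x :
  remainder (c *: f + g) l a y x =
  c *: remainder f l a y x + remainder g l a y x.
Proof.
rewrite /remainder jcoef_lin scalerBr addrACA -opprD; congr (_ - _).
rewrite scaler_sumr -big_split /=; apply: eq_bigr => b _.
by rewrite jcoef_lin scalerDr !scalerA mulrC.
Qed.

Definition whitney_pred : {pred jet} := fun f => `[< is_whitney f >].

Record whitney := MkWhitney { whitney_jet :> jet; _ : whitney_jet \in whitney_pred }.

HB.instance Definition _ := [isSub for whitney_jet].
HB.instance Definition _ := [Choice of whitney by <:].

Fact whitney_submod_closed : submod_closed whitney_pred.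
Proof.
have enorm_ge0 (v : 'rV[R]_n) : 0 <= enorm v by exact: sqrtr_ge0.
split.
  apply/asboolP => l a q K e lk al [_ _ qZ] cK e0; exists 1 => // x y _ _ _.
  rewrite (_ : remainder _ _ _ _ _ = 0 *: 0).
    by rewrite qZ normr0 mul0r; apply: mulr_ge0; [exact: ltW|exact: exprn_ge0].
  rewrite scaler0 /remainder big1 => [|b _].
    by rewrite subr0 /jcoef; case: insub.
  by rewrite /jcoef; case: insub => [?|]; rewrite /= scaler0.
move=> c f g /asboolP fW /asboolP gW; apply/asboolP.
move=> l a q K e lk al qs cK e0; have [_ qD qZ] := qs.
have c1 : 0 < `|c| + 1 by rewrite ltr_wpDl.
have e1 : 0 < e / 2 / (`|c| + 1) by rewrite !divr_gt0.
have e2 : 0 < e / 2 by rewrite divr_gt0.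
have [d1 d10 fd1] := fW l a q K _ lk al qs cK e1.
have [d2 d20 gd2] := gW l a q K _ lk al qs cK e2.
exists (Num.min d1 d2); first by rewrite lt_min d10.
move=> x y Kx Ky /andP[xy]; rewrite lt_min => /andP[xy1 xy2].
have {}fd1 := fd1 x y Kx Ky (introT andP (conj xy xy1)).
have {}gd2 := gd2 x y Kx Ky (introT andP (conj xy xy2)).
rewrite remainder_lin (le_trans (qD _ _))// qZ [e in leRHS]splitr mulrDl lerD//.
apply: le_trans (ler_wpM2l (normr_ge0 c) fd1) _.
rewrite mulrA ler_wpM2r ?exprn_ge0// mulrCA ger_pMr//.
by rewrite ler_pdivrMr// mul1r lerDl.
Qed.

HB.instance Definition _ := GRing.isSubmodClosed.Build R jet whitney_pred
  whitney_submod_closed.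
HB.instance Definition _ := [SubChoice_isSubLmodule of whitney by <:].

(* As for [Ck_norm], the suprema are over bounded sets. *)
Definition whitney_norm (l : nat) (q : E -> R) (K : set A) (f : whitney) : R :=
  \big[Num.max/0]_(a : bmultinom n l.+1) sup [set q (jcoef f a x) | x in K] +
  \big[Num.max/0]_(a : bmultinom n l.+1)
    sup [set q (remainder f l a z.2 z.1) /
             enorm (\val z.1 - \val z.2) ^+ (l - mdeg a)
        | z in [set z : A * A | [/\ K z.1, K z.2 & z.1 != z.2]]].

Definition whitney_seminorms : set (whitney -> R) :=
  [set p | exists l q K,
    [/\ (l <= k)%N, continuous_seminorm q, compact K & p = whitney_norm l q K]].

HB.instance Definition _ :=
  isSubBaseTopological.Build whitney (seminorm_subbase whitney_seminorms) id.

End WhitneyJets.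

(* Main.v *)
Require Import Defs.
From HB Require Import structures.
From mathcomp Require Import all_boot all_order all_algebra.
From mathcomp Require Import all_classical all_reals all_analysis.
From mathcomp Require mpoly.
Import -(notations) mpoly.
From mathcomp Require Import ring lra zify.
Import Order.TTheory GRing.Theory Num.Theory numFieldNormedType.Exports.
Local Open Scope classical_set_scope.
Local Open Scope ring_scope.
Set Implicit Arguments.
Unset Strict Implicit.
Unset Printing Implicit Defensive.

(** The right inverse is a form of Whitney extension in which the decomposition
    of the complement of [A] into cubes is replaced by interpolation on finer
    and finer grids.

    A bump function on the line whose integer translates form a partition of
    unity ([bump_exists]) gives, by dilation and in each coordinate in turn,
    weights for the nodes of the grid of mesh [4 ^- m] ([grid]). The
    approximation [approx m g] glues with these weights the Taylor polynomials
    of the jet [g] at points of [A] chosen near the nodes; at a node without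
    such a point it keeps the approximation of the previous level. At distance
    more than [4 ^- m] from [A] nothing changes after the level [m]; [ext g] is
    the final value there, and it is [g] itself on [A]. The choices do not
    depend on [g], so [ext] is linear.

    Everything rests on one estimate ([ext_estimate]): near [x0] in [A], the
    derivatives of order [j] of [ext g] and of the Taylor polynomial of [g] at
    [x0] differ by at most [ext_cst * M] times the power [k - j] of the distance
    to [x0], where [M] bounds the remainders of [g] near [x0]. The reason is
    that the Taylor polynomials at two close points of [A] differ by remainders
    ([jet_taylor_transfer]), and that a derivative which falls on a weight costs
    one factor [4 ^+ m], which is comparable to the inverse of the distance to
    [A] where the level [m] matters. The Whitney condition makes [M] small, and
    then [ext g] is of class C^k across [A] with the prescribed derivatives
    ([ext_ck_at]). Taking for [M] the seminorm of [g] on a compact disc of [A],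
    which exists by local compactness, the same estimate bounds the seminorms of
    [ext g] by those of [g] ([bdd_ext]), locally and hence on compact sets; this
    is the continuity of the extension. Relative closedness of [A] is used to
    see that all points of [U] are interior to the set of points in [A] or at
    positive distance from [A] ([sub_covered]).

    That the restriction of a C^k function is a Whitney jet, and depends
    continuously on the function, is Taylor's formula. Close points of a compact
    subset of [A] are joined by segments in [U] because [U] is locally convex;
    such a segment may lie in the boundary, where derivatives are only defined
    by extension, but pushing it into the interior one sees that the expected
    mean value inequalities still hold along it ([strictly_differentiable],
    [partial_word_segment]).

    [E] is a general locally convex space, so every estimate is for one
    continuous seminorm at a time, and integrals are avoided in favour of mean
    value inequalities ([lipschitz_interval], [seg_bound]). A function and its
    iterated partial derivatives are handled as a family indexed by words
    ([ck_family]); such a family around [U] gives a function of class C^k in the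
    sense of iterated directional derivatives ([is_Ck_family]), and its symmetry
    ([ck_family_perm]) links words to multi-indices. *)

(** * Cancellation in abelian groups *)

(* Everything is moved to the left and expanded; opposite terms are then
   cancelled. *)
Ltac zmod_cancel := repeat match goal with
  | |- is_true (_ - ?u == 0) =>
      first [rewrite addrK | rewrite (addrAC _ u)]
  | |- is_true (_ + ?u == 0) =>
      first [rewrite subrK | rewrite (addrAC _ (- u))]
  end.

Lemma subr0_eq_left (V : zmodType) (a b : V) : 0 + (a - b) == 0 -> a = b.
Proof. by rewrite add0r subr_eq0 => /eqP. Qed.

Ltac zmod := apply: subr0_eq_left; rewrite
  !(opprD, opprK, scalerDr, scalerDl, scalerN, scaleNr, scalerA, scale1r,
    addrA, oppr0, addr0, sub0r, scaler0, scale0r, scaleN1r, mul1r, mulr1);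
  zmod_cancel; exact: eqxx.

(** * Continuous seminorms of a locally convex space *)

Section ConvexSets.
Context {R : realType} {V : lmodType R}.

Lemma convexP (C : set V) : convex_set C <->
  forall x y (s : R), C x -> C y -> 0 <= s <= 1 -> C (s *: x + (1 - s) *: y).
Proof.
split=> [cC x y s Cx Cy s01|cC x y l].
  have [s0 s1] := andP s01.
  by have := cC x y (Itv01 s0 s1); rewrite !inE => /(_ Cx Cy).
by rewrite !inE => Cx Cy; apply: cC => //; rewrite ge0 le1.
Qed.

End ConvexSets.

Section Seminorm.
Context {R : realType} {E : lcsType R}.
Variable q : E -> R.
Hypothesis qs : continuous_seminorm q.

Let qD u v : q (u + v) <= q u + q v. Proof. by case: qs. Qed.
Let qZ c u : q (c *: u) = `|c| * q u. Proof. by case: qs. Qed.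

Lemma semi_le u v : q (u + v) <= q u + q v. Proof. exact: qD. Qed.

Lemma semiZ c u : q (c *: u) = `|c| * q u. Proof. exact: qZ. Qed.

Lemma semi0 : q 0 = 0.
Proof. by rewrite -(scale0r 0) qZ normr0 mul0r. Qed.

Lemma semiN u : q (- u) = q u.
Proof. by rewrite -scaleN1r qZ normrN1 mul1r. Qed.

Lemma semi_ge0 u : 0 <= q u.
Proof. by have := qD u (- u); rewrite subrr semi0 semiN; lra. Qed.

Lemma semi_leB u v : q (u - v) <= q u + q v.
Proof. by rewrite (le_trans (qD _ _))// semiN. Qed.

Lemma semiBC u v : q (u - v) = q (v - u).
Proof. by rewrite -opprB semiN. Qed.

Lemma semi_tri u v w : q (u - w) <= q (u - v) + q (v - w).
Proof. by rewrite -[u - w](subrKA v). Qed.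

Lemma semi_sub u v : q u <= q v + q (u - v).
Proof. by rewrite -{1}(subrK v u) addrC. Qed.

Lemma semi_sum I (r : seq I) (P : pred I) (F : I -> E) :
  q (\sum_(i <- r | P i) F i) <= \sum_(i <- r | P i) q (F i).
Proof.
apply: (big_rec2 (fun u s => q u <= s)); first by rewrite semi0.
by move=> i s u _ us; rewrite (le_trans (qD _ _))// lerD2l.
Qed.

End Seminorm.

Section Gauge.
Context {R : realType} {E : lcsType R}.

Section GaugeOfConvex.
Variable B : set E.
Hypotheses (oB : open B) (B0 : B 0) (cB : convex_set B)
  (sB : forall u, B u -> B (- u)).

Let absorb u : exists2 t : R, 0 < t & B (t^-1 *: u).
Proof.
have : (fun s : R^o => s *: u) @ (0 : R^o) --> (0 : R) *: u.
  have /= := @cvg_comp2 R^o R^o E E (nbhs (0 : R^o)) (nbhs (0 : R^o)) (nbhs u)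
    (nbhs (0 *: u)) _ _ _ id (fun=> u) (fun a b => a *: b) cvg_id (cvg_cst _).
  by apply; exact: (@scale_continuous R E (0, u)).
rewrite scale0r => /(_ B (open_nbhs_nbhs (conj oB B0))) /nbhs_ballP[e /= e0 be].
have e1 : 0 < e / 2 by lra.
exists (e / 2)^-1; first by rewrite invr_gt0.
by rewrite invrK; apply: be; rewrite /ball /= sub0r normrN gtr0_norm//; lra.
Qed.

Let star u (s t : R) : 0 < s -> s <= t -> B (s^-1 *: u) -> B (t^-1 *: u).
Proof.
move=> s0 st Bu; have t0 : 0 < t by lra.
have := (convexP B).1 cB (s^-1 *: u) 0 (s / t) Bu B0.
rewrite scaler0 addr0 scalerA mulrAC divff ?mul1r ?gt_eqF//; apply.
by apply/andP; split; [apply: divr_ge0; lra|rewrite ler_pdivrMr// mul1r].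
Qed.

Definition gauge u : R := inf [set t : R | 0 < t /\ B (t^-1 *: u)].

Let gauge_has_inf u : has_inf [set t : R | 0 < t /\ B (t^-1 *: u)].
Proof.
split; first by have [t t0 Bt] := absorb u; exists t.
by exists 0 => t /= [/ltW].
Qed.

Let gauge_le u t : 0 < t -> B (t^-1 *: u) -> gauge u <= t.
Proof. by move=> t0 Bt; apply: ge_inf => //; case: (gauge_has_inf u). Qed.

Lemma gauge_lt u t : gauge u < t -> B (t^-1 *: u).
Proof.
move=> /(inf_lt (gauge_has_inf u).1)[s /= [s0 Bs] st].
exact: star s0 (ltW st) Bs.
Qed.

Let gauge_ge0 u : 0 <= gauge u.
Proof. by apply: lb_le_inf => [|t /= [/ltW]//]; case: (gauge_has_inf u). Qed.

Let gaugeD u v : gauge (u + v) <= gauge u + gauge v.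
Proof.
apply/ler_addgt0Pr => e e0.
pose s := gauge u + e / 2; pose t := gauge v + e / 2.
have s0 : 0 < s by rewrite /s; have := gauge_ge0 u; lra.
have t0 : 0 < t by rewrite /t; have := gauge_ge0 v; lra.
have -> : gauge u + gauge v + e = s + t by rewrite /s /t; lra.
have st0 : 0 < s + t by lra.
apply: gauge_le => //.
have us : B (s^-1 *: u) by apply: gauge_lt; rewrite /s; lra.
have vt : B (t^-1 *: v) by apply: gauge_lt; rewrite /t; lra.
have := (convexP B).1 cB _ _ (s / (s + t)) us vt.
rewrite !scalerA (_ : (1 - _) * _ = (s + t)^-1); last by field; lra.
rewrite (_ : s / _ / _ = (s + t)^-1); last by field; lra.
rewrite -scalerDr; apply.
by apply/andP; split; [apply: divr_ge0; lra|rewrite ler_pdivrMr//; lra].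
Qed.

Let gauge_leZ c u : c != 0 -> gauge (c *: u) <= `|c| * gauge u.
Proof.
move=> c0; have c1 : 0 < `|c| by rewrite normr_gt0.
rewrite -ler_pdivrMl//; apply/ler_addgt0Pr => e e0.
rewrite ler_pdivrMl//; apply: gauge_le.
  by rewrite mulr_gt0//; have := gauge_ge0 u; lra.
have : B ((gauge u + e)^-1 *: u) by apply: gauge_lt; lra.
rewrite scalerA; have [cp|cn] := ltrP 0 c.
  by rewrite gtr0_norm// invfM mulrAC mulVf ?mul1r.
have {}cn : c < 0 by rewrite lt_neqAle c0.
rewrite ltr0_norm// mulNr invrN mulNr scaleNr => /sB.
by rewrite invfM mulrAC mulVf ?mul1r.
Qed.

Let gaugeZ c u : gauge (c *: u) = `|c| * gauge u.
Proof.
have [->|c0] := eqVneq c 0.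
  rewrite scale0r normr0 mul0r; apply/eqP; rewrite eq_le gauge_ge0 andbT.
  apply/ler_addgt0Pr => e e0; rewrite add0r.
  by apply: gauge_le => //; rewrite scaler0.
apply/eqP; rewrite eq_le gauge_leZ//=.
have c1 : 0 < `|c| by rewrite normr_gt0.
rewrite -ler_pdivlMl// -normfV -{1}[u]scale1r -(mulVf c0) -scalerA.
by rewrite gauge_leZ// invr_eq0.
Qed.

Lemma gauge_seminorm : continuous_seminorm gauge.
Proof.
split=> // u; apply/(@cvgrPdist_le _ R^o) => e e0.
have cv : (fun v : E => e^-1 *: v + (- (e^-1 *: u))) @ u --> (0 : E).
  rewrite -(subrr (e^-1 *: u)); apply: cvg_lin; [exact: cvg_id|exact: cvg_cst].
near=> v.
have ge : gauge (v - u) <= e.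
  apply: gauge_le => //; rewrite scalerBr; near: v.
  exact: (cv B (open_nbhs_nbhs (conj oB B0))).
rewrite ler_norml; apply/andP; split.
  by have := gaugeD u (v - u); rewrite subrKC; lra.
have gN : gauge (u - v) = gauge (v - u).
  by rewrite -(opprB v u) -scaleN1r gaugeZ normrN1 mul1r.
by have := gaugeD v (u - v); rewrite subrKC gN; lra.
Unshelve. all: by end_near. Qed.

End GaugeOfConvex.

(** The gauge of a symmetric convex open set inside a given neighbourhood of 0
    is a continuous seminorm: continuous seminorms define the topology. *)
Lemma nbhs0_seminorm (V : set E) : nbhs 0 V ->
  exists2 q : E -> R, continuous_seminorm q & forall u, q u < 1 -> V u.
Proof.
move=> V0; have [BE BEc [BEo BEb]] := @locally_convex R E.
have [C [BC C0] CV] := BEb 0 V V0.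
have oC := BEo _ BC.
have cC : convex_set C by apply: BEc; rewrite inE.
pose B := C `&` [set u | C (- u)].
have oB : open B.
  apply: openI => //; apply: open_comp => // u _; exact: opp_continuous.
have B0 : B 0 by split=> //=; rewrite oppr0.
have cB : convex_set B.
  apply/convexP => x y s [Cx Cx'] [Cy Cy'] s01; split.
    exact: ((convexP C).1 cC).
  by rewrite /= opprD -!scalerN; exact: ((convexP C).1 cC).
have sB u : B u -> B (- u) by move=> [? ?]; split => //=; rewrite opprK.
exists (gauge B); first exact: gauge_seminorm.
move=> u /(gauge_lt oB B0 cB); rewrite invr1 scale1r => -[Cu _].
exact: CV.
Qed.

(** Limits in [E] can thus be tested with one seminorm at a time. *)
Lemma cvg_seminormP (T : Type) (F : set_system T) {FF : Filter F}
    (f : T -> E) (l : E) :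
  f @ F --> l <-> (forall q, continuous_seminorm q ->
    forall e : R, 0 < e -> \forall t \near F, q (f t - l) <= e).
Proof.
split=> [fl q qs e e0|H V Vl].
  have ql : (fun u : E => q (u - l)) @ l --> (0 : R).
    rewrite -(semi0 qs) -(subrr l).
    apply: (@cvg_comp _ _ _ (fun u : E => u - l) q _ (nbhs (l - l))).
      rewrite -{3}[l]scale1r.
      rewrite (_ : (fun u => _) = (fun u => 1 *: u - l)).
        apply: cvg_lin; [exact: cvg_id|exact: cvg_cst].
      by apply/funext => u; rewrite scale1r.
    by have [cq _ _] := qs; exact: cq.
  have : (fun t => q (f t - l)) @ F --> (0 : R) by apply: cvg_comp ql.
  by move/cvgr_le; apply.
have [q qs qV] : exists2 q : E -> R, continuous_seminorm q &
    forall u, q u < 1 -> V (u + l).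
  apply: (@nbhs0_seminorm [set u | V (u + l)]).
  have h : (fun u => 1 *: u + l) @ (0 : E) --> 1 *: 0 + l.
    by apply: cvg_lin; [exact: cvg_id|exact: cvg_cst].
  move: h; rewrite scaler0 add0r => /(_ V Vl).
  by apply: (@filterS _ (nbhs (0 : E))) => u /=; rewrite scale1r.
have h0 : (0 : R) < 1/2 by lra.
have := H q qs _ h0; apply: filterS => t qt.
by rewrite /= -(subrK l (f t)); apply: qV; lra.
Qed.

(** Otherwise the constant sequence [v] would have two limits. *)
Lemma seminorm_eq (u v : E) :
  (forall q : E -> R, continuous_seminorm q -> q (u - v) = 0) -> u = v.
Proof.
move=> H; apply: (@lcs_hausdorff R E) => A B Au Bv.
exists v; split; last exact: nbhs_singleton Bv.
have : (fun _ : nat => v) @ \oo --> u.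
  apply/cvg_seminormP => q qs e e0; apply: nearW => _.
  by rewrite (semiBC qs) H// ltW.
by move=> /(_ A Au) [m _ /(_ m)]; apply => /=.
Qed.

End Gauge.

(** * Calculus with respect to one seminorm *)

Section RowVectorNorm.
Context {R : realType} {n : nat}.
Implicit Types (x y : 'rV[R]_n).

Lemma coord_le x i : `|x 0 i| <= `|x|.
Proof.
by rewrite /Num.norm /= mx_normrE (le_bigmax _ (fun ij => `|x ij.1 ij.2|) (0, i)).
Qed.

Lemma norm_le_coord x r : 0 <= r -> (forall i, `|x 0 i| <= r) -> `|x| <= r.
Proof.
move=> r0 xr; rewrite /Num.norm /= mx_normrE.
by apply/bigmax_leP; split=> // -[i j] _ /=; rewrite ord1.
Qed.

Lemma norm_delta (i : 'I_n) : `|delta_mx 0 i : 'rV[R]_n| <= 1.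
Proof.
apply: norm_le_coord => // j; rewrite mxE eqxx /=.
by case: eqP => _; rewrite ?normr1 ?normr0.
Qed.

Lemma fin_delta (I : finType) (P : I -> R -> Prop) :
  (forall i d d', d' <= d -> P i d -> P i d') ->
  (forall i, exists2 d, 0 < d & P i d) ->
  exists2 d, 0 < d & forall i, P i d.
Proof.
move=> mono /(_ _)/cid2-/all_sig[d dP].
exists (\big[Num.min/1]_i d i).
  by apply: lt_bigmin => // i _; case: (dP i).
move=> i; have [_] := dP i; apply: mono.
exact: bigmin_le_cond.
Qed.

Lemma nbhs_rVP x (P : set 'rV[R]_n) :
  nbhs x P <-> exists2 d : R, 0 < d & forall y, `|y - x| < d -> P y.
Proof.
split=> [/(@nbhs_normP R 'rV[R]_n)[d /= d0 dP]|[d d0 dP]].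
  by exists d => // y yx; apply: dP; rewrite /ball_ /= distrC.
apply/(@nbhs_normP R 'rV[R]_n); exists d => // y.
by rewrite /ball_ /= distrC => /dP.
Qed.

End RowVectorNorm.

Section OneVariable.
Context {R : realType} {E : lcsType R}.
Variable q : E -> R.
Hypothesis qs : continuous_seminorm q.

(** The set of [t] satisfying the inequality on [[a, t]] contains its supremum,
    and could be enlarged beyond it if it were smaller than [b]. *)
Lemma lipschitz_interval (h : R -> E) (a b L : R) : a <= b ->
  (forall t, a <= t <= b -> exists2 d, 0 < d & forall t', a <= t' <= b ->
    `|t' - t| < d -> q (h t' - h t) <= L * `|t' - t|) ->
  q (h b - h a) <= L * (b - a).
Proof.
move=> ab H.
pose S := [set t : R | a <= t <= b /\ q (h t - h a) <= L * (t - a)].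
have Sa : S a by split; [rewrite lexx ab|rewrite !subrr (semi0 qs) mulr0].
have hS : has_sup S by split; [exists a|exists b => t [/andP[]]].
pose c := sup S.
have cab : a <= c <= b.
  apply/andP; split; first exact: (ub_le_sup hS.2).
  by apply: ge_sup; [exists a|move=> t [/andP[]]].
have [d d0 dH] := H c cab.
have [s Ss sc] : exists2 s, S s & c - d < s.
  by apply: (sup_gt hS.1); rewrite -/c; lra.
have sc' : s <= c by exact: (ub_le_sup hS.2).
have Sc : q (h c - h a) <= L * (c - a).
  have [sab Hs] := Ss.
  have := dH s sab; rewrite ler0_norm ?subr_le0// opprB (semiBC qs).
  have := semi_tri qs (h c) (h s) (h a).
  by move=> H1 /(_ ltac:(lra)) H2; nra.
have [cb|bc] := ltrP c b; last first.
  by have -> : b = c by have/andP[_ ?] := cab; lra.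
pose t := Num.min b (c + d / 2).
have ct : c < t by rewrite lt_min cb/=; lra.
have tb : t <= b by rewrite ge_min lexx.
have td : t <= c + d / 2 by rewrite ge_min lexx orbT.
suff St : S t by have := ub_le_sup hS.2 St; rewrite -/c; lra.
have tab : a <= t <= b by have/andP[? ?] := cab; lra.
split=> //.
have := dH t tab; rewrite ger0_norm; last lra.
move=> /(_ ltac:(lra)) H2.
by have := semi_tri qs (h t) (h c) (h a); nra.
Qed.

(** [h' t] is the derivative of [h], relative to [[0, 1]], at every [t] in
    [[0, 1]], up to vectors on which [q] vanishes. *)
Definition qder01 (h h' : R -> E) := forall t : R, 0 <= t <= 1 ->
  forall e : R, 0 < e -> exists2 d, 0 < d & forall t' : R, 0 <= t' <= 1 ->
    `|t' - t| < d -> q (h t' - h t - (t' - t) *: h' t) <= e * `|t' - t|.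

Lemma qder01B (h h' g g' : R -> E) : qder01 h h' -> qder01 g g' ->
  qder01 (fun t => h t - g t) (fun t => h' t - g' t).
Proof.
move=> dh dg t t01 e e0; have e2 : 0 < e / 2 by rewrite divr_gt0.
have [d d0 dP] := dh t t01 _ e2; have [b b0 bP] := dg t t01 _ e2.
exists (Num.min d b) => [|t' t'01]; first by rewrite lt_min d0.
rewrite lt_min => /andP[td tb].
have -> : h t' - g t' - (h t - g t) - (t' - t) *: (h' t - g' t) =
    (h t' - h t - (t' - t) *: h' t) - (g t' - g t - (t' - t) *: g' t).
  by zmod.
rewrite (le_trans (semi_leB qs _ _))//.
by have := dP t' t'01 td; have := bP t' t'01 tb; lra.
Qed.

(** The function [h t - t *: c] satisfies the hypothesis of
    [lipschitz_interval] with the constant [M + e]. *)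
Lemma mean_value (h h' : R -> E) (c : E) (M : R) (b : R) : qder01 h h' ->
  (forall t, 0 <= t <= 1 -> q (h' t - c) <= M) -> 0 <= b <= 1 ->
  q (h b - h 0 - b *: c) <= M * b.
Proof.
move=> dh hM /andP[b0 b1]; apply/ler_addgt0Pr => e e0.
have := @lipschitz_interval (fun t => h t - t *: c) 0 b (M + e) b0.
rewrite scale0r !subr0 => H.
suff : q (h b - b *: c - h 0) <= (M + e) * b by rewrite addrAC; nra.
apply: H => t /andP[t0 tb].
have [|d d0 dP] := dh t _ e e0; first lra.
exists d => // s /andP[s0 sb] sd.
have := dP s ltac:(lra) sd; have := hM t ltac:(lra).
have -> : h s - s *: c - (h t - t *: c) =
    (h s - h t - (s - t) *: h' t) + (s - t) *: (h' t - c).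
  rewrite scalerBr addrA subrK scalerBl.
  by rewrite !opprB addrACA [RHS]addrAC -!addrA; congr (_ + _); rewrite addrCA.
move=> H1 H2; rewrite (le_trans (semi_le qs _ _))// (semiZ qs).
by have := normr_ge0 (s - t); nra.
Qed.

End OneVariable.

Section Derivatives.
Context {R : realType} {n : nat} {E : lcsType R}.
Implicit Types (F G H : 'rV[R]_n -> E) (x y : 'rV[R]_n) (w : seq 'I_n).

(** [qcont] and [qdiff] are what a single seminorm [q] sees of continuity and of
    differentiability in the direction [y]; together, the continuous seminorms
    see everything ([qcontP], [qdiffP]). *)
Definition qcont (q : E -> R) F x := forall e : R, 0 < e ->
  exists2 d, 0 < d & forall y, `|y - x| < d -> q (F y - F x) <= e.

Definition qdiff (q : E -> R) F y x (l : E) := forall e : R, 0 < e ->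
  exists2 d, 0 < d & forall t : R, `|t| < d ->
    q (F (x + t *: y) - F x - t *: l) <= e * `|t|.

Lemma qcontP F x :
  {for x, continuous F} <-> (forall q, continuous_seminorm q -> qcont q F x).
Proof.
split=> [cF q qs e e0|H].
  have /cvg_seminormP/(_ q qs e e0) := cF.
  by move=> /nbhs_rVP[d d0 dP]; exists d.
apply/(@cvg_seminormP _ _ _ (nbhs x)) => q qs e e0.
by apply/nbhs_rVP; exact: H.
Qed.

Lemma qdiffP F y x l : is_dirderiv F y x l <->
  (forall q, continuous_seminorm q -> qdiff q F y x l).
Proof.
have key (q : E -> R) (t : R) (D : E) : continuous_seminorm q -> t != 0 ->
    q (D - t *: l) = q (t^-1 *: D - l) * `|t|.
  move=> qs t0; rewrite mulrC -(semiZ qs) scalerBr scalerA divff//.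
  by rewrite scale1r.
split=> [Fl q qs e e0|H].
  have /cvg_seminormP/(_ q qs e e0) := Fl.
  rewrite near_withinE => /nbhs_normP[d /= d0 dP]; exists d => // t td.
  have [->|t0] := eqVneq t 0.
    by rewrite !scale0r addr0 !subrr (semi0 qs) normr0 mulr0.
  rewrite key// ler_pM2r ?normr_gt0//; apply: dP => //.
  by rewrite /ball_ /= sub0r normrN.
apply/cvg_seminormP => q qs e e0; have [d d0 dP] := H q qs e e0.
rewrite near_withinE; apply/nbhs_normP; exists d => // t.
rewrite /ball_ /= sub0r normrN => td t0; have := dP t td.
by rewrite key// ler_pM2r ?normr_gt0.
Qed.

End Derivatives.

(** * Families of partial derivatives indexed by words *)

Section WordFamilies.
Context {R : realType} {n : nat} {E : lcsType R}.
Implicit Types (F G H : 'rV[R]_n -> E) (x y : 'rV[R]_n) (w : seq 'I_n).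
Implicit Types (D : set 'rV[R]_n).

Local Notation "''e_' i" := (delta_mx 0 i : 'rV[R]_n) (at level 8, i at level 2).

Section OneSeminorm.
Variable q : E -> R.
Hypothesis qs : continuous_seminorm q.

Lemma qcont_near F G x r : 0 < r -> (forall y, `|y - x| < r -> F y = G y) ->
  qcont q F x -> qcont q G x.
Proof.
move=> r0 FG cF e e0; have [d d0 dP] := cF e e0.
exists (Num.min d r); first by rewrite lt_min d0.
move=> y; rewrite lt_min => /andP[yd yr].
by rewrite -!FG ?subrr ?normr0//; exact: dP.
Qed.

Lemma qdiff_near F G y x l r : 0 < r -> (forall z, `|z - x| < r -> F z = G z) ->
  qdiff q F y x l -> qdiff q G y x l.
Proof.
move=> r0 FG dF e e0; have [d d0 dP] := dF e e0.
have y0 : 0 < `|y| + 1 by have := normr_ge0 y; lra.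
exists (Num.min d (r / (`|y| + 1))); first by rewrite lt_min d0 divr_gt0.
move=> t; rewrite lt_min => /andP[td tr].
rewrite -!FG ?subrr ?normr0//; first exact: dP.
rewrite addrAC subrr add0r normrZ.
by move: tr; rewrite ltr_pdivlMr//; have := normr_ge0 t; nra.
Qed.

Lemma qcont_cst (c : E) x : qcont q (fun=> c) x.
Proof. by move=> e e0; exists 1 => // y _; rewrite subrr (semi0 qs) ltW. Qed.

Lemma qdiff_cst (c : E) y x : qdiff q (fun=> c) y x 0.
Proof.
move=> e e0; exists 1 => // t _.
by rewrite subrr scaler0 subrr (semi0 qs) mulr_ge0// ltW.
Qed.

Lemma qcont_lin (c : R) F G x : qcont q F x -> qcont q G x ->
  qcont q (fun y => c *: F y + G y) x.
Proof.
move=> cF cG e e0; have c1 : 0 < `|c| + 1 by have := normr_ge0 c; lra.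
have [|d d0 dP] := cF (e / 2 / (`|c| + 1)); first by rewrite !divr_gt0.
have [|d' d'0 d'P] := cG (e / 2); first by rewrite divr_gt0.
exists (Num.min d d'); first by rewrite lt_min d0.
move=> y; rewrite lt_min => /andP[/dP yd /d'P yd'].
rewrite opprD addrACA -scalerBr (le_trans (semi_le qs _ _))// (semiZ qs).
move: yd; rewrite ler_pdivlMr//.
by have := semi_ge0 qs (F y - F x); nra.
Qed.

Lemma qdiff_lin (c : R) F G y x l m : qdiff q F y x l -> qdiff q G y x m ->
  qdiff q (fun y => c *: F y + G y) y x (c *: l + m).
Proof.
move=> dF dG e e0; have c1 : 0 < `|c| + 1 by have := normr_ge0 c; lra.
have [|d d0 dP] := dF (e / 2 / (`|c| + 1)); first by rewrite !divr_gt0.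
have [|d' d'0 d'P] := dG (e / 2); first by rewrite divr_gt0.
exists (Num.min d d'); first by rewrite lt_min d0.
move=> t; rewrite lt_min => /andP[/dP yd /d'P yd'].
have -> : c *: F (x + t *: y) + G (x + t *: y) - (c *: F x + G x) -
    t *: (c *: l + m) = c *: (F (x + t *: y) - F x - t *: l) +
    (G (x + t *: y) - G x - t *: m).
  by rewrite scalerDr scalerA [t * c]mulrC -scalerA; zmod.
rewrite (le_trans (semi_le qs _ _))// (semiZ qs).
move: yd; rewrite mulrAC ler_pdivlMr//.
by have := semi_ge0 qs (F (x + t *: y) - F x - t *: l); nra.
Qed.

Lemma qcont_sum (I : Type) (r : seq I) (c : I -> R) (F : I -> _ -> E) x :
  (forall i, qcont q (F i) x) ->
  qcont q (fun y => \sum_(i <- r) c i *: F i y) x.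
Proof.
move=> cF; elim: r => [|i r IH].
  under eq_fun do rewrite big_nil; exact: qcont_cst.
rewrite (_ : (fun z => _) =
  fun z => c i *: F i z + \sum_(j <- r) c j *: F j z); first exact: qcont_lin.
by apply/funext => z; rewrite big_cons.
Qed.

Lemma qdiff_sum (I : Type) (r : seq I) (c : I -> R) (F : I -> _ -> E) y x l :
  (forall i, qdiff q (F i) y x (l i)) ->
  qdiff q (fun y => \sum_(i <- r) c i *: F i y) y x (\sum_(i <- r) c i *: l i).
Proof.
move=> dF; elim: r => [|i r IH].
  under eq_fun do rewrite big_nil; rewrite big_nil; exact: qdiff_cst.
rewrite big_cons (_ : (fun z => _) =
  fun z => c i *: F i z + \sum_(j <- r) c j *: F j z); first exact: qdiff_lin.
by apply/funext => z; rewrite big_cons.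
Qed.

Lemma qdiffZ (s : R) F y x l : qdiff q F y x l -> qdiff q F (s *: y) x (s *: l).
Proof.
move=> dF e e0; have s1 : 0 < `|s| + 1 by have := normr_ge0 s; lra.
have [|d d0 dP] := dF (e / (`|s| + 1)); first by rewrite divr_gt0.
exists (d / (`|s| + 1)); first by rewrite divr_gt0.
move=> t; rewrite ltr_pdivlMr// => td.
have := dP (t * s); rewrite !scalerA normrM.
move=> H; have {H}/H : `|t| * `|s| < d by have := normr_ge0 t; nra.
move=> /le_trans; apply; rewrite mulrAC ler_pdivrMr// -mulrA ler_wpM2l//.
  exact: ltW.
by have := normr_ge0 t; nra.
Qed.

Lemma qdiff_qder01 F (F' : R -> E) x y :
  (forall t, 0 <= t <= 1 -> qdiff q F y (x + t *: y) (F' t)) ->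
  qder01 q (fun t => F (x + t *: y)) F'.
Proof.
move=> dF t t01 e e0; have [d d0 dP] := dF t t01 e e0; exists d => // t' _.
by move=> /dP; rewrite -(addrA x) -scalerDl subrKC.
Qed.

(** [G (i :: w)] is the [i]-th partial derivative of [G w]: a function is
    presented together with its iterated partial derivatives, indexed by words
    in which the outermost derivative comes first. *)
Definition semi_ck_family D (k : nat) (G : seq 'I_n -> 'rV[R]_n -> E) :=
  forall x, D x -> forall w,
    ((size w <= k)%N -> qcont q (G w) x) /\
    ((size w < k)%N -> forall i, qdiff q (G w) 'e_i x (G (i :: w) x)).

Variables (D : set 'rV[R]_n) (k : nat) (G : seq 'I_n -> 'rV[R]_n -> E).
Hypotheses (oD : open D) (GD : semi_ck_family D k G).

Lemma open_ball x : D x -> exists2 r : R, 0 < r & forall y, `|y - x| < r -> D y.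
Proof. by move=> Dx; apply/nbhs_rVP/open_nbhs_nbhs; split. Qed.

(** Moving one coordinate at a time from [x] to [x + v], each step is
    controlled by the mean value inequality. *)
Lemma total_diff x w : D x -> (size w < k)%N -> forall e : R, 0 < e ->
  exists2 d, 0 < d & forall v, `|v| < d ->
    q (G w (x + v) - G w x - \sum_i v 0 i *: G (i :: w) x) <= e * `|v|.
Proof.
move=> Dx wk e e0.
have n1 : (0 : R) < n%:R + 1 by have := ler0n R n; lra.
pose e' := e / (n%:R + 1).
have e'0 : 0 < e' by rewrite divr_gt0.
have [r r0 rD] := open_ball Dx.
have [d d0 dP] : exists2 d : R, 0 < d & forall i y, `|y - x| < d ->
    q (G (i :: w) y - G (i :: w) x) <= e'.
  apply: (@fin_delta R 'I_n (fun i d => forall y, `|y - x| < d ->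
    q (G (i :: w) y - G (i :: w) x) <= e')).
    by move=> i d d' dd' H y yd; apply: H; lra.
  by move=> i; have [+ _] := GD Dx (i :: w); move=> /(_ wk _ e'0).
exists (Num.min r d); first by rewrite lt_min r0.
move=> v; rewrite lt_min => /andP[vr vd].
pose p (j : nat) : 'rV[R]_n := x + \row_i (if (i < j)%N then v 0 i else 0).
have step (j : 'I_n) :
    q (G w (p j.+1) - G w (p j) - v 0 j *: G (j :: w) x) <= `|v| * e'.
  have pS : p j.+1 = p j + v 0 j *: 'e_j.
    apply/rowP => i; rewrite !mxE eqxx /= -addrA; congr (_ + _).
    rewrite ltnS leq_eqVlt eq_sym; have [->|ij] := eqVneq i j.
      by rewrite eqxx /= ltnn add0r mulr1.
    rewrite (_ : (j == i :> nat) = false) ?mulr0 ?addr0//.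
    by apply/negbTE; rewrite eq_sym.
  have near_p t : 0 <= t <= 1 -> `|p j + t *: (v 0 j *: 'e_j) - x| <= `|v|.
    move=> /andP[t0 t1]; apply: norm_le_coord => // i; rewrite !mxE eqxx /=.
    rewrite -(addrA (x 0 i)) addrAC subrr add0r.
    have [->|ij] := eqVneq i j.
      rewrite ltnn add0r mulr1 normrM ger0_norm//.
      by rewrite (le_trans _ (coord_le v j))// ler_piMl.
    rewrite !mulr0 addr0; case: ifP => _; first exact: coord_le.
    by rewrite normr0.
  have dF t : 0 <= t <= 1 -> qdiff q (G w) (v 0 j *: 'e_j)
      (p j + t *: (v 0 j *: 'e_j)) (v 0 j *: G (j :: w) (p j + t *: (v 0 j *: 'e_j))).
    move=> t01; apply: qdiffZ; apply: (GD _ w).2 => //.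
    by apply: rD; rewrite (le_lt_trans (near_p t t01)).
  have := mean_value qs (qdiff_qder01 dF) (c := v 0 j *: G (j :: w) x)
    (M := `|v| * e') (b := 1).
  rewrite scale0r addr0 !scale1r -pS mulr1; apply; last lra.
  move=> t t01; rewrite -scalerBr (semiZ qs) ler_pM ?coord_le ?(semi_ge0 qs)//.
  by apply: dP; rewrite (le_lt_trans (near_p t t01)).
have tele (j : nat) : (j <= n)%N ->
    q (G w (p j) - G w x - \sum_(i < n | (i < j)%N) v 0 i *: G (i :: w) x) <=
    (\sum_(i < n | (i < j)%N) `|v| * e').
  elim: j => [_|j IH jn].
    rewrite !big_pred0// /p (_ : \row_i _ = 0).
      by rewrite addr0 !subrr (semi0 qs).
    by apply/rowP => i; rewrite !mxE.
  have jE (V : zmodType) (F : 'I_n -> V) : \sum_(i < n | (i < j.+1)%N) F i =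
      F (Ordinal jn) + \sum_(i < n | (i < j)%N) F i.
    rewrite (bigD1 (Ordinal jn)) ?ltnSn//=; congr (_ + _).
    apply: eq_bigl => i; rewrite ltnS -val_eqE /=.
    by case: ltngtP.
  rewrite !{}jE; have := IH (ltnW jn); have := step (Ordinal jn); move=> /=.
  set u := G w (p j.+1); set u' := G w (p j); set S := \sum_(i < n | _) _.
  move=> H1 H2; rewrite [leRHS]addrC.
  have -> : u - G w x - (v 0 (Ordinal jn) *: G (Ordinal jn :: w) x + S) =
    (u' - G w x - S) + (u - u' - v 0 (Ordinal jn) *: G (Ordinal jn :: w) x).
    zmod.
  by rewrite (le_trans (semi_le qs _ _))// lerD.
have := tele n (leqnn n).
have -> : p n = x + v.
  by congr (_ + _); apply/rowP => i; rewrite !mxE ltn_ord.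
rewrite (eq_bigl xpredT); last by move=> i; rewrite ltn_ord.
move=> /le_trans; apply; rewrite (eq_bigl xpredT); last by move=> i; rewrite ltn_ord.
rewrite sumr_const card_ord -mulr_natl mulrC.
rewrite [leRHS]mulrC -mulrA ler_wpM2l//.
by rewrite /e' mulrAC ler_pdivrMr// ler_wpM2l ?ltW// ltrDl.
Qed.

End OneSeminorm.

End WordFamilies.

(** * Functions with a word family of derivatives are of class C^k *)

Section SubspaceTopology.
Context {R : realType} {n : nat} {E : lcsType R} (U : set 'rV[R]_n).

Lemma nbhs_setP (x : U) (P : set U) : nbhs x P <->
  exists2 d : R, 0 < d & forall y : U, `|\val y - \val x| < d -> P y.
Proof.
rewrite nbhs_ballP; split=> -[d /= d0 dP]; exists d => // y.
  move=> yx; apply: dP; change (ball (\val x) d (\val y)).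
  by rewrite -ball_normE /= distrC.
move=> yx; apply: dP; move: yx.
change (ball (\val x) d (\val y) -> `|\val y - \val x| < d).
by rewrite -ball_normE /= distrC.
Qed.

Lemma continuous_setP (g : U -> E) : continuous g <->
  (forall q, continuous_seminorm q -> forall (x : U) (e : R), 0 < e ->
    exists2 d : R, 0 < d & forall y : U, `|\val y - \val x| < d ->
      q (g y - g x) <= e).
Proof.
split=> [cg q qs x e e0|H x].
  by have /cvg_seminormP/(_ q qs e e0)/nbhs_setP := cg x.
apply/(@cvg_seminormP _ _ _ (nbhs x)) => q qs e e0.
by apply/nbhs_setP; exact: H.
Qed.

(** The interior is dense and [E] is separated. *)
Lemma dense_continuous_eq (g h : U -> E) : dense_interior U ->
  continuous g -> continuous h -> (forall x : U, U° (\val x) -> g x = h x) ->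
  g = h.
Proof.
move=> dU /continuous_setP cg /continuous_setP ch gh; apply/funext => x.
apply: seminorm_eq => q qs; apply/eqP; rewrite eq_le (semi_ge0 qs) andbT.
apply/ler_addgt0Pr => e e0; rewrite add0r.
have e2 : 0 < e / 2 by rewrite divr_gt0.
have [d d0 dP] := cg q qs x _ e2; have [d' d'0 d'P] := ch q qs x _ e2.
have : closure U° (\val x) by apply/dU/set_valP.
move=> /(_ (ball (\val x) (Num.min d d'))).
have m0 : 0 < Num.min d d' by rewrite lt_min d0.
move=> /(_ (nbhsx_ballx _ _ m0))[z [Uz]].
rewrite -ball_normE /= distrC lt_min => /andP[zd zd'].
have Uz' : U z := interior_subset Uz.
pose z' : U := exist _ z (mem_set Uz').
have H1 := dP z' zd; have H2 := d'P z' zd'.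
have H3 : g z' = h z' by exact: gh.
have := semi_tri qs (g x) (g z') (h x); rewrite (semiBC qs (g x) (g z')) {2}H3; lra.
Qed.

Lemma valL0_val (f : U -> E) (x : U) : valL_ 0 f (\val x) = f x.
Proof. by rewrite /valL_ /= oinv_set_val /= valK. Qed.

End SubspaceTopology.

Section Words.
Context {n : nat}.
Implicit Types (w : seq 'I_n) (a : multinom n).

Definition word_mnm w : multinom n := Multinom [tuple count_mem i w | i < n].

(** The letters appear in increasing order, which is the order in which
    [iter_partial] composes the partial derivatives. *)
Definition mnm_word a : seq 'I_n := flatten [seq nseq (a i) i | i <- enum 'I_n].

Lemma word_mnmE w i : word_mnm w i = count_mem i w.
Proof. by rewrite /word_mnm mnmE. Qed.

Lemma word_mnm_cons i w : word_mnm (i :: w) = mnm_add (mnm1 i) (word_mnm w).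
Proof. by apply/mnmP => j; rewrite mnmDE !word_mnmE mnm1E. Qed.

Lemma word_mnm_nil : word_mnm [::] = mnm0.
Proof. by apply/mnmP => j; rewrite !mnmE. Qed.

Lemma mdeg_word_mnm w : mdeg (word_mnm w) = size w.
Proof.
by elim: w => [|i w IH]; rewrite ?word_mnm_nil ?mdeg0// word_mnm_cons mdegD mdeg1 IH.
Qed.

Lemma mnm_wordK a : word_mnm (mnm_word a) = a.
Proof.
apply/mnmP => i; rewrite word_mnmE /mnm_word count_flatten -map_comp sumnE big_map.
rewrite big_enum /= (bigD1 i) //= count_nseq /= eqxx mul1n big1 ?addn0// => j ji.
by rewrite count_nseq /= (negPf ji).
Qed.

Lemma size_mnm_word a : size (mnm_word a) = mdeg a.
Proof. by rewrite -mdeg_word_mnm mnm_wordK. Qed.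

End Words.

Section CkOfFamily.
Context {R : realType} {n : nat} {E : lcsType R}.
Implicit Types (F : 'rV[R]_n -> E) (x y : 'rV[R]_n) (w : seq 'I_n).
Implicit Types (D : set 'rV[R]_n) (k : nat) (G : seq 'I_n -> 'rV[R]_n -> E).

Local Notation "''e_' i" := (delta_mx 0 i : 'rV[R]_n) (at level 8, i at level 2).

Definition ck_family D k G :=
  forall q, continuous_seminorm q -> semi_ck_family q D k G.

(** Total differentiability makes the derivative linear in the direction. *)
Lemma ck_family_dirderiv D k G y x w : open D -> ck_family D k G -> D x ->
  (size w < k)%N -> is_dirderiv (G w) y x (\sum_i y 0 i *: G (i :: w) x).
Proof.
move=> oD GD Dx wk; apply/qdiffP => q qs e e0.
have y0 : 0 < `|y| + 1 by have := normr_ge0 y; lra.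
have [|d d0 dP] := total_diff qs oD (GD q qs) Dx wk (e := e / (`|y| + 1)).
  by rewrite divr_gt0.
exists (d / (`|y| + 1)); first by rewrite divr_gt0.
move=> t; rewrite ltr_pdivlMr// => td.
have := dP (t *: y); rewrite normrZ => H.
have {H}/H : `|t| * `|y| < d by have := normr_ge0 t; nra.
rewrite scaler_sumr; under eq_bigr do rewrite mxE -scalerA.
move=> /le_trans; apply; rewrite mulrAC ler_pdivrMr// -mulrA ler_wpM2l//.
  exact: ltW.
by have := normr_ge0 t; nra.
Qed.

(** The derivative in the direction [y] of the function presented by the family
    [g] at a point. The letter [i] goes to the end of the word, because this
    derivative is taken before those which [w] stands for. *)
Definition along y (g : seq 'I_n -> E) w : E := \sum_i y 0 i *: g (rcons w i).

Lemma ck_family_along D k G y : ck_family D k.+1 G ->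
  ck_family D k (fun w x => along y (G^~ x) w).
Proof.
move=> GD q qs x Dx w; split=> [wk|wk i].
  by apply: qcont_sum => // i; apply: (GD q qs x Dx _).1; rewrite size_rcons.
apply: (@qdiff_sum _ _ _ _ qs _ _ _ _ _ _ (fun j => G (i :: rcons w j) x)) => j.
by apply: (GD q qs x Dx _).2; rewrite size_rcons.
Qed.

(** By linearity in each direction, an iterated directional derivative is a
    combination of values of the family. *)
Lemma ck_family_iter D k F G ys : open D -> ck_family D k G ->
  (size ys <= k)%N -> (forall x, D x -> F x = G [::] x) ->
  iter_dirderivable D ys F /\
  forall x, D x ->
    iter_dirderiv ys F x = foldl (fun g y => along y g) (G^~ x) ys [::].
Proof.
move=> oD; elim: ys k F G => [|y ys IH] k F G GD yk FG /=.
  by split=> // x /FG.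
case: k yk GD => // k yk GD.
have dF x : D x -> is_dirderiv F y x (along y (G^~ x) [::]).
  move=> Dx; have := @ck_family_dirderiv _ _ G y _ [::] oD GD Dx (ltn0Sn _).
  move=> /qdiffP dG; apply/qdiffP => q qs.
  have [r r0 rD] := open_ball oD Dx.
  by apply: (@qdiff_near _ _ _ q (G [::]) F y x _ r) (dG q qs) => // z /rD /FG.
have [|H1 H2] := IH _ (dirderiv y F) _ (ck_family_along y GD) yk.
  by move=> x Dx; apply/dirderiv_unique/dF.
split=> //; split=> // x Dx; eexists; exact: dF.
Qed.

Lemma cvg_scale (T : Type) (S : set_system T) {FS : Filter S}
    (c : T -> R) (f : T -> E) (b : R) (u : E) :
  c @ S --> b -> f @ S --> u -> (fun t => c t *: f t) @ S --> b *: u.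
Proof.
move=> cb fu.
have /= := @cvg_comp2 T R^o E E S (nbhs (b : R^o)) (nbhs u) (nbhs (b *: u))
  _ _ _ c f (fun a v => a *: v) cb fu.
by apply; exact: (@scale_continuous R E (b, u)).
Qed.

Lemma cvg_sum_scale (T I : Type) (S : set_system T) {FS : Filter S}
    (r : seq I) (c : I -> T -> R) (f : I -> T -> E) (b : I -> R) (u : I -> E) :
  (forall i, c i @ S --> b i) -> (forall i, f i @ S --> u i) ->
  (fun t => \sum_(i <- r) c i t *: f i t) @ S --> \sum_(i <- r) b i *: u i.
Proof.
move=> cb fu; elim: r => [|i r IH].
  rewrite big_nil (_ : (fun t => _) = fun=> 0); first exact: cvg_cst.
  by apply/funext => t; rewrite big_nil.
rewrite big_cons (_ : (fun t => _) =
  fun t => 1 *: (c i t *: f i t) + \sum_(j <- r) c j t *: f j t).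
  by rewrite -(scale1r (b i *: u i)); apply: cvg_lin => //; exact: cvg_scale.
by apply/funext => t; rewrite big_cons scale1r.
Qed.

Lemma foldl_along_continuous (T : topologicalType) (ys : seq (T -> 'rV[R]_n))
    (g : T -> seq 'I_n -> E) (t : T) :
  (forall j, (j < size ys)%N -> {for t, continuous (nth (fun=> 0) ys j)}) ->
  (forall w, (size w <= size ys)%N -> {for t, continuous (g ^~ w)}) ->
  {for t, continuous (fun s =>
    foldl (fun g y => along y g) (g s) [seq (u s : 'rV[R]_n) | u <- ys] [::])}.
Proof.
elim: ys g => [|y ys IH] g cy cg /=; first exact: cg.
apply: (IH (fun s => along (y s) (g s))) => [j|w wys]; first exact: (cy j.+1).
have cyi i : (fun s => y s 0 i) @ t --> y t 0 i.
  have cy0 : y s @[s --> t] --> y t := cy 0%N isT.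
  apply: (@cvg_comp _ _ _ y (fun M : 'rV[R]_n => M 0 i) _ _ _ cy0).
  exact: (@coord_continuous R 1 n 0 i (y t)).
apply: cvg_sum_scale => // i; apply: cg.
by rewrite size_rcons.
Qed.

Lemma continuous_family (V D : set 'rV[R]_n) k G w : V `<=` D ->
  ck_family D k G -> (size w <= k)%N -> continuous (fun x : V => G w (\val x)).
Proof.
move=> VD GD wk; apply/continuous_setP => q qs x e e0.
have Dx : D (\val x) by apply/VD/set_valP.
have [d d0 dP] := (GD q qs _ Dx w).1 wk e e0; exists d => // y; exact: dP.
Qed.

Lemma row_continuous l (i : 'I_l) : continuous (@row R l n i).
Proof.
move=> Y V /nbhs_rVP[d d0 dP]; apply/(@nbhs_normP R 'M[R]_(l, n)).
exists d => // Z; rewrite /ball_ /= distrC => ZY; apply: dP.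
rewrite -raddfB; apply: le_lt_trans ZY.
apply: norm_le_coord => // j; rewrite mxE /Num.norm /= mx_normrE.
by rewrite (le_bigmax _ (fun ij => `|(Z - Y) ij.1 ij.2|) (i, j)).
Qed.

Section OnU.
Variables (U D : set 'rV[R]_n) (k : nat) (G : seq 'I_n -> 'rV[R]_n -> E).
Hypotheses (UD : U `<=` D) (GD : ck_family D k G).

Let f (x : U) : E := G [::] (\val x).

Let valLf x : U x -> valL_ 0 f x = G [::] x.
Proof.
move=> Ux; have := valL0_val f (exist _ x (mem_set Ux)).
by rewrite /f /= => ->.
Qed.

Let GU : ck_family U° k G.
Proof. by move=> q qs x /interior_subset/UD Dx; exact: (GD qs Dx). Qed.

Let cts_foldl (V : set 'rV[R]_n) l : V `<=` D -> (l <= k)%N ->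
  continuous (fun z : V * 'M[R]_(l, n) =>
    foldl (fun g y => along y g) (G^~ (\val z.1)) (rowseq z.2) [::]).
Proof.
move=> VD lk z; set ys := [seq (fun z : V * 'M[R]_(l, n) => row i z.2) | i <- enum 'I_l].
have -> : (fun z : V * 'M[R]_(l, n) =>
      foldl (fun g y => along y g) (G^~ (\val z.1)) (rowseq z.2) [::]) =
    (fun z => foldl (fun g y => along y g) (G^~ (\val z.1))
      [seq (u z : 'rV[R]_n) | u <- ys] [::]).
  by apply/funext => s; rewrite /rowseq /ys -map_comp.
apply: foldl_along_continuous => [j|w].
  rewrite size_map size_enum_ord => jl.
  have -> : nth (fun=> 0) ys j = (fun s : V * 'M[R]_(l, n) => row (Ordinal jl) s.2).
    by rewrite (nth_map (Ordinal jl)) ?size_enum_ord// (nth_ord_enum _ (Ordinal jl)).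
  apply: (@cvg_comp _ _ _ snd (row _) _ _ _ cvg_snd).
  exact: row_continuous.
rewrite size_map size_enum_ord => wl.
apply: (@cvg_comp _ _ _ fst (fun x : V => G w (\val x)) _ _ _ cvg_fst).
exact: (continuous_family VD GD (leq_trans wl lk)).
Qed.

(** The combinations of [ck_family_iter] make sense and are continuous on all of
    [D], so they extend the iterated directional derivatives from the interior
    of [U] to [U]. *)
Lemma is_Ck_family : is_Ck k f.
Proof.
split; first exact: continuous_family UD GD _.
move=> l /andP[l1 lk] /=.
have szY (Y : 'M[R]_(l, n)) : (size (rowseq Y) <= k)%N.
  by rewrite size_map size_enum_ord.
have iter Y := ck_family_iter (@open_interior _ U) GU (szY Y)
  (fun x Ux => valLf (interior_subset Ux)).
split=> [Y||].
- by have [] := iter Y.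
- have UD' : U° `<=` D by move=> x /interior_subset/UD.
  rewrite (_ : (fun z => _) = (fun z : set_type U° * 'M[R]_(l, n) =>
    foldl (fun g y => along y g) (G^~ (\val z.1)) (rowseq z.2) [::])).
    exact: cts_foldl.
  by apply/funext => -[x Y] /=; have [_ ->//] := iter Y; exact: set_valP.
- exists (fun z : U * 'M[R]_(l, n) =>
    foldl (fun g y => along y g) (G^~ (\val z.1)) (rowseq z.2) [::]).
  split; first exact: cts_foldl.
  by move=> x Y Ux /=; have [_ ->//] := iter Y.
Qed.

Lemma iter_partialE (a : multinom n) (F : 'rV[R]_n -> E) :
  iter_partial a F = foldr (fun i H => dirderiv 'e_i H) F (mnm_word a).
Proof.
rewrite /iter_partial /mnm_word; elim: (enum 'I_n) => //= i s ->.
by rewrite foldr_cat; elim: (a i) => //= m ->.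
Qed.

Lemma foldr_dirderiv V F w : open V -> ck_family V k G ->
  (size w <= k)%N -> (forall x, V x -> F x = G [::] x) ->
  forall x, V x -> foldr (fun i H => dirderiv 'e_i H) F w x = G w x.
Proof.
move=> oV GV + FG; elim: w => [_|i w IH wk] x Vx; first exact: FG.
apply: dirderiv_unique; apply/qdiffP => q qs.
have [r r0 rV] := open_ball oV Vx.
apply: (@qdiff_near _ _ _ q (G w) _ _ x _ r) => //.
  by move=> z /rV Vz; rewrite -IH// ltnW.
exact: (GV q qs x Vx w).2.
Qed.

Lemma partial_family (a : multinom n) (x : U) : dense_interior U ->
  (mdeg a <= k)%N -> partial a f x = G (mnm_word a) (\val x).
Proof.
move=> dU ak; rewrite /partial; set P := [set g | _].
have wk : (size (mnm_word a) <= k)%N by rewrite size_mnm_word.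
have PG : P (fun x : U => G (mnm_word a) (\val x)).
  split=> [|y Uy]; first exact: continuous_family UD GD _.
  rewrite iter_partialE (foldr_dirderiv (@open_interior _ U) GU)// => z Uz.
  by rewrite valLf//; exact: interior_subset Uz.
have [cx xE] := xgetPex (fun=> 0) (ex_intro _ _ PG).
suff -> : xget (fun=> 0) P = fun x : U => G (mnm_word a) (\val x) by [].
apply: dense_continuous_eq => // [|y Uy]; first exact: continuous_family UD GD _.
by rewrite xE// -PG.2.
Qed.

End OnU.

End CkOfFamily.

(** * Symmetry of the derivatives; functions of class C^k on U *)

Section Schwarz.
Context {R : realType} {n : nat} {E : lcsType R}.
Implicit Types (x y : 'rV[R]_n) (w : seq 'I_n).
Variables (D : set 'rV[R]_n) (k : nat) (G : seq 'I_n -> 'rV[R]_n -> E).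
Hypotheses (oD : open D) (GD : ck_family D k G).

Local Notation "''e_' i" := (delta_mx 0 i : 'rV[R]_n) (at level 8, i at level 2).

(** The mean value inequality, applied in the direction [j] and then in the
    direction [i], compares the second difference with [s ^+ 2] times the
    mixed derivative. *)
Lemma second_difference q x w i j : continuous_seminorm q -> D x ->
  (size w + 2 <= k)%N -> forall e : R, 0 < e -> exists2 d, 0 < d &
  forall s : R, 0 < s < d ->
    q (G w (x + s *: 'e_i + s *: 'e_j) - G w (x + s *: 'e_j) -
      (G w (x + s *: 'e_i) - G w x) - (s * s) *: G [:: i, j & w] x) <=
    e * (s * s).
Proof.
move=> qs Dx wk e e0; have [r r0 rD] := open_ball oD Dx.
have [|d d0 dP] := (GD qs Dx [:: i, j & w]).1 _ e e0; first by rewrite addn2 in wk.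
have wk' : ((size w).+1 < k)%N by rewrite addn2 in wk.
exists (Num.min r d / 2); first by rewrite divr_gt0// lt_min r0.
move=> s /andP[s0]; rewrite ltr_pdivlMr// lt_min => /andP[sr sd].
have sz_le v (t : R) l : 0 <= t <= 1 -> `|v + t *: (s *: 'e_l) - x| <= `|v - x| + s.
  move=> /andP[t0 t1]; rewrite addrAC (le_trans (ler_normD _ _))// lerD2l.
  rewrite !normrZ (ger0_norm t0) gtr0_norm//.
  by rewrite mulrCA ger_pMr// mulr_ile1// norm_delta.
have dline v w' l : (size w' < k)%N ->
    (forall t : R, 0 <= t <= 1 -> D (v + t *: (s *: 'e_l))) ->
    qder01 q (fun t => G w' (v + t *: (s *: 'e_l)))
      (fun t => s *: G (l :: w') (v + t *: (s *: 'e_l))).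
  move=> w'k Dv; apply: qdiff_qder01 => // t t01; apply: qdiffZ => //.
  by apply: (GD qs _ w').2 => //; exact: Dv.
have xx : `|x - x| = 0 by rewrite subrr normr0.
have x1 : `|x + s *: 'e_i - x| <= s.
  by have := sz_le x 1 i; rewrite scale1r xx; lra.
pose h t := G w (x + s *: 'e_i + t *: (s *: 'e_j)) - G w (x + t *: (s *: 'e_j)).
pose h' t := s *: G (j :: w) (x + s *: 'e_i + t *: (s *: 'e_j)) -
  s *: G (j :: w) (x + t *: (s *: 'e_j)).
have dh : qder01 q h h'.
  apply: qder01B => //; (apply: dline => [|t t01]; first exact: ltnW); apply: rD.
    by have := sz_le (x + s *: 'e_i) t j t01; lra.
  by have := sz_le x t j t01; rewrite xx; lra.
have hM t : 0 <= t <= 1 -> q (h' t - (s * s) *: G [:: i, j & w] x) <= e * (s * s).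
  move=> t01; set v := x + t *: (s *: 'e_j).
  have vx : `|v - x| <= s by have := sz_le x t j t01; rewrite xx add0r.
  have vi (b : R) : 0 <= b <= 1 -> `|v + b *: (s *: 'e_i) - x| <= s * 2.
    by move=> b01; have := sz_le v b i b01; lra.
  have dv : qder01 q (fun b => G (j :: w) (v + b *: (s *: 'e_i)))
      (fun b => s *: G [:: i, j & w] (v + b *: (s *: 'e_i))).
    apply: dline => [//|b b01].
    by apply: rD; have := vi b b01; lra.
  have := mean_value qs dv (c := s *: G [:: i, j & w] x) (M := s * e) (b := 1).
  rewrite scale0r addr0 !scale1r mulr1 => H.
  have -> : h' t - (s * s) *: G [:: i, j & w] x = s *: (G (j :: w) (v + s *: 'e_i) -
      G (j :: w) v - s *: G [:: i, j & w] x).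
    by rewrite /h' (addrAC x (s *: 'e_i)) -/v !scalerBr scalerA.
  rewrite (semiZ qs) gtr0_norm// mulrCA ler_wpM2l//; first exact: ltW.
  rewrite mulrC; apply: H; last lra.
  move=> b b01; rewrite -scalerBr (semiZ qs) gtr0_norm// ler_wpM2l//.
    exact: ltW.
  by apply: dP; have := vi b b01; lra.
have := mean_value qs dh hM (b := 1).
rewrite /h !scale1r !scale0r !addr0 mulr1; apply; lra.
Qed.

(** Both mixed derivatives are close to the same second difference divided by
    [s ^+ 2]. *)
Lemma schwarz x w i j : D x -> (size w + 2 <= k)%N ->
  G [:: i, j & w] x = G [:: j, i & w] x.
Proof.
move=> Dx wk; apply: seminorm_eq => q qs; apply/eqP.
rewrite eq_le (semi_ge0 qs) andbT; apply/ler_addgt0Pr => e e0; rewrite add0r.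
have e2 : 0 < e / 2 by rewrite divr_gt0.
have [d d0 dP] := second_difference i j qs Dx wk e2.
have [d' d'0 d'P] := second_difference j i qs Dx wk e2.
pose s := Num.min d d' / 2.
have m0 : 0 < Num.min d d' by rewrite lt_min d0.
have md : Num.min d d' <= d by rewrite ge_min lexx.
have md' : Num.min d d' <= d' by rewrite ge_min lexx orbT.
have s0 : 0 < s by rewrite /s; lra.
have := dP s ltac:(rewrite /s; lra); have := d'P s ltac:(rewrite /s; lra).
rewrite (addrAC x (s *: 'e_j)).
set a := G w (_ + _ + _); set b := G w (x + _); set c := G w (x + _).
have -> : a - b - (c - G w x) = a - c - (b - G w x) by zmod.
set u := a - c - _ => H1 H2.
have ss : 0 < s * s by rewrite mulr_gt0.
have : q ((s * s) *: (G [:: i, j & w] x - G [:: j, i & w] x)) <= e * (s * s).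
  have -> : (s * s) *: (G [:: i, j & w] x - G [:: j, i & w] x) =
    (u - (s * s) *: G [:: j, i & w] x) - (u - (s * s) *: G [:: i, j & w] x).
    by rewrite scalerBr; zmod.
  by rewrite (le_trans (semi_leB qs _ _))//; lra.
by rewrite (semiZ qs) gtr0_norm// mulrC ler_pM2r.
Qed.

Let cons_eq i w w' : (size w < k)%N -> (size w' < k)%N ->
  (forall x, D x -> G w x = G w' x) -> forall x, D x -> G (i :: w) x = G (i :: w') x.
Proof.
move=> wk wk' ww x Dx; have [r r0 rD] := open_ball oD Dx.
have d v : (size v < k)%N -> is_dirderiv (G v) 'e_i x (G (i :: v) x).
  by move=> vk; apply/qdiffP => q qs; exact: (GD qs Dx v).2.
rewrite -(dirderiv_unique (d w wk)); apply: dirderiv_unique.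
apply/qdiffP => q qs.
apply: (@qdiff_near _ _ _ q (G w') _ _ x _ r) => //.
  by move=> z /rD /ww.
by move/qdiffP: (d w' wk'); apply.
Qed.

(** Exchanges of adjacent letters suffice to bring any letter to the front. *)
Lemma ck_family_perm w w' : perm_eq w w' -> (size w <= k)%N ->
  forall x, D x -> G w x = G w' x.
Proof.
have front i v : i \in v -> (size v <= k)%N ->
    forall x, D x -> G v x = G (i :: rem i v) x.
  elim: v => // j v IH; rewrite inE /=; have [<-//|ij] := eqVneq j i.
  rewrite orFb => iv vk x Dx.
  have sz : size (i :: rem i v) = size v.
    by rewrite /= size_rem//; case: v iv {IH vk}.
  rewrite (@cons_eq j v (i :: rem i v))// ?sz//; last exact: IH (ltnW vk).
  apply: schwarz => //; have := sz; rewrite /=; lia.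
elim: w w' => [|i w IH] w'.
  by rewrite perm_sym => /perm_nilP ->.
move=> ww wk x Dx.
have iw' : i \in w' by rewrite -(perm_mem ww) mem_head.
rewrite (front i w')// -?(perm_size ww)//.
have ww' : perm_eq w (rem i w').
  by rewrite -(perm_cons i) (perm_trans ww)// perm_to_rem.
by apply: cons_eq => //; rewrite -?(perm_size ww')//; exact: IH ww' (ltnW wk).
Qed.

End Schwarz.

Section FunctionsOnU.
Context {R : realType} {n : nat} {E : lcsType R}.
Implicit Types (x y : 'rV[R]_n) (w : seq 'I_n).
Variables (U : set 'rV[R]_n) (k : nat) (f : U -> E).
Hypotheses (lcU : locally_convex_subset U) (dU : dense_interior U).
Hypothesis fC : is_Ck k f.

Local Notation "''e_' i" := (delta_mx 0 i : 'rV[R]_n) (at level 8, i at level 2).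

Let H w := foldr (fun i F => dirderiv 'e_i F) (valL_ 0 f) w.

Let word_mx w : 'M[R]_(size w, n) := \matrix_(i < size w) nth 0 [seq 'e_j | j <- rev w] i.

Let rowseq_word w : rowseq (word_mx w) = [seq 'e_j | j <- rev w].
Proof.
apply: (@eq_from_nth _ 0); first by rewrite size_map size_enum_ord size_map size_rev.
move=> i; rewrite size_map size_enum_ord => iw.
rewrite (nth_map (Ordinal iw)) ?size_enum_ord// (nth_ord_enum _ (Ordinal iw)).
by rewrite rowK.
Qed.

Let HE w : H w = iter_dirderiv (rowseq (word_mx w)) (valL_ 0 f).
Proof. by rewrite rowseq_word /iter_dirderiv map_rev foldl_rev foldr_map. Qed.

Let H_ext w : (size w <= k)%N -> exists g : U -> E, continuous g /\
  forall x : U, U° (\val x) -> g x = H w (\val x).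
Proof.
case: fC => cf df; case: w => [|i w] wk.
  by exists f; split=> // x _; rewrite -[LHS]valL0_val.
have [|_ _ [g [cg gE]]] := df (size (i :: w)); first by rewrite wk.
exists (fun x : U => g (x, word_mx (i :: w))); split=> [x|x Ux]; last first.
  by rewrite gE// HE.
apply: (@cvg_comp _ _ _ (fun x : U => (x, word_mx (i :: w))) g _
  (nbhs (x, word_mx (i :: w)))); last exact: cg.
move=> V [[A B] /= [nA nB] AB]; apply: filterS nA => u Au; apply: AB.
by split=> //=; exact: nbhs_singleton nB.
Qed.

Let iter_dirderivable_rcons D ys y (F : 'rV[R]_n -> E) x :
  iter_dirderivable D (rcons ys y) F -> D x ->
  exists l, is_dirderiv (iter_dirderiv ys F) y x l.
Proof. by elim: ys F => [|z ys IH] F /= [Hz Hs] Dx; [exact: Hz|exact: IH]. Qed.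

Let H_fam : ck_family U° k H.
Proof.
move=> q qs x Ux w; split=> [wk|wk i].
  have [g [/continuous_setP cg gE]] := H_ext wk => e e0.
  have [r r0 rU] := open_ball (@open_interior _ U) Ux.
  have Ux' := interior_subset Ux.
  have [d d0 dP] := cg q qs (exist _ x (mem_set Ux')) e e0.
  exists (Num.min d r); first by rewrite lt_min d0.
  move=> y; rewrite lt_min => /andP[yd yr].
  have Uy' := interior_subset (rU y yr).
  have := dP (exist _ y (mem_set Uy')) yd.
  by rewrite !gE//; exact: rU.
have dH : is_dirderiv (H w) 'e_i x (H (i :: w) x).
  apply: dirderivP; rewrite HE.
  have [|/(_ (word_mx (i :: w)))+ _ _] := fC.2 (size (i :: w)).
    by rewrite wk.
  rewrite !rowseq_word rev_cons map_rcons => Hd.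
  exact: (iter_dirderivable_rcons Hd Ux).
by move/qdiffP: dH; exact.
Qed.

Lemma partialP a : (mdeg a <= k)%N -> continuous (partial a f) /\
  forall x : U, U° (\val x) -> partial a f x = H (mnm_word a) (\val x).
Proof.
move=> ak; have [|g [cg gE]] := @H_ext (mnm_word a); first by rewrite size_mnm_word.
pose P := [set g : U -> E | continuous g /\
  forall x : U, U° (\val x) -> g x = iter_partial a (valL_ 0 f) (\val x)].
have Pg : P g by split=> // x Ux; rewrite gE// iter_partialE.
have [cx xE] := xgetPex (fun=> 0) (ex_intro _ _ Pg).
by split=> [|x Ux]; [exact: cx|rewrite [LHS]xE// iter_partialE].
Qed.

(** The partial derivatives of [f] on [U], extended by 0 and reindexed by words;
    by symmetry they form a word family on the interior
    ([partial_word_family]). *)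
Definition partial_word w x : E := valL_ 0 (partial (word_mnm w) f) x.

Lemma partial_word_val w (x : U) :
  partial_word w (\val x) = partial (word_mnm w) f x.
Proof. exact: valL0_val. Qed.

Let perm_mnm_word w : perm_eq (mnm_word (word_mnm w)) w.
Proof.
by apply/allP => i _ /=; rewrite -!word_mnmE mnm_wordK.
Qed.

Lemma partial_word_family : ck_family U° k partial_word.
Proof.
have PE w x : (size w <= k)%N -> U° x -> H w x = partial_word w x.
  move=> wk Ux; have Ux' := interior_subset Ux.
  have := partial_word_val w (exist _ x (mem_set Ux')); rewrite /= => ->.
  have [|_ ->//] := @partialP (word_mnm w); first by rewrite mdeg_word_mnm.
  symmetry; apply: (ck_family_perm (@open_interior _ U) H_fam (perm_mnm_word w)) => //.
  by rewrite size_mnm_word mdeg_word_mnm.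
move=> q qs x Ux w; have [r r0 rU] := open_ball (@open_interior _ U) Ux.
have [H1 H2] := H_fam qs Ux w; split=> [wk|wk i].
  apply: (@qcont_near _ _ _ q (H w) _ x r) (H1 wk) => // z /rU.
  exact: PE.
rewrite -PE//; apply: (@qdiff_near _ _ _ q (H w) _ _ x _ r) (H2 wk i) => //.
by move=> z /rU; apply: PE; exact: ltnW.
Qed.

Lemma partial_word_cont q w (x : U) : continuous_seminorm q -> (size w <= k)%N ->
  forall e : R, 0 < e -> exists2 d, 0 < d & forall y : U,
    `|\val y - \val x| < d ->
    q (partial_word w (\val y) - partial_word w (\val x)) <= e.
Proof.
move=> qs wk e e0.
have [|/continuous_setP c _] := @partialP (word_mnm w); first by rewrite mdeg_word_mnm.
have [d d0 dP] := c q qs x e e0; exists d => // y; rewrite !partial_word_val.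
exact: dP.
Qed.

(** Passage to the limit at 0 in an estimate for small positive [s]. *)
Lemma limit_estimate q (a b : R -> E) (a0 b0 S : E) (B : R) :
  continuous_seminorm q ->
  (forall e : R, 0 < e -> exists2 d, 0 < d &
    forall s, 0 < s < d -> q (a s - a0) <= e) ->
  (forall e : R, 0 < e -> exists2 d, 0 < d &
    forall s, 0 < s < d -> q (b s - b0) <= e) ->
  (forall s, 0 < s <= 1 -> q (a s - b s - (1 - s) *: S) <= B) ->
  q (a0 - b0 - S) <= B.
Proof.
move=> qs ha hb hS; apply/ler_addgt0Pr => e e0.
have e3 : 0 < e / 3 by rewrite divr_gt0.
have [d d0 {ha}ha] := ha _ e3; have [c c0 {hb}hb] := hb _ e3.
have S0 := semi_ge0 qs S; have S1 : 0 < q S + 1 by lra.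
have x0 : 0 < e / 3 / (q S + 1) by rewrite divr_gt0.
pose m := Num.min (Num.min d c) (Num.min 1 (e / 3 / (q S + 1))).
have m0 : 0 < m by rewrite !lt_min d0 c0 ltr01.
have [m1 m2 m3 m4] : [/\ m <= d, m <= c, m <= 1 & m <= e / 3 / (q S + 1)].
  by rewrite /m; split; rewrite !ge_min lexx ?orbT.
move: m m0 m1 m2 m3 m4 => m m0 m1 m2 m3; rewrite ler_pdivlMr// => m4.
have H1 := ha (m / 2) ltac:(lra); have H2 := hb (m / 2) ltac:(lra).
have H3 := hS (m / 2) ltac:(lra).
have H4 : q ((m / 2) *: S) <= e / 3.
  by rewrite (semiZ qs) gtr0_norm; [nra|lra].
move: H1 H2 H3 H4; move: (a _) (b _) => u v H1 H2 H3 H4.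
have -> : a0 - b0 - S = (u - v - (1 - m / 2) *: S - (u - a0)) +
    ((v - b0) - (m / 2) *: S).
  by rewrite scalerBl; zmod.
have := semi_le qs (u - v - (1 - m / 2) *: S - (u - a0)) ((v - b0) - (m / 2) *: S).
have := semi_leB qs (u - v - (1 - m / 2) *: S) (u - a0).
have := semi_leB qs (v - b0) ((m / 2) *: S).
by clear ha hb hS m0 m1 m2 m3 m4 x0 d0 c0 e0 e3 S0 S1; lra.
Qed.

Lemma segment_ball (c p u : 'rV[R]_n) (r t : R) : `|p - c| < r ->
  `|u - c| < r -> 0 <= t <= 1 -> `|p + t *: (u - p) - c| < r.
Proof.
move=> pr ur /andP[t0 t1].
have -> : p + t *: (u - p) - c = (1 - t) *: (p - c) + t *: (u - c).
  by rewrite scalerBl; zmod.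
rewrite (le_lt_trans (ler_normD _ _))// !normrZ (ger0_norm t0).
rewrite (ger0_norm (_ : 0 <= 1 - t)) ?subr_ge0//.
have [->|tn0] := eqVneq t 0; first by rewrite mul0r subr0 mul1r addr0.
have {}t0 : 0 < t by rewrite lt_neqAle eq_sym tn0.
have : t * `|u - c| < t * r by rewrite ltr_pM2l.
have : (1 - t) * `|p - c| <= (1 - t) * r.
  by rewrite ler_wpM2l ?subr_ge0// ltW.
lra.
Qed.

Lemma scale_small (v : 'rV[R]_n) (d : R) : 0 < d -> exists2 c, 0 < c &
  forall s, 0 < s < c -> s <= 1 /\ `|s *: v| < d.
Proof.
move=> d0; have v0 := normr_ge0 v; have v1 : 0 < `|v| + 1 by lra.
exists (Num.min 1 (d / (`|v| + 1))); first by rewrite lt_min ltr01 divr_gt0.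
move=> s /andP[s0]; rewrite lt_min ltr_pdivlMr// => /andP[s1 sd].
by split; [exact: ltW|rewrite normrZ gtr0_norm//; nra].
Qed.

(** Near [x0] the set [U] contains a convex neighbourhood; moving both end
    points of a segment towards an interior point of it gives a segment in the
    interior of [U], where the mean value inequality applies. *)
Lemma strictly_differentiable q w (x0 : U) : continuous_seminorm q ->
  (size w < k)%N -> forall e : R, 0 < e -> exists2 r, 0 < r &
  forall x y : U, `|\val x - \val x0| < r -> `|\val y - \val x0| < r ->
  q (partial_word w (\val y) - partial_word w (\val x) -
     \sum_i (\val y - \val x) 0 i *: partial_word (i :: w) (\val x0)) <=
  e * `|\val y - \val x|.
Proof.
move=> qs wk e e0.
have [C [CU cC /nbhs_rVP[r0 r00 r0C]]] := lcU (set_valP x0).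
have n1 : (0 : R) < n%:R + 1 by have := ler0n R n; lra.
have e'0 : 0 < e / (n%:R + 1) by rewrite divr_gt0.
have [r1 r10 r1P] : exists2 d : R, 0 < d & forall i (y : U),
    `|\val y - \val x0| < d ->
    q (partial_word (i :: w) (\val y) - partial_word (i :: w) (\val x0)) <=
    e / (n%:R + 1).
  apply: (@fin_delta R 'I_n (fun i d => forall y : U, `|\val y - \val x0| < d ->
    q (partial_word (i :: w) (\val y) - partial_word (i :: w) (\val x0)) <=
    e / (n%:R + 1))).
    by move=> i d d' dd' Hy y yd; apply: Hy; lra.
  by move=> i; apply: partial_word_cont.
pose r := Num.min r0 r1; have r_gt0 : 0 < r by rewrite lt_min r00.
have rr0 : r <= r0 by rewrite ge_min lexx.
have rr1 : r <= r1 by rewrite ge_min lexx orbT.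
exists r => // x y xr yr.
have [z [Uz zr]] : exists z, U° z /\ `|z - \val x0| < r.
  have : closure U° (\val x0) by apply/dU/set_valP.
  move=> /(_ (ball (\val x0) r) (nbhsx_ballx _ _ r_gt0))[z [Uz zr]].
  by exists z; split=> //; rewrite -ball_normE /= distrC in zr.
have [rho rho0 rhoP] : exists2 rho, 0 < rho & forall u, `|u - z| < rho -> C u.
  have [d d0 dP] := open_ball (@open_interior _ U) Uz.
  exists (Num.min d (r - `|z - \val x0|)).
    by rewrite lt_min d0 subr_gt0.
  move=> u; rewrite lt_min => /andP[ud ur]; apply: r0C.
    have := ler_distD z u (\val x0); lra.
  exact: interior_subset (dP _ ud).
have Cv (u : U) : `|\val u - \val x0| < r -> C (\val u).
  by move=> ur; apply: r0C; [lra|exact: set_valP].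
(* points of the shifted segment *)
have shift p (s : R) : C p -> 0 < s <= 1 -> U° (p + s *: (z - p)).
  move=> Cp /andP[s0 s1]; apply/nbhs_rVP; exists (s * rho).
    by rewrite mulr_gt0.
  move=> u us; apply: CU.
  pose a := u - (p + s *: (z - p)).
  have <- : s *: (z + s^-1 *: a) + (1 - s) *: p = u.
    by rewrite scalerDr scalerA divff ?gt_eqF// /a; zmod.
  apply: (convexP C).1 => //; last lra.
  apply: rhoP; rewrite addrAC subrr add0r normrZ gtr0_norm ?invr_gt0//.
  by rewrite ltr_pdivrMl.
pose S := \sum_i (\val y - \val x) 0 i *: partial_word (i :: w) (\val x0).
have step (s : R) : 0 < s <= 1 ->
    q (partial_word w (\val y + s *: (z - \val y)) -
       partial_word w (\val x + s *: (z - \val x)) - (1 - s) *: S) <=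
    e * `|\val y - \val x|.
  move=> s01; have [s0 s1] := andP s01.
  pose v := (1 - s) *: (\val y - \val x).
  pose xs := \val x + s *: (z - \val x).
  have seg (t : R) : 0 <= t <= 1 -> exists p,
      [/\ C p, `|p - \val x0| < r & xs + t *: v = p + s *: (z - p)].
    move=> t01; exists (\val x + t *: (\val y - \val x)); split.
    - have <- : t *: \val y + (1 - t) *: \val x =
          \val x + t *: (\val y - \val x) by zmod.
      exact: (convexP C).1 cC _ _ t (Cv y yr) (Cv x xr) t01.
    - exact: segment_ball.
    - by apply/rowP => i; rewrite !mxE; ring.
  have dP : qder01 q (fun t => partial_word w (xs + t *: v))
      (fun t => \sum_i v 0 i *: partial_word (i :: w) (xs + t *: v)).
    apply: qdiff_qder01 => // t /seg[p [Cp pr ->]].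
    have := @ck_family_dirderiv _ _ _ _ _ _ v _ w (@open_interior _ U)
      partial_word_family (shift p s Cp s01) wk.
    by move=> /qdiffP; apply.
  have := mean_value qs dP (c := (1 - s) *: S) (M := e * `|\val y - \val x|) (b := 1).
  rewrite scale0r addr0 !scale1r mulr1.
  have -> : xs + v = \val y + s *: (z - \val y).
    by rewrite /xs /v scalerBl; zmod.
  apply; last lra.
  move=> t /seg[p [Cp pr ->]].
  have Up := interior_subset (shift p s Cp s01).
  pose p' : U := exist _ (p + s *: (z - p)) (mem_set Up).
  have s01' : 0 <= s <= 1 by rewrite ltW.
  have pr' := segment_ball pr zr s01'.
  have -> : (1 - s) *: S = \sum_i v 0 i *: partial_word (i :: w) (\val x0).
    by rewrite scaler_sumr; apply: eq_bigr => i _; rewrite scalerA !mxE.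
  rewrite -sumrB (le_trans (semi_sum qs _ _ _))//.
  apply: (@le_trans _ _ (\sum_(i < n) `|\val y - \val x| * (e / (n%:R + 1)))).
    apply: ler_sum => i _; rewrite -scalerBr (semiZ qs).
    apply: ler_pM; rewrite ?(semi_ge0 qs)//.
      rewrite (le_trans (coord_le _ _))// normrZ ger0_norm ?subr_ge0//.
      by rewrite ler_piMl// gerBl ltW.
    by apply: (r1P i p'); rewrite /= (lt_le_trans pr').
  rewrite sumr_const card_ord -[leLHS]mulr_natl mulrCA [leRHS]mulrC.
  apply: ler_wpM2l => //.
  by rewrite mulrA ler_pdivrMr// mulrC ler_wpM2l ?ltW// ltrDl.
have lim (p : U) (rp : `|\val p - \val x0| < r) e1 : 0 < e1 -> exists2 d, 0 < d &
    forall s, 0 < s < d ->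
      q (partial_word w (\val p + s *: (z - \val p)) - partial_word w (\val p)) <= e1.
  move=> e10; have [d d0 dP] := partial_word_cont p qs (ltnW wk) e10.
  have [c c0 cP] := scale_small (z - \val p) d0.
  exists c => // s sc; have [s1 sd] := cP s sc.
  have Up : U° (\val p + s *: (z - \val p)).
    by apply: shift; [exact: Cv|have/andP[-> _] := sc].
  apply: (dP (exist _ (\val p + s *: (z - \val p)) (mem_set (interior_subset Up)))).
  by rewrite /= addrAC subrr add0r.
exact: (limit_estimate qs (lim y yr) (lim x xr) step).
Qed.

(** Along a segment contained in [U], even in its boundary, the functions
    [partial_word w] are differentiable with the expected derivative. *)
Lemma partial_word_segment q w x y : continuous_seminorm q -> (size w < k)%N ->
  (forall t : R, 0 <= t <= 1 -> U (x + t *: (y - x))) ->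
  qder01 q (fun t => partial_word w (x + t *: (y - x)))
    (fun t => \sum_i (y - x) 0 i *: partial_word (i :: w) (x + t *: (y - x))).
Proof.
move=> qs wk Uxy t t01 e e0.
have N1 : 0 < `|y - x| + 1 by have := normr_ge0 (y - x); lra.
have [|r r0 rP] := @strictly_differentiable q w
  (exist _ (x + t *: (y - x)) (mem_set (Uxy t t01))) qs wk (e / (`|y - x| + 1)).
  by rewrite divr_gt0.
exists (r / (`|y - x| + 1)); first by rewrite divr_gt0.
move=> t' t'01; rewrite ltr_pdivlMr// => tr.
have := rP (exist _ (x + t *: (y - x)) (mem_set (Uxy t t01)))
  (exist _ (x + t' *: (y - x)) (mem_set (Uxy t' t'01))).
rewrite /= subrr normr0 => /(_ r0).
have -> : x + t' *: (y - x) - (x + t *: (y - x)) = (t' - t) *: (y - x).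
  by rewrite scalerBl; zmod.
rewrite normrZ.
have N0 := normr_ge0 (y - x); have T0 := normr_ge0 (t' - t).
move=> /(_ ltac:(nra)).
rewrite scaler_sumr; under eq_bigr do rewrite mxE -scalerA.
move=> /le_trans; apply; rewrite mulrAC ler_pdivrMr// -mulrA ler_wpM2l//.
  exact: ltW.
nra.
Qed.

End FunctionsOnU.

(** * Taylor polynomials *)

Section TaylorPolynomials.
Context {R : realType} {n : nat} {E : lcsType R}.
Implicit Types (x y : 'rV[R]_n) (w : seq 'I_n) (a b : multinom n).

Local Notation "''e_' i" := (delta_mx 0 i : 'rV[R]_n) (at level 8, i at level 2).

Lemma mpow0 x : mpow x mnm0 = 1.
Proof. by rewrite /mpow big1// => i _; rewrite mnm0E expr0. Qed.

Lemma mpow_0 b : b != mnm0 -> mpow (0 : 'rV[R]_n) b = 0.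
Proof.
move=> b0; have [i bi] : exists i, b i != 0%N.
  apply/existsP; apply: contraNT b0; rewrite negb_exists => /forallP H.
  by apply/eqP/mnmP => i; rewrite mnm0E; have := H i; rewrite negbK => /eqP.
by rewrite /mpow (bigD1 i)//= mxE expr0n (negPf bi) mul0r.
Qed.

Lemma mfact0 : mfact (@mnm0 n) = 1%N.
Proof. by rewrite /mfact big1// => i _; rewrite mnm0E. Qed.

Lemma mfact_gt0 b : (0 < mfact b)%N.
Proof. by rewrite /mfact prodn_gt0// => i; exact: fact_gt0. Qed.

Lemma mpow_split x b i :
  mpow x b = x 0 i ^+ b i * \prod_(j | j != i) x 0 j ^+ b j.
Proof. by rewrite /mpow (bigD1 i). Qed.

Lemma norm_mpow x b : `|mpow x b| <= `|x| ^+ mdeg b.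
Proof.
rewrite /mpow normr_prod mdegE.
suff [] : 0 <= \prod_i `|x 0 i ^+ b i| /\
  \prod_i `|x 0 i ^+ b i| <= `|x| ^+ (\sum_i b i)%N by [].
elim/big_rec2: _ => [|i m r _ [r0 IH]].
  by rewrite expr0.
rewrite exprD normrX; split; first by rewrite mulr_ge0 ?exprn_ge0.
by apply: ler_pM => //; rewrite ?exprn_ge0// lerXn2r ?nnegrE// coord_le.
Qed.

Lemma pow_taylor (y : R) m : exists2 C : R, 0 <= C & forall t, `|t| <= 1 ->
  `|(y + t) ^+ m - y ^+ m - t * (m%:R * y ^+ m.-1)| <= C * t ^+ 2.
Proof.
elim: m => [|m [C C0 IH]].
  by exists 0 => // t _; rewrite !expr0 !mul0r mulr0 subr0 subrr normr0.
exists ((`|y| + 1) * C + m%:R * `|y| ^+ m.-1).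
  by rewrite addr_ge0 ?mulr_ge0 ?exprn_ge0// addr_ge0.
move=> t t1 /=.
have -> : (y + t) ^+ m.+1 - y ^+ m.+1 - t * (m.+1%:R * y ^+ m) =
    (y + t) * ((y + t) ^+ m - y ^+ m - t * (m%:R * y ^+ m.-1)) +
    t ^+ 2 * (m%:R * y ^+ m.-1).
  case: m {IH} => [|m] /=; rewrite !exprS -?natr1; [rewrite !expr0|]; ring.
rewrite (le_trans (ler_normD _ _))// [leRHS]mulrDl; apply: lerD.
  rewrite normrM -mulrA; apply: ler_pM => //; last exact: IH.
  by rewrite (le_trans (ler_normD _ _))// lerD2l.
by rewrite normrM mulrC (ger0_norm (sqr_ge0 t)) normrM normr_nat normrX.
Qed.

(* the derivative in direction i of the monomial with exponent b *)
Let dmono b i x : R :=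
  (b i)%:R * x 0 i ^+ (b i).-1 * \prod_(j | j != i) x 0 j ^+ b j.

Lemma mpow_taylor b i x : exists2 C : R, 0 <= C & forall t, `|t| <= 1 ->
  `|mpow (x + t *: 'e_i) b - mpow x b - t * dmono b i x| <= C * t ^+ 2.
Proof.
have [C C0 CP] := pow_taylor (x 0 i) (b i).
set Q := \prod_(j | j != i) x 0 j ^+ b j.
exists (C * `|Q|); first by rewrite mulr_ge0.
move=> t t1; rewrite !(mpow_split _ _ i).
have -> : \prod_(j | j != i) (x + t *: 'e_i) 0 j ^+ b j = Q.
  apply: eq_bigr => j ji; rewrite !mxE eqxx /= (negPf ji) mulr0 addr0//.
rewrite !mxE !eqxx mulr1 -/Q /dmono -/Q.
have -> : (x 0 i + t) ^+ b i * Q - x 0 i ^+ b i * Q -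
    t * ((b i)%:R * x 0 i ^+ (b i).-1 * Q) =
    ((x 0 i + t) ^+ b i - x 0 i ^+ b i - t * ((b i)%:R * x 0 i ^+ (b i).-1)) * Q.
  by ring.
by rewrite normrM mulrAC ler_wpM2r//; exact: CP.
Qed.

(** For a jet [c], the Taylor polynomial at [y] of the component of index [a], up
    to the total order [l]; it is what [remainder] subtracts. *)
Definition taylor (l : nat) (c : multinom n -> E) (y : 'rV[R]_n)
    (a : multinom n) (x : 'rV[R]_n) : E :=
  \sum_(b : bmultinom n (l - mdeg a).+1)
    (mpow (x - y) b / (mfact b)%:R) *: c (mnm_add a b).

Lemma taylor_center l c y a : taylor l c y a y = c a.
Proof.
have b0 : (mdeg (@mnm0 n) < (l - mdeg a).+1)%N by rewrite mdeg0.
rewrite /taylor (bigD1 (BMultinom b0))//= subrr mpow0 mfact0 divr1 scale1r.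
rewrite addm0 big1 ?addr0// => b bb.
by rewrite mpow_0 ?mul0r ?scale0r.
Qed.

Lemma taylor_top l c y a x : mdeg a = l -> taylor l c y a x = c a.
Proof.
move=> al; have b0 : (mdeg (@mnm0 n) < (l - mdeg a).+1)%N by rewrite mdeg0.
rewrite /taylor (bigD1 (BMultinom b0))//= mpow0 mfact0 divr1 scale1r.
rewrite addm0 big1 ?addr0// => b /negP[]; apply/eqP/val_inj => /=.
apply/eqP; rewrite -mdeg_eq0 -leqn0 -ltnS; apply: leq_trans (bmdeg b) _.
by rewrite al subnn.
Qed.

Lemma taylor_lin l (r : R) c c' y a x :
  taylor l (fun b => r *: c b + c' b) y a x =
  r *: taylor l c y a x + taylor l c' y a x.
Proof.
rewrite /taylor scaler_sumr -big_split; apply: eq_bigr => b _ /=.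
by rewrite scalerDr !scalerA mulrC.
Qed.

Lemma qdiff_scale q (u : E) (al : 'rV[R]_n -> R) (d : R) x y (C : R) :
  continuous_seminorm q -> 0 <= C -> (forall t : R, `|t| <= 1 ->
    `|al (x + t *: y) - al x - t * d| <= C * t ^+ 2) ->
  qdiff q (fun z => al z *: u) y x (d *: u).
Proof.
move=> qs C0 H e e0.
have u0 := semi_ge0 qs u; have Cu : 0 < C * q u + 1 by nra.
exists (Num.min 1 (e / (C * q u + 1))); first by rewrite lt_min ltr01 divr_gt0.
move=> t; rewrite lt_min ltr_pdivlMr// => /andP[t1 te].
rewrite -scalerBl scalerA -scalerBl (semiZ qs).
have := H t (ltW t1); rewrite -(real_normK (num_real t)) => Ht.
have T0 := normr_ge0 t.
apply: (le_trans (ler_wpM2r u0 Ht)); nra.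
Qed.

(** Derivation in direction [i] kills the monomials without [x_i] and maps the
    others bijectively to the monomials of one degree less. *)
Let shift_sum (V : zmodType) N i (F : bmultinom n N.+2 -> V)
    (F' : bmultinom n N.+1 -> V) :
  (forall b : bmultinom n N.+2, b i = 0%N -> F b = 0) ->
  (forall (b : bmultinom n N.+2) (b' : bmultinom n N.+1),
     bmnm b = mnm_add (mnm1 i) b' -> F b = F' b') ->
  \sum_b F b = \sum_b F' b.
Proof.
move=> F0 FF'; rewrite (bigID (fun b : bmultinom n N.+2 => b i == 0%N)) /=.
rewrite big1 ?add0r => [|b /eqP]; last exact: F0.
have hP (b : bmultinom n N.+1) : (mdeg (mnm_add (mnm1 i) b) < N.+2)%N.
  by rewrite mdegD mdeg1 add1n ltnS bmdeg.
pose h (b : bmultinom n N.+1) := BMultinom (hP b).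
have b0 : (mdeg (@mnm0 n) < N.+1)%N by rewrite mdeg0.
pose h' (b : bmultinom n N.+2) := insubd (BMultinom b0) (mnm_sub b (mnm1 i)).
have hK (b : bmultinom n N.+1) : h' (h b) = b.
  apply/val_inj; rewrite /h' val_insubd /= addmC addmK bmdeg.
  by [].
rewrite (reindex_onto h h'); last first.
  move=> b bi; apply/val_inj; rewrite /= /h' val_insubd.
  have le : lem (mnm1 i) b.
    by apply/mnm_lepP => j; rewrite mnm1E; case: eqP => // <-; rewrite lt0n.
  have e : mdeg (mnm_add (mnm1 i) (mnm_sub b (mnm1 i))) = mdeg b.
    by rewrite addmC submK.
  have bN := bmdeg b; rewrite mdegD mdeg1 add1n in e.
  by rewrite -ltnS e bN addmC submK.
apply: eq_big => [b|b _]; last exact: FF'.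
by rewrite hK eqxx andbT mnmDE mnm1E eqxx.
Qed.

Lemma cvg_prod_fun (T I : Type) (S : set_system T) {FS : Filter S}
    (r : seq I) (P : pred I) (u : I -> T -> R) (v : I -> R) :
  (forall i, u i @ S --> v i) ->
  (fun t => \prod_(i <- r | P i) u i t) @ S --> \prod_(i <- r | P i) v i.
Proof.
move=> uv; elim: r => [|i r IH].
  rewrite big_nil (_ : (fun t => _) = fun=> 1); first exact: cvg_cst.
  by apply/funext => t; rewrite big_nil.
rewrite big_cons (_ : (fun t => _) = fun t => if P i
  then u i t * \prod_(j <- r | P j) u j t else \prod_(j <- r | P j) u j t).
  by case: (P i) => //; exact: cvgM.
by apply/funext => t; rewrite big_cons.
Qed.

Lemma mpow_cvg y b x : mpow (z - y) b @[z --> x] --> mpow (x - y) b.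
Proof.
apply: (@cvg_prod_fun _ _ (nbhs x)) => i.
apply: (@cvg_comp _ _ _ (fun z : 'rV[R]_n => (z - y) 0 i)
  (fun r : R => r ^+ b i) _ (nbhs ((x - y) 0 i))); last exact: exprn_continuous.
rewrite (_ : (fun z => _) = fun z : 'rV[R]_n => z 0 i - y 0 i).
  rewrite !mxE; apply: cvgB; last exact: cvg_cst.
  exact: (@coord_continuous R 1 n 0 i x).
by apply/funext => z; rewrite !mxE.
Qed.

(** Differentiating a Taylor polynomial shifts the jet. *)
Lemma taylor_family l c y : ck_family setT l (fun w => taylor l c y (word_mnm w)).
Proof.
move=> q qs x _ w; split=> [wl|wl i].
  have : {for x, continuous (taylor l c y (word_mnm w))}.
    pose I := bmultinom n (l - mdeg (word_mnm w)).+1.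
    apply: (@cvg_sum_scale R E _ I (nbhs x) _ (index_enum I)
      (fun (b : I) z => mpow (z - y) b / (mfact b)%:R)
      (fun (b : I) _ => c (mnm_add (word_mnm w) b))) => b; last exact: cvg_cst.
    by apply: cvgMl; exact: mpow_cvg.
  by move=> /qcontP; apply.
have [N lN] : exists N, (l - size w = N.+1)%N.
  by exists (l - size w).-1; rewrite prednK// subn_gt0.
rewrite /taylor !mdeg_word_mnm /=.
have -> : (l - (size w).+1)%N = N by rewrite subnS lN.
rewrite lN.
pose D (b : bmultinom n N.+2) : E :=
  (dmono b i (x - y) / (mfact b)%:R) *: c (mnm_add (word_mnm w) b).
rewrite -(@shift_sum _ N i D); last 2 first.
- by move=> b bi; rewrite /D /dmono bi !mul0r scale0r.
- move=> b b' bb; rewrite /D /dmono word_mnm_cons bb; congr (_ *: c _); last first.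
    by rewrite addmA [mnm_add (word_mnm w) _]addmC.
  rewrite (mpow_split _ _ i) /mfact.
  rewrite (bigD1 (F := fun j => ((mnm_add (mnm1 i) b') j)`!%N) i)//=.
  rewrite (bigD1 (F := fun j => (b' j)`!%N) i)//=.
  rewrite mnmDE mnm1E eqxx add1n /= factS.
  have -> : \prod_(j | j != i) (x - y) 0 j ^+ mnm_add (mnm1 i) b' j =
            \prod_(j | j != i) (x - y) 0 j ^+ b' j.
    by apply: eq_bigr => j ji; rewrite mnmDE mnm1E eq_sym (negPf ji).
  have -> : (\prod_(j | j != i) (mnm_add (mnm1 i) b' j)`! =
            \prod_(j | j != i) (b' j)`!)%N.
    by apply: eq_bigr => j ji; rewrite mnmDE mnm1E eq_sym (negPf ji).
  set P := \prod_(j | _) _; set Q := (\prod_(j | _) _)%N.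
  have Q0 : (Q%:R : R) != 0.
    by rewrite pnatr_eq0 -lt0n prodn_gt0// => j; exact: fact_gt0.
  have f0 : ((b' i)`!%:R : R) != 0 by rewrite pnatr_eq0 -lt0n fact_gt0.
  have s0 : ((b' i).+1%:R : R) != 0 by rewrite pnatr_eq0.
  rewrite !natrM; field.
  by rewrite f0 Q0 nat1r s0.
rewrite (_ : (fun z => _) = fun z => \sum_(b : bmultinom n N.+2)
    1 *: ((mpow (z - y) b / (mfact b)%:R) *: c (mnm_add (word_mnm w) b))); last first.
  by apply/funext => z; apply: eq_bigr => b _; rewrite scale1r.
rewrite (_ : \sum_b D b = \sum_(b : bmultinom n N.+2) 1 *: D b); last first.
  by apply: eq_bigr => b _; rewrite scale1r.
apply: qdiff_sum => // b.
have [C C0 CP] := mpow_taylor b i (x - y).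
apply: (@qdiff_scale q _ _ _ _ _ (C / (mfact b)%:R)) => //.
  by rewrite divr_ge0.
move=> t t1; have := CP t t1; rewrite (addrAC x (- y)) => H.
have -> : mpow (x + t *: 'e_i - y) b / (mfact b)%:R - mpow (x - y) b / (mfact b)%:R -
    t * (dmono b i (x - y) / (mfact b)%:R) =
  (mpow (x + t *: 'e_i - y) b - mpow (x - y) b - t * dmono b i (x - y)) /
    (mfact b)%:R by ring.
by rewrite normrM normfV normr_nat mulrAC ler_wpM2r.
Qed.

(** The mean value inequality carries the bound at the order [m] down to the
    lower orders, one at a time; each step multiplies it by [rho] and by
    [n.+1], for the [n] terms of the derivative and for the value at 0. *)
Lemma seg_bound q (m : nat) (H : seq 'I_n -> R -> E) (v : 'rV[R]_n) (rho M : R) :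
  continuous_seminorm q -> 0 <= M -> `|v| <= rho ->
  (forall w, (size w < m)%N ->
    qder01 q (H w) (fun t => \sum_i v 0 i *: H (i :: w) t)) ->
  (forall w, (size w <= m)%N -> q (H w 0) <= M * rho ^+ (m - size w)) ->
  (forall w t, size w = m -> 0 <= t <= 1 -> q (H w t) <= M) ->
  forall w t, (size w <= m)%N -> 0 <= t <= 1 ->
    q (H w t) <= (n.+1)%:R ^+ (m - size w) * M * rho ^+ (m - size w).
Proof.
move=> qs M0 vr dH H0 Hm w t wm t01.
have r0 : 0 <= rho by rewrite (le_trans _ vr).
move wj: (m - size w)%N => j.
elim: j w wj wm t t01 => [|j IH] w wj wm t t01.
  by rewrite !expr0 mul1r mulr1; apply: Hm => //; lia.
have IHw i s : 0 <= s <= 1 ->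
    q (H (i :: w) s) <= (n.+1)%:R ^+ j * M * rho ^+ j.
  by move=> s01; apply: IH => //=; lia.
have := mean_value qs (dH w _) (c := 0) (M := rho * (n%:R * ((n.+1)%:R ^+ j * M * rho ^+ j))).
move=> /(_ t ltac:(lia)) H1.
have {}H1 : q (H w t - H w 0) <= rho * (n%:R * (n.+1%:R ^+ j * M * rho ^+ j)) * t.
  move: H1; rewrite scaler0 subr0; apply=> // s s01; rewrite subr0.
  rewrite (le_trans (semi_sum qs _ _ _))//.
  apply: (@le_trans _ _ (\sum_(i < n) rho * (n.+1%:R ^+ j * M * rho ^+ j))).
    apply: ler_sum => i _; rewrite (semiZ qs) ler_pM ?(semi_ge0 qs)//.
      by rewrite (le_trans (coord_le _ _)).
    exact: IHw.
  by rewrite sumr_const card_ord -[leLHS]mulr_natl mulrCA.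
have H2 := H0 w wm; rewrite wj in H2 *.
rewrite (le_trans (semi_sub qs _ (H w 0)))//.
set X := n.+1%:R ^+ j * M * rho ^+ j in H1 *.
have X0 : 0 <= X by rewrite !mulr_ge0// exprn_ge0.
have MX : M * rho ^+ j <= X.
  by rewrite /X -mulrA ler_peMl ?mulr_ge0 ?exprn_ge0// exprn_ege1// ler1n.
have -> : n.+1%:R ^+ j.+1 * M * rho ^+ j.+1 = rho * X + rho * (n%:R * X).
  by rewrite /X !exprS -natr1; ring.
apply: lerD.
  by rewrite (le_trans H2)// exprS mulrCA ler_wpM2l.
apply: (le_trans H1); have/andP[_ t1] := t01.
by apply: ler_piMr => //; apply: mulr_ge0 => //; apply: mulr_ge0.
Qed.

End TaylorPolynomials.

(** * Compactness and topologies defined by seminorms *)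

(** The sets [P] such that [D] holds for [K `\` P] form a filter, which would
    be proper if [D K] failed; a cluster point contradicts the local
    hypothesis. *)
Lemma compact_ind (T : topologicalType) (K : set T) (D : set T -> Prop) :
  compact K -> D set0 -> (forall S S', D S -> D S' -> D (S `|` S')) ->
  (forall S S', S' `<=` S -> D S -> D S') ->
  (forall x, K x -> exists2 V, nbhs x V & D V) -> D K.
Proof.
move=> cK D0 DU DS Dloc; apply: contrapT => nDK.
pose F : set_system T := [set P | D (K `\` P)].
have FF : ProperFilter F.
  apply: Build_ProperFilter; first by rewrite /F /= setD0.
  split; rewrite /F /=.
  - by rewrite setDT.
  - by move=> P Q DP DQ; rewrite /= setDIr; exact: DU.
  - by move=> P Q PQ; apply: DS; exact: setDS.
have [|x [Kx Fx]] := cK F FF; first by rewrite /F /= setDv.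
have [V Vx DV] := Dloc x Kx.
have FV : F (~` V) by rewrite /F /=; apply: DS DV; rewrite setDE setCK; exact: subIsetr.
by have [y []] := Fx _ _ FV Vx.
Qed.

Section SubbaseTopology.
Variables (V : topologicalType) (S : set (set V)).
Hypothesis openS : open = [set \bigcup_(B in D') id B | D' in subset^~ (finI_from S id)].

Lemma subbase_open B : S B -> open B.
Proof.
move=> SB; rewrite openS; exists [set B] => [_ ->|]; last by rewrite bigcup_set1.
exact: (@finI_from1 _ _ S id).
Qed.

Lemma subbase_continuous (X : topologicalType) (f : X -> V) :
  (forall B, S B -> open (f @^-1` B)) -> continuous f.
Proof.
move=> H; apply/continuousP => A; rewrite openS => -[D' D'S <-].
rewrite preimage_bigcup; apply: bigcup_open => B /D'S[D DS <-].
rewrite preimage_bigcap openE => x Ix.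
apply: filter_bigI => C CD; apply: open_nbhs_nbhs; split; last exact: Ix.
by apply: H; have := DS C CD; rewrite inE.
Qed.

End SubbaseTopology.

(** A linear map between spaces with topologies defined by seminorms is
    continuous if each seminorm of the target is dominated on its values by a
    seminorm of the source. *)
Lemma seminorm_continuous (R : realType) (V W : preTopologicalLmodType R)
    (P : set (V -> R)) (Q : set (W -> R)) (f : {linear V -> W}) :
  open = [set \bigcup_(B in D') id B |
    D' in subset^~ (finI_from (seminorm_subbase P) id)] ->
  open = [set \bigcup_(B in D') id B |
    D' in subset^~ (finI_from (seminorm_subbase Q) id)] ->
  (forall q, Q q -> forall u v, q (u + v) <= q u + q v) ->
  (forall q, Q q -> exists p B, [/\ P p, p 0 = 0, forall v, 0 <= p v, 0 <= B &
     forall v, q (f v) <= B * p v]) ->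
  continuous f.
Proof.
move=> oV oW Qle QP; apply: (subbase_continuous oW).
move=> _ [q [h [r [Qq r0 ->]]]]; have [p [B [Pp p0 p_ge0 B0 qp]]] := QP q Qq.
rewrite openE => g /= gr; have B1 : 0 < B + 1 by lra.
pose s := (r - q (f g - h)) / (B + 1).
have s0 : 0 < s by rewrite divr_gt0// subr_gt0.
have oB : open [set g' : V | p (g' - g) < s].
  by apply: (subbase_open oV); exists p, g, s.
apply: (@filterS _ (nbhs g) _ [set g' : V | p (g' - g) < s]) => [g' /= g's|].
  rewrite -(subrKA (f g)) -raddfB (le_lt_trans (Qle q Qq _ _))// -ltrBrDr.
  rewrite (le_lt_trans (qp _))//; move: g's; rewrite /s ltr_pdivlMr//.
  by have := p_ge0 (g' - g); nra.
by apply: open_nbhs_nbhs; split=> //=; rewrite subrr p0.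
Qed.

Section CompactBounds.
Context {R : realType} {n : nat} {E : lcsType R}.

Lemma compact_bounded (A : set 'rV[R]_n) (K : set A) (F : A -> R) : compact K ->
  (forall x, K x -> exists C d : R, 0 < d /\
    forall y, K y -> `|\val y - \val x| < d -> F y <= C) ->
  exists2 C, 0 <= C & forall x, K x -> F x <= C.
Proof.
move=> cK Floc.
have [||||C CP] := @compact_ind A K (fun S => exists C, forall y, S y -> K y -> F y <= C) cK.
- by exists 0.
- move=> S S' [C CP] [C' C'P]; exists (Num.max C C') => y [Sy|Sy] Ky.
    by rewrite le_max CP.
  by rewrite le_max C'P ?orbT.
- by move=> S S' SS [C CP]; exists C => y /SS; exact: CP.
- move=> x Kx; have [C [d [d0 CP]]] := Floc x Kx.
  exists [set y : A | `|\val y - \val x| < d].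
    by apply/nbhs_setP; exists d.
  by exists C => y yx Ky; exact: CP.
exists (Num.max 0 C); first by rewrite le_max lexx.
by move=> x Kx; rewrite le_max CP ?orbT.
Qed.

(** The radius is a Lebesgue number of a cover of [K] by balls. *)
Lemma lebesgue_number (A : set 'rV[R]_n) (K : set A) (Q : A -> A -> Prop) :
  compact K ->
  (forall x, K x -> exists2 r : R, 0 < r & forall y z,
    `|\val y - \val x| < r -> `|\val z - \val x| < r -> Q y z) ->
  exists2 d : R, 0 < d & forall y z, K y -> `|\val z - \val y| < d -> Q y z.
Proof.
move=> cK Qloc.
apply: (@compact_ind A K (fun S => exists2 d : R, 0 < d & forall y z,
  S y -> `|\val z - \val y| < d -> Q y z) cK).
- by exists 1.
- move=> S S' [d d0 dP] [d' d'0 d'P].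
  exists (Num.min d d') => [|y z yS]; first by rewrite lt_min d0.
  by rewrite lt_min => /andP[yd yd']; case: yS => Sy; [exact: dP|exact: d'P].
- by move=> S S' SS [d d0 dP]; exists d => // y z /SS; exact: dP.
- move=> x Kx; have [r r0 rP] := Qloc x Kx.
  exists [set y : A | `|\val y - \val x| < r / 2].
    by apply/nbhs_setP; exists (r / 2) => //; rewrite divr_gt0.
  exists (r / 2) => [|y z /= yx zy]; first by rewrite divr_gt0.
  by apply: rP; [|have := ler_distD (\val y) (\val z) (\val x)]; lra.
Qed.

(** The Euclidean norm and the norm of the library, which is the maximum norm,
    are equivalent. *)
Lemma enorm_ge (v : 'rV[R]_n) : `|v| <= enorm v.
Proof.
apply: norm_le_coord => [|i]; first exact: sqrtr_ge0.
rewrite /enorm -sqrtr_sqr ler_sqrt ?sumr_ge0// => [|j _]; last exact: sqr_ge0.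
by rewrite (bigD1 i)//= lerDl sumr_ge0// => j _; exact: sqr_ge0.
Qed.

Lemma enorm_le (v : 'rV[R]_n) : enorm v <= n.+1%:R * `|v|.
Proof.
rewrite /enorm -[leRHS]ger0_norm ?mulr_ge0// -sqrtr_sqr ler_sqrt ?sqr_ge0//.
apply: (@le_trans _ _ (\sum_(i < n) `|v| ^+ 2)).
  apply: ler_sum => i _; rewrite -(real_normK (num_real _)).
  by rewrite lerXn2r ?nnegrE// coord_le.
rewrite sumr_const card_ord -[leLHS]mulr_natl exprMn ler_wpM2r ?sqr_ge0//.
by rewrite -natrX ler_nat; apply: (@leq_trans n.+1) => //; rewrite leq_pmull.
Qed.

Lemma enorm_ge0 (v : 'rV[R]_n) : 0 <= enorm v.
Proof. exact: sqrtr_ge0. Qed.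

Lemma enorm_gt0 (v : 'rV[R]_n) : (0 < enorm v) = (v != 0).
Proof.
apply/idP/idP => [|v0]; last by rewrite (lt_le_trans _ (enorm_ge v))// normr_gt0.
by apply: contraTneq => ->; rewrite -leNgt (le_trans (enorm_le _))// normr0 mulr0.
Qed.

(** Away from the diagonal the remainder is controlled by the jet itself. *)
Lemma taylor_far (q : E -> R) (l : nat) (a : multinom n) (d : R) :
  continuous_seminorm q -> 0 < d -> exists2 C, 0 <= C &
  forall (c : multinom n -> E) (u : E) (x y : 'rV[R]_n) (N : R), 0 <= N ->
    q u <= N -> (forall b, (mdeg b <= l)%N -> q (c b) <= N) ->
    (mdeg a <= l)%N -> d <= enorm (x - y) ->
    q (u - taylor l c y a x) <= C * N * enorm (x - y) ^+ (l - mdeg a).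
Proof.
move=> qs d0; set m := (l - mdeg a)%N.
pose D := (1 + d^-1) ^+ m; have d1 : 0 < d^-1 by rewrite invr_gt0.
have D0 : 0 <= D by rewrite exprn_ge0// addr_ge0// ltW.
exists (D * (1 + #|{: bmultinom n m.+1}|%:R)); first by rewrite mulr_ge0.
move=> c u x y N N0 uN cN al dxy; set s := enorm (x - y) in dxy *.
have s0 : 0 < s by lra.
have pow j : (j <= m)%N -> s ^+ j <= D * s ^+ m.
  move=> jm; rewrite -(subnK jm) exprD mulrA -[leLHS]mul1r.
  apply: ler_wpM2r; first by rewrite exprn_ge0// ltW.
  apply: (@le_trans _ _ ((1 + d^-1) ^+ (m - j) * s ^+ (m - j))); last first.
    apply: ler_wpM2r; first by rewrite exprn_ge0// ltW.
    by rewrite /D ler_weXn2l ?leq_subr// lerDl ltW.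
  rewrite -exprMn exprn_ege1// mulrDl.
  have : d^-1 * d <= d^-1 * s by rewrite ler_pM2l.
  rewrite mulVf ?gt_eqF//; lra.
rewrite (le_trans (semi_leB qs _ _))//.
have -> : D * (1 + #|{: bmultinom n m.+1}|%:R) * N * s ^+ m =
   N * (D * s ^+ m) + #|{: bmultinom n m.+1}|%:R * (N * (D * s ^+ m)) by ring.
apply: lerD.
  rewrite (le_trans uN)// -[leLHS]mulr1 ler_wpM2l//.
  by have := pow 0%N (leq0n _); rewrite expr0.
rewrite /taylor (le_trans (semi_sum qs _ _ _))//.
rewrite mulr_natl -sumr_const; apply: ler_sum => b _.
rewrite (semiZ qs) mulrC; apply: ler_pM; rewrite ?(semi_ge0 qs)//.
  by apply: cN; rewrite mdegD -leq_subRL// -ltnS; exact: bmdeg.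
rewrite normrM normfV normr_nat.
apply: (@le_trans _ _ (s ^+ mdeg b)); last by apply: pow; rewrite -ltnS; exact: bmdeg.
rewrite ler_pdivrMr ?ltr0n ?mfact_gt0//.
rewrite (le_trans (norm_mpow _ _))//.
rewrite (@le_trans _ _ (s ^+ mdeg b))//.
  by rewrite lerXn2r ?nnegrE ?enorm_ge ?enorm_ge0.
by rewrite ler_peMr ?ler1n ?mfact_gt0// exprn_ge0// ltW.
Qed.

End CompactBounds.

Section SpaceSeminorms.
Context {R : realType} {n : nat} {E : lcsType R}.

Lemma sup_ge0_le (T : Type) (S : set T) (F : T -> R) (N : R) : 0 <= N ->
  (forall x, S x -> F x <= N) -> sup [set F x | x in S] <= N.
Proof.
move=> N0 FN; have [->|/set0P[x Sx]] := eqVneq S set0.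
  by rewrite image_set0 sup0.
by apply: ge_sup; [exists (F x), x|move=> _ [y Sy <-]; exact: FN].
Qed.

Lemma sup_image_ge (T : Type) (S : set T) (F : T -> R) (C : R) x :
  (forall y, S y -> F y <= C) -> S x -> F x <= sup [set F y | y in S].
Proof.
move=> FC Sx; apply: ub_le_sup; last by exists x.
by exists C => _ [y Sy <-]; exact: FC.
Qed.

Section Ck.
Variables (U : set 'rV[R]_n) (k : nat).
Hypothesis dU : dense_interior U.
Implicit Types (f g : Ck U E k).

Lemma CkP f : is_Ck k f.
Proof. by case: f => f fC; apply/asboolP. Qed.

Lemma Ck_norm_ge l q K f (a : multinom n) (x : U) : (l <= k)%N ->
  (mdeg a <= l)%N -> continuous_seminorm q -> compact K -> K x ->
  q (partial a f x) <= Ck_norm l q K f.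
Proof.
move=> lk al qs cK Kx.
have [|C C0 CP] := compact_bounded (F := fun x => q (partial a f x)) cK.
  move=> y Ky; have [|/continuous_setP cp _] := partialP (CkP f) (a := a).
    exact: leq_trans lk.
  have [d d0 dP] := cp q qs y 1 ltr01.
  exists (q (partial a f y) + 1), d; split=> // z _ /dP zy.
  by rewrite (le_trans (semi_sub qs _ (partial a f y)))// lerD2l.
have al' : (mdeg a < l.+1)%N by [].
apply: (le_trans (sup_image_ge CP Kx)).
by rewrite /Ck_norm (le_bigmax _ (fun a : bmultinom n l.+1 =>
  sup [set q (partial a f x) | x in K]) (BMultinom al')).
Qed.

Lemma Ck_norm_le l q K f (N : R) : 0 <= N ->
  (forall (a : multinom n) x, (mdeg a <= l)%N -> K x -> q (partial a f x) <= N) ->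
  Ck_norm l q K f <= N.
Proof.
move=> N0 H; rewrite /Ck_norm; apply/bigmax_leP; split=> // a _.
by apply: sup_ge0_le => // x; apply: H; rewrite -ltnS bmdeg.
Qed.

Lemma Ck_norm_ge0 l q K f : 0 <= Ck_norm l q K f.
Proof. by rewrite /Ck_norm; apply/bigmax_geP; left. Qed.

(** [partial mnm0 f] is a continuous function which agrees with [f] on the
    interior. *)
Lemma partial_nil f (x : U) : partial mnm0 f x = f x.
Proof.
have [//|cp pE] := partialP (CkP f) (a := mnm0); first by rewrite mdeg0.
have -> // : partial mnm0 f = f.
apply: dense_continuous_eq => //; first by have [] := CkP f.
have w0 : mnm_word (@mnm0 n) = [::] by apply/nilP; rewrite /nilp size_mnm_word mdeg0.
by move=> y Uy; rewrite pE// w0; exact: valL0_val.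
Qed.

Lemma partial_lin (c : R) f g (a : multinom n) (x : U) : (mdeg a <= k)%N ->
  partial a (c *: f + g) x = c *: partial a f x + partial a g x.
Proof.
move=> ak; have [//|cf _] := partialP (CkP f) (a := a).
have [//|cg _] := partialP (CkP g) (a := a).
have [//|cfg fgE] := partialP (CkP (c *: f + g)) (a := a).
suff -> : partial a (c *: f + g) = c *: partial a f + partial a g by [].
apply: dense_continuous_eq => //; first exact: continuous_lin.
move=> y Uy; rewrite fgE//.
pose G w z := c *: partial_word f w z + partial_word g w z.
have GU : ck_family U° k G.
  move=> q qs z Uz w; split=> [wk|wk i].
    by apply: qcont_lin => //; apply: (partial_word_family (CkP _) qs Uz w).1.
  by apply: qdiff_lin => //; apply: (partial_word_family (CkP _) qs Uz w).2.
rewrite (foldr_dirderiv (@open_interior _ U) GU) ?size_mnm_word//.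
  by rewrite /G !partial_word_val mnm_wordK.
move=> z Uz; have Uz' := interior_subset Uz.
pose z' : U := exist _ z (mem_set Uz').
have -> : valL_ 0 (c *: f + g : Ck U E k) z = (c *: f + g : Ck U E k) z'.
  exact: (valL0_val _ z').
rewrite /G (partial_word_val f [::] z') (partial_word_val g [::] z') word_mnm_nil.
by rewrite !partial_nil.
Qed.

End Ck.

End SpaceSeminorms.

(** * The seminorms of the space of Whitney jets *)

Section WhitneyNorm.
Context {R : realType} {n : nat} {E : lcsType R}.
Variables (A : set 'rV[R]_n) (k : nat).
Implicit Types (f g : whitney A E k) (a b : multinom n) (x y : A).

Lemma fin_bound (I : finType) (P : I -> R -> Prop) :
  (forall i d d', d <= d' -> P i d -> P i d') ->
  (forall i, exists2 d, 0 <= d & P i d) ->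
  exists2 d, 0 <= d & forall i, P i d.
Proof.
move=> mono /(_ _)/cid2-/all_sig[d dP].
exists (\sum_i d i); first by rewrite sumr_ge0// => i _; case: (dP i).
move=> i; have [_] := dP i; apply: mono.
by rewrite (bigD1 i)//= lerDl sumr_ge0// => j _; case: (dP j).
Qed.

Lemma whitneyP f : is_whitney f.
Proof. by case: f => f fW; apply/asboolP. Qed.

Lemma val_sub_neq0 x y : x != y -> \val x - \val y != 0.
Proof. by apply: contraNN; rewrite subr_eq0 => /eqP/val_inj ->. Qed.

Lemma remainderE (f : jet A E k) l a y x : remainder f l a y x =
  jcoef f a x - taylor l (fun b => jcoef f b y) (\val y) a (\val x).
Proof. by []. Qed.

Lemma remainder_diag (f : jet A E k) l a x : remainder f l a x x = 0.
Proof. by rewrite remainderE taylor_center subrr. Qed.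

(** The Whitney condition for [l = mdeg a] says that [jcoef f a] is uniformly
    continuous on compact sets. *)
Lemma jcoef_bounded q (K : set A) f a : continuous_seminorm q -> compact K ->
  (mdeg a <= k)%N -> exists2 C, 0 <= C & forall x, K x -> q (jcoef f a x) <= C.
Proof.
move=> qs cK ak; apply: (compact_bounded cK) => x Kx.
have [d d0 dP] := @whitneyP f (mdeg a) a q K 1 ak (leqnn _) qs cK ltr01.
exists (q (jcoef f a x) + 1), (d / n.+1%:R); split; first by rewrite divr_gt0.
move=> y Ky yx; have [->|yx0] := eqVneq y x; first by rewrite lerDl.
have := dP y x Ky Kx; rewrite remainderE taylor_top// enorm_gt0.
rewrite val_sub_neq0//= subnn expr0 mulr1 => H.
rewrite (le_trans (semi_sub qs _ (jcoef f a x)))// lerD2l; apply: H.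
by rewrite (le_lt_trans (enorm_le _))// mulrC -ltr_pdivlMr.
Qed.

(** The Whitney condition gives the bound near the diagonal, and [taylor_far] gives
    it elsewhere; with [jcoef_bounded], the suprema in [whitney_norm] are over
    bounded sets. *)
Lemma remainder_bounded q (K : set A) f l a : continuous_seminorm q ->
  compact K -> (l <= k)%N -> (mdeg a <= l)%N ->
  exists C, forall x y, K x -> K y -> x != y ->
    q (remainder f l a y x) / enorm (\val x - \val y) ^+ (l - mdeg a) <= C.
Proof.
move=> qs cK lk al.
have [d d0 dP] := @whitneyP f l a q K 1 lk al qs cK ltr01.
have [C C0 CP] := taylor_far l a qs d0.
have [N N0 NP] : exists2 N, 0 <= N & forall b : bmultinom n l.+1,
    forall x, K x -> q (jcoef f b x) <= N.
  apply: (@fin_bound _ (fun (b : bmultinom n l.+1) N =>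
    forall x, K x -> q (jcoef f b x) <= N)).
    by move=> b N N' NN H x /H /le_trans; apply.
  by move=> b; apply: jcoef_bounded => //; apply: leq_trans lk; rewrite -ltnS bmdeg.
exists (C * N + 1) => x y Kx Ky xy.
have s0 : 0 < enorm (\val x - \val y) by rewrite enorm_gt0 val_sub_neq0.
rewrite ler_pdivrMr ?exprn_gt0//.
have [sd|ds] := ltrP (enorm (\val x - \val y)) d.
  apply: (le_trans (dP x y Kx Ky _)); first by rewrite s0.
  by rewrite ler_wpM2r ?exprn_ge0 ?enorm_ge0// lerDr mulr_ge0.
have NP' (b : multinom n) z : (mdeg b <= l)%N -> K z -> q (jcoef f b z) <= N.
  by rewrite -ltnS => bl; exact: (NP (BMultinom bl)).
rewrite remainderE; apply: (@le_trans _ _ (C * N *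
    enorm (\val x - \val y) ^+ (l - mdeg a))).
  by apply: CP => //; [exact: NP'|move=> b bl; exact: NP'].
by rewrite ler_wpM2r ?exprn_ge0 ?enorm_ge0// lerDl.
Qed.

(** [whitney_sup] and [whitney_rem] are the two summands of [whitney_norm]. *)
Definition whitney_sup l q (K : set A) f : R :=
  \big[Num.max/0]_(a : bmultinom n l.+1) sup [set q (jcoef f a x) | x in K].

Definition whitney_rem l q (K : set A) f : R :=
  \big[Num.max/0]_(a : bmultinom n l.+1)
    sup [set q (remainder f l a z.2 z.1) /
             enorm (\val z.1 - \val z.2) ^+ (l - mdeg a)
        | z in [set z : A * A | [/\ K z.1, K z.2 & z.1 != z.2]]].

Lemma whitney_normE l q K f :
  whitney_norm l q K f = whitney_sup l q K f + whitney_rem l q K f.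
Proof. by []. Qed.

Lemma whitney_sup_ge0 l q K f : 0 <= whitney_sup l q K f.
Proof. by apply/bigmax_geP; left. Qed.

Lemma whitney_rem_ge0 l q K f : 0 <= whitney_rem l q K f.
Proof. by apply/bigmax_geP; left. Qed.

Lemma whitney_norm_ge0 l q K f : 0 <= whitney_norm l q K f.
Proof. by rewrite whitney_normE addr_ge0 ?whitney_sup_ge0 ?whitney_rem_ge0. Qed.

Lemma whitney_sup_ge l q K f a x : (l <= k)%N -> (mdeg a <= l)%N ->
  continuous_seminorm q -> compact K -> K x ->
  q (jcoef f a x) <= whitney_sup l q K f.
Proof.
move=> lk al qs cK Kx.
have [C C0 CP] := jcoef_bounded f qs cK (leq_trans al lk).
have al' : (mdeg a < l.+1)%N by [].
apply: (le_trans (sup_image_ge CP Kx)).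
by rewrite /whitney_sup (le_bigmax _ (fun a : bmultinom n l.+1 =>
  sup [set q (jcoef f a x) | x in K]) (BMultinom al')).
Qed.

Lemma whitney_rem_ge l q K f a x y : (l <= k)%N -> (mdeg a <= l)%N ->
  continuous_seminorm q -> compact K -> K x -> K y ->
  q (remainder f l a y x) <=
  whitney_rem l q K f * enorm (\val x - \val y) ^+ (l - mdeg a).
Proof.
move=> lk al qs cK Kx Ky; have [->|xy] := eqVneq x y.
  by rewrite remainder_diag (semi0 qs) mulr_ge0 ?whitney_rem_ge0 ?exprn_ge0 ?enorm_ge0.
have [C CP] := remainder_bounded f qs cK lk al.
have s0 : 0 < enorm (\val x - \val y) by rewrite enorm_gt0 val_sub_neq0.
rewrite -ler_pdivrMr ?exprn_gt0//.
have al' : (mdeg a < l.+1)%N by [].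
pose S := [set z : A * A | [/\ K z.1, K z.2 & z.1 != z.2]].
have CP' z : S z -> q (remainder f l a z.2 z.1) /
    enorm (\val z.1 - \val z.2) ^+ (l - mdeg a) <= C.
  by case=> ? ? ?; exact: CP.
have Sxy : S (x, y) by [].
apply: (le_trans (sup_image_ge CP' Sxy)).
by rewrite /whitney_rem (le_bigmax _ (fun a : bmultinom n l.+1 =>
  sup [set q (remainder f l a z.2 z.1) /
             enorm (\val z.1 - \val z.2) ^+ (l - mdeg a) | z in S]) (BMultinom al')).
Qed.

Lemma whitney_sup_le l q K f N : 0 <= N ->
  (forall a x, (mdeg a <= l)%N -> K x -> q (jcoef f a x) <= N) ->
  whitney_sup l q K f <= N.
Proof.
move=> N0 H; apply/bigmax_leP; split=> // a _; apply: sup_ge0_le => // x.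
by apply: H; rewrite -ltnS bmdeg.
Qed.

Lemma whitney_rem_le l q K f N : 0 <= N ->
  (forall a x y, (mdeg a <= l)%N -> K x -> K y -> x != y ->
     q (remainder f l a y x) <= N * enorm (\val x - \val y) ^+ (l - mdeg a)) ->
  whitney_rem l q K f <= N.
Proof.
move=> N0 H; apply/bigmax_leP; split=> // a _.
apply: sup_ge0_le => // -[x y] [/= Kx Ky xy].
rewrite ler_pdivrMr ?exprn_gt0 ?enorm_gt0 ?val_sub_neq0//.
by apply: H => //; rewrite -ltnS bmdeg.
Qed.

Lemma whitney_normD l q K f g : (l <= k)%N -> continuous_seminorm q ->
  compact K -> whitney_norm l q K (f + g) <= whitney_norm l q K f + whitney_norm l q K g.
Proof.
move=> lk qs cK; rewrite !whitney_normE addrACA; apply: lerD.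
  apply: whitney_sup_le => [|a x al Kx]; first by rewrite addr_ge0 ?whitney_sup_ge0.
  have -> : jcoef (f + g : whitney A E k) a x = jcoef f a x + jcoef g a x.
    by rewrite -(scale1r (jcoef f a x)) -jcoef_lin scale1r.
  by rewrite (le_trans (semi_le qs _ _))// lerD ?whitney_sup_ge.
apply: whitney_rem_le => [|a x y al Kx Ky xy]; first by rewrite addr_ge0 ?whitney_rem_ge0.
have -> : remainder (f + g : whitney A E k) l a y x =
    remainder f l a y x + remainder g l a y x.
  by rewrite -(scale1r (remainder f l a y x)) -remainder_lin scale1r.
by rewrite (le_trans (semi_le qs _ _))// mulrDl lerD ?whitney_rem_ge.
Qed.

Lemma whitney_norm0 l q (K : set A) : continuous_seminorm q ->
  whitney_norm l q K (0 : whitney A E k) = 0.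
Proof.
move=> qs; have j0 a x : jcoef (0 : whitney A E k) a x = 0.
  by rewrite /jcoef; case: insub.
apply/eqP; rewrite eq_le whitney_norm_ge0 andbT whitney_normE -[leRHS]addr0.
apply: lerD; first by apply: whitney_sup_le => // a x _ _; rewrite j0 (semi0 qs).
apply: whitney_rem_le => // a x y _ _ _ _.
rewrite mul0r remainderE j0 /taylor big1 ?subrr ?(semi0 qs)// => b _.
by rewrite j0 scaler0.
Qed.

Lemma whitney_norm_sub l q (K K' : set A) f : (l <= k)%N -> continuous_seminorm q ->
  compact K' -> K `<=` K' -> whitney_norm l q K f <= whitney_norm l q K' f.
Proof.
move=> lk qs cK KK; rewrite !whitney_normE; apply: lerD.
  apply: whitney_sup_le => [|a x al /KK Kx]; first exact: whitney_sup_ge0.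
  exact: whitney_sup_ge.
apply: whitney_rem_le => [|a x y al /KK Kx /KK Ky _]; first exact: whitney_rem_ge0.
exact: whitney_rem_ge.
Qed.

End WhitneyNorm.

Section CkNormD.
Context {R : realType} {n : nat} {E : lcsType R}.
Variables (U : set 'rV[R]_n) (k : nat).
Hypothesis dU : dense_interior U.

Lemma Ck_normD l q K (f g : Ck U E k) : (l <= k)%N -> continuous_seminorm q ->
  compact K -> Ck_norm l q K (f + g) <= Ck_norm l q K f + Ck_norm l q K g.
Proof.
move=> lk qs cK; apply: Ck_norm_le => [|a x al Kx].
  by rewrite addr_ge0 ?Ck_norm_ge0.
have -> : partial a (f + g : Ck U E k) x = partial a f x + partial a g x.
  rewrite -(scale1r (partial a f x)) -partial_lin ?scale1r//.
  exact: leq_trans lk.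
by rewrite (le_trans (semi_le qs _ _))// lerD// Ck_norm_ge.
Qed.

Lemma Ck_norm0 l q K : (l <= k)%N -> continuous_seminorm q ->
  Ck_norm l q K (0 : Ck U E k) = 0.
Proof.
move=> lk qs; apply/eqP; rewrite eq_le Ck_norm_ge0 andbT.
apply: Ck_norm_le => // a x al _.
have e0 : (0 : Ck U E k) = (-1) *: 0 + 0 by rewrite scaler0 addr0.
rewrite e0 partial_lin//; last exact: leq_trans lk.
by rewrite scaleN1r addNr (semi0 qs).
Qed.

End CkNormD.

(** * The restriction map *)

Section Restriction.
Context {R : realType} {n : nat} {E : lcsType R}.
Variables (U A : set 'rV[R]_n) (AU : A `<=` U) (k : nat).
Hypotheses (lcU : locally_convex_subset U) (dU : dense_interior U).
Implicit Types (f g : Ck U E k) (a b : multinom n).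

Lemma taylor_ext l (c c' : multinom n -> E) (y x : 'rV[R]_n) a :
  (mdeg a <= l)%N -> (forall b, (mdeg b <= l)%N -> c b = c' b) ->
  taylor l c y a x = taylor l c' y a x.
Proof.
move=> al cc; apply: eq_bigr => b _; rewrite cc// mdegD -leq_subRL// -ltnS.
exact: bmdeg.
Qed.

(** [seg_bound] for the difference between the derivatives of [f] and those of its
    Taylor polynomial, which vanishes at [y] and whose top order part is the
    oscillation of the derivatives of order [l]. *)
Lemma taylor_estimate f q l (x y : U) (M : R) : continuous_seminorm q ->
  (l <= k)%N -> 0 <= M ->
  (forall t : R, 0 <= t <= 1 -> U (\val y + t *: (\val x - \val y))) ->
  (forall w (t : R), size w = l -> 0 <= t <= 1 ->
    q (partial_word f w (\val y + t *: (\val x - \val y)) -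
       partial_word f w (\val y)) <= M) ->
  forall a, (mdeg a <= l)%N ->
  q (partial a f x - taylor l (fun b => partial b f y) (\val y) a (\val x)) <=
  n.+1%:R ^+ (l - mdeg a) * M * `|\val x - \val y| ^+ (l - mdeg a).
Proof.
move=> qs lk M0 Uxy PM a al.
pose v := \val x - \val y; pose c b := partial b f y.
pose H w t := partial_word f w (\val y + t *: v) -
  taylor l c (\val y) (word_mnm w) (\val y + t *: v).
have cE w : c (word_mnm w) = partial_word f w (\val y) by rewrite partial_word_val.
have := @seg_bound R n E q l H v `|v| M qs M0 (lexx _) _ _ _ (mnm_word a) 1.
rewrite /H size_mnm_word mnm_wordK scale1r /v subrKC partial_word_val mnm_wordK.
apply=> //; last lra.
- move=> w wl.
  have := @partial_word_segment _ _ _ _ _ _ lcU dU (CkP f) q w (\val y) (\val x)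
    qs (leq_trans wl lk) Uxy.
  move=> H1.
  have H2 : qder01 q (fun t => taylor l c (\val y) (word_mnm w) (\val y + t *: v))
      (fun t => \sum_i v 0 i *: taylor l c (\val y) (word_mnm (i :: w)) (\val y + t *: v)).
    apply: qdiff_qder01 => // t _.
    have := @ck_family_dirderiv R n E setT l _ v (\val y + t *: v) w openT
      (taylor_family l c (\val y)) I wl.
    by move=> /qdiffP; apply.
  have := qder01B qs H1 H2; rewrite /v; congr (qder01 q _ _).
  apply/funext => t /=; rewrite -sumrB; apply: eq_bigr => i _.
  by rewrite [RHS]scalerBr.
- move=> w wl; rewrite scale0r addr0 taylor_center cE subrr (semi0 qs).
  by rewrite mulr_ge0// exprn_ge0.
- move=> w t wl t01; rewrite taylor_top ?mdeg_word_mnm// cE.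
  exact: PM.
Qed.

Definition restriction_jet f : jet A E k :=
  fun (a : bmultinom n k.+1) x => partial a f (set_incl AU x).

Lemma restriction_jcoef f a (x : A) : (mdeg a <= k)%N ->
  jcoef (restriction_jet f) a x = partial a f (set_incl AU x).
Proof.
by rewrite -ltnS => ak; rewrite /jcoef insubT /=.
Qed.

Lemma restriction_remainder f l a (x y : A) : (l <= k)%N -> (mdeg a <= l)%N ->
  remainder (restriction_jet f) l a y x = partial a f (set_incl AU x) -
    taylor l (fun b => partial b f (set_incl AU y)) (\val y) a (\val x).
Proof.
move=> lk al; rewrite remainderE restriction_jcoef; last exact: leq_trans lk.
congr (_ - _); apply: taylor_ext => // b bl.
by rewrite restriction_jcoef//; exact: leq_trans lk.
Qed.

Lemma local_segments (x : U) : exists2 r : R, 0 < r & forall y z : U,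
  `|\val y - \val x| < r -> `|\val z - \val x| < r ->
  forall t : R, 0 <= t <= 1 -> U (\val y + t *: (\val z - \val y)).
Proof.
have [C [CU cC /nbhs_rVP[r r0 rC]]] := lcU (set_valP x).
exists r => // y z yr zr t t01; apply: CU.
have -> : \val y + t *: (\val z - \val y) = t *: \val z + (1 - t) *: \val y.
  by zmod.
apply: (convexP C).1 => //; apply: rC => //; exact: set_valP.
Qed.

(** Close points of a compact set are joined by segments in [U], on which the top
    order derivatives oscillate little by continuity. *)
Lemma restriction_whitney f : is_whitney (restriction_jet f).
Proof.
move=> l a q K e lk al qs cK e0.
pose m := (l - mdeg a)%N; pose e' := e / (n.+1%:R ^+ m * 2).
have n0 : (0 : R) < n.+1%:R ^+ m by rewrite exprn_gt0.
have e'0 : 0 < e' by rewrite divr_gt0// mulr_gt0.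
have e'E : n.+1%:R ^+ m * (e' * 2) = e.
  by rewrite mulrCA /e' divfK// gt_eqF// mulr_gt0.
have [x Kx|d d0 dP] := @lebesgue_number R n A K (fun y x =>
    q (remainder (restriction_jet f) l a y x) <= e * `|\val x - \val y| ^+ m) cK.
  pose x' := set_incl AU x.
  have [r r0 rU] := local_segments x'.
  have [r' r'0 r'P] : exists2 d : R, 0 < d & forall b : bmultinom n l.+1,
      forall y : U, `|\val y - \val x'| < d ->
      q (partial b f y - partial b f x') <= e'.
    apply: (@fin_delta R _ (fun (b : bmultinom n l.+1) d =>
      forall y : U, `|\val y - \val x'| < d ->
        q (partial b f y - partial b f x') <= e')).
      by move=> b d d' dd' Hb y yd; apply: Hb; lra.
    move=> b; have [|/continuous_setP cp _] := partialP (CkP f) (a := b).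
      by apply: leq_trans lk; rewrite -ltnS bmdeg.
    exact: cp.
  exists (Num.min r r') => [|y z]; first by rewrite lt_min r0.
  rewrite !lt_min => /andP[yr yr'] /andP[zr zr'].
  rewrite restriction_remainder//.
  have seg := rU (set_incl AU y) (set_incl AU z) yr zr.
  have M0 : 0 <= e' * 2 by rewrite mulr_ge0// ltW.
  have := @taylor_estimate f q l (set_incl AU z) (set_incl AU y) (e' * 2) qs lk M0 seg _ a al.
  move=> /(_ _)/le_trans; apply; last first.
    by rewrite -/m e'E.
  move=> w t wl t01.
  have Ut := seg t t01.
  pose u : U := exist _ (\val (set_incl AU y) +
    t *: (\val (set_incl AU z) - \val (set_incl AU y))) (mem_set Ut).
  rewrite (partial_word_val f w u) partial_word_val.
  have wb : (mdeg (word_mnm w) < l.+1)%N by rewrite mdeg_word_mnm wl.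
  have H1 := r'P (BMultinom wb) u.
  have H2 := r'P (BMultinom wb) (set_incl AU y) yr'.
  have ur : `|\val u - \val x'| < r' by exact: segment_ball.
  have := semi_tri qs (partial (word_mnm w) f u) (partial (word_mnm w) f x')
    (partial (word_mnm w) f (set_incl AU y)).
  have := H1 ur; rewrite (semiBC qs) in H2; rewrite /= in H2 *; lra.
exists d => // x y Kx Ky /andP[_ xyd].
have := dP y x Ky; rewrite (le_lt_trans (enorm_ge _) xyd) => /(_ isT) H.
rewrite (le_trans H)// ler_wpM2l ?(ltW e0)//.
by rewrite lerXn2r ?nnegrE ?enorm_ge0 ?enorm_ge.
Qed.

End Restriction.

Section RestrictionContinuity.
Context {R : realType} {n : nat} {E : lcsType R}.

Lemma compact_val_image (A : set 'rV[R]_n) (K : set A) : compact K ->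
  compact [set \val x | x in K].
Proof.
move=> cK; apply: continuous_compact => //; apply: continuous_subspaceT.
exact: initial_continuous.
Qed.

Lemma compact_val_preimage (U S : set 'rV[R]_n) : S `<=` U -> compact S ->
  compact (\val @^-1` S : set U).
Proof.
move=> SU cS F FF FS.
pose G : set_system 'rV[R]_n := [set P | F (\val @^-1` P)].
have PG : ProperFilter G.
  by apply: Build_ProperFilter; exact: (@filter_not_empty _ F).
have [p [Sp Fp]] := cS G PG FS.
pose u : U := exist _ p (mem_set (SU _ Sp)).
exists u; split=> // B V FB /nbhs_setP[d d0 dP].
have FB' : F (\val @^-1` [set \val x | x in B]).
  by apply: filterS FB => x Bx; exists x.
have pd : nbhs p [set y | `|y - p| < d] by apply/nbhs_rVP; exists d.
have [_ [[x Bx <-] /= xd]] := Fp _ _ FB' pd.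
by exists x; split=> //; exact: dP.
Qed.

Definition short_segments (K : set 'rV[R]_n) (d : R) : set 'rV[R]_n :=
  [set p | exists x y (t : R), [/\ K x, K y, 0 <= t <= 1, `|x - y| <= d &
    p = y + t *: (x - y)]].

Lemma compact_short_segments K d : compact K -> compact (short_segments K d).
Proof.
move=> cK.
pose Z : set ('rV[R]_n * 'rV[R]_n * R) := (K `*` K) `*` `[0, 1].
pose B : set ('rV[R]_n * 'rV[R]_n * R) := [set z | `|z.1.1 - z.1.2| <= d].
have cZ : compact (Z `&` B).
  apply: compact_closedI.
    by apply: compact_setX; [exact: compact_setX|exact: segment_compact].
  have -> : B = (fun z => `|z.1.1 - z.1.2|) @^-1` [set r | r <= d] by [].
  apply: closed_comp => [z _|]; last exact: closed_le.
  apply: (@cvg_norm _ 'rV[R]_n); apply: (@cvgB _ 'rV[R]_n).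
    by apply: (@cvg_comp _ _ _ fst fst _ _ _ cvg_fst); exact: cvg_fst.
  by apply: (@cvg_comp _ _ _ fst snd _ _ _ cvg_fst); exact: cvg_snd.
pose phi (z : 'rV[R]_n * 'rV[R]_n * R) := z.1.2 + z.2 *: (z.1.1 - z.1.2).
have -> : short_segments K d = phi @` (Z `&` B).
  rewrite predeqE => p; split=> [[x [y [t [Kx Ky t01 xy ->]]]]|].
    exists (x, y, t) => //; split=> //; split=> //=.
  move=> [[[x y] t] [[[Kx Ky] /=]]]; rewrite in_itv /= => t01 xy <-.
  by exists x, y, t.
apply: continuous_compact => //; apply: continuous_subspaceT => z.
have c1 : (fun z : 'rV[R]_n * 'rV[R]_n * R => z.1.1) @ z --> z.1.1.
  by apply: (@cvg_comp _ _ _ fst fst _ _ _ cvg_fst); exact: cvg_fst.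
have c2 : (fun z : 'rV[R]_n * 'rV[R]_n * R => z.1.2) @ z --> z.1.2.
  by apply: (@cvg_comp _ _ _ fst snd _ _ _ cvg_fst); exact: cvg_snd.
apply: (@cvgD _ 'rV[R]_n) => //; apply: (@cvgZ _ 'rV[R]_n); first exact: cvg_snd.
exact: (@cvgB _ 'rV[R]_n).
Qed.

Variables (U A : set 'rV[R]_n) (AU : A `<=` U) (k : nat).
Hypotheses (lcU : locally_convex_subset U) (dU : dense_interior U).
Implicit Types (f g : Ck U E k) (a b : multinom n).

Definition restriction f : whitney A E k :=
  MkWhitney (asboolT (restriction_whitney AU lcU dU f)).

(** Close points of [K] are joined by segments inside a compact subset of [U],
    along which the Taylor estimate applies; for distant points the remainder
    is bounded by the jet. *)
Lemma restriction_bound l q (K : set A) : (l <= k)%N -> continuous_seminorm q ->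
  compact K -> exists K' C, [/\ compact K', 0 <= C & forall f,
    whitney_norm l q K (restriction f) <= C * Ck_norm l q K' f].
Proof.
move=> lk qs cK.
have [x Kx|d d0 dP] := @lebesgue_number R n A K (fun y z =>
    forall t : R, 0 <= t <= 1 -> U (\val y + t *: (\val z - \val y))) cK.
  have [r r0 rU] := local_segments lcU (set_incl AU x).
  exists r => // y z yr zr; exact: (rU (set_incl AU y) (set_incl AU z)).
pose S := short_segments [set \val x | x in K] (d / 2).
have SU : S `<=` U.
  move=> _ [_ [_ [t [[x Kx <-] [y Ky <-] t01 xy ->]]]].
  by apply: dP => //; lra.
have cS : compact S by apply: compact_short_segments; exact: compact_val_image.
pose K' : set U := \val @^-1` S.
have cK' : compact K' by exact: compact_val_preimage.
have KS (x : A) : K x -> K' (set_incl AU x).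
  move=> Kx; exists (\val x), (\val x), 0; split=> //; [by exists x|by exists x| | |].
  - by rewrite lexx ler01.
  - by rewrite subrr normr0 divr_ge0// ltW.
  - by rewrite scale0r addr0.
have [C C0 CP] : exists2 C, 0 <= C & forall a : bmultinom n l.+1,
    forall (c : multinom n -> E) (u : E) (x y : 'rV[R]_n) (N : R), 0 <= N ->
    q u <= N -> (forall b, (mdeg b <= l)%N -> q (c b) <= N) ->
    (mdeg a <= l)%N -> d / 2 <= enorm (x - y) ->
    q (u - taylor l c y a x) <= C * N * enorm (x - y) ^+ (l - mdeg a).
  apply: (@fin_bound R _ (fun (a : bmultinom n l.+1) C =>
    forall (c : multinom n -> E) (u : E) (x y : 'rV[R]_n) (N : R), 0 <= N ->
    q u <= N -> (forall b, (mdeg b <= l)%N -> q (c b) <= N) ->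
    (mdeg a <= l)%N -> d / 2 <= enorm (x - y) ->
    q (u - taylor l c y a x) <= C * N * enorm (x - y) ^+ (l - mdeg a))).
    move=> a C C' CC H c u x y N N0 H1 H2 H3 H4.
    rewrite (le_trans (H c u x y N N0 H1 H2 H3 H4))// -mulrA -[leRHS]mulrA.
    by rewrite ler_wpM2r// mulr_ge0// exprn_ge0// enorm_ge0.
  by move=> a; apply: taylor_far => //; rewrite divr_gt0.
exists K', (1 + (C + n.+1%:R ^+ l * 2)); split=> //.
  by rewrite addr_ge0// addr_ge0// mulr_ge0// exprn_ge0.
move=> f; set N := Ck_norm l q K' f.
have N0 : 0 <= N by exact: Ck_norm_ge0.
have NP b (x : U) : (mdeg b <= l)%N -> K' x -> q (partial b f x) <= N.
  by move=> bl K'x; exact: Ck_norm_ge.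
rewrite whitney_normE mulrDl mul1r; apply: lerD.
  apply: whitney_sup_le => // a x al Kx.
  rewrite restriction_jcoef; last exact: leq_trans lk.
  exact: NP (KS x Kx).
apply: whitney_rem_le => [|a x y al Kx Ky xy].
  by rewrite mulr_ge0// addr_ge0// mulr_ge0// exprn_ge0.
rewrite [remainder _ _ _ _ _]restriction_remainder// !mulrDl.
have s0 : 0 < enorm (\val x - \val y) by rewrite enorm_gt0 val_sub_neq0.
have sm : 0 <= enorm (\val x - \val y) ^+ (l - mdeg a) by rewrite exprn_ge0// ltW.
have [near|far] := lerP (enorm (\val x - \val y)) (d / 2); last first.
  apply: (@le_trans _ _ (C * N * enorm (\val x - \val y) ^+ (l - mdeg a))).
    have al' : (mdeg a < l.+1)%N by [].
    apply: (CP (BMultinom al')) => //; [exact: NP (KS x Kx)| |exact: ltW].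
    by move=> b bl; exact: NP (KS y Ky).
  by rewrite lerDl mulr_ge0// !mulr_ge0// exprn_ge0.
have xyd : `|\val x - \val y| <= d / 2 by rewrite (le_trans (enorm_ge _)).
have seg (t : R) : 0 <= t <= 1 -> S (\val y + t *: (\val x - \val y)).
  by move=> t01; exists (\val x), (\val y), t; split=> //; [exists x|exists y].
have N2 : 0 <= N * 2 by rewrite mulr_ge0.
have H := @taylor_estimate _ _ _ _ _ lcU dU f q l (set_incl AU x) (set_incl AU y)
  (N * 2) qs lk N2 (fun t t01 => SU _ (seg t t01)) _ a al.
apply: (le_trans (H _)).
  move=> w t wl t01; have Ut := SU _ (seg t t01).
  pose u : U := exist _ (\val y + t *: (\val x - \val y)) (mem_set Ut).
  have K'u : K' u by exact: seg.
  rewrite (partial_word_val f w u) partial_word_val mulr2n.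
  rewrite mulrDr mulr1 (le_trans (semi_leB qs _ _))// lerD// NP ?mdeg_word_mnm ?wl//.
  exact: KS.
rewrite /=.
apply: (@le_trans _ _ (n.+1%:R ^+ l * 2 * N * enorm (\val x - \val y) ^+ (l - mdeg a))).
  rewrite -(mulrA _ 2) (mulrC 2); apply: ler_pM => //.
  - by rewrite !mulr_ge0// exprn_ge0.
  - by rewrite ler_wpM2r// ler_weXn2l ?leq_subr// ler1n.
  - by rewrite lerXn2r ?nnegrE ?enorm_ge0 ?enorm_ge.
by rewrite lerDr !mulr_ge0.
Qed.

Fact restriction_linear : linear restriction.
Proof.
move=> c f g; apply/val_inj/funext => a; apply/funext => x.
by rewrite /= /restriction_jet partial_lin// -ltnS bmdeg.
Qed.

HB.instance Definition _ := GRing.isLinear.Build R (Ck U E k) (whitney A E k) _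
  restriction restriction_linear.

Lemma restriction_continuous : continuous restriction.
Proof.
apply: (@seminorm_continuous R (Ck U E k) (whitney A E k)
  (@Ck_seminorms R n U E k) (@whitney_seminorms R n A E k)
  (restriction : {linear _ -> _}) erefl erefl).
  by move=> _ [l [q [K [lk qs cK ->]]]] f g; exact: whitney_normD.
move=> _ [l [q [K [lk qs cK ->]]]].
have [K' [B [cK' B0 BP]]] := restriction_bound lk qs cK.
exists (Ck_norm l q K'), B; split=> //; first by exists l, q, K'.
- exact: Ck_norm0.
- by move=> f; exact: Ck_norm_ge0.
Qed.

End RestrictionContinuity.

(** * A partition of unity on the line *)

Section Step.
Context {R : realType}.
Implicit Types (p r : {poly R}) (t u v : R).

Lemma poly_bounded p :
  exists2 C : R, 0 <= C & forall u, 0 <= u <= 1 -> `|p.[u]| <= C.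
Proof.
elim/poly_ind: p => [|p c [C C0 IH]].
  by exists 0 => // u _; rewrite horner0 normr0.
exists (C + `|c|) => [|u u01]; first by rewrite addr_ge0.
rewrite hornerMXaddC (le_trans (ler_normD _ _))// lerD2r normrM.
have/andP[u0 u1] := u01; rewrite (ger0_norm u0).
by have := IH u u01; have := normr_ge0 p.[u]; nra.
Qed.

Lemma poly_second_order p : exists2 C : R, 0 <= C & forall u v,
  0 <= u <= 1 -> 0 <= v <= 1 ->
  `|p.[u] - p.[v] - (u - v) * p^`().[v]| <= C * (u - v) ^+ 2.
Proof.
elim/poly_ind: p => [|p c [C C0 IH]].
  exists 0 => // u v _ _; rewrite deriv0 !horner0 mulr0 !subr0 normr0 mul0r//.
have [C' C'0 C'P] := poly_bounded p^`().
exists (C + C') => [|u v u01 v01]; first by rewrite addr_ge0.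
rewrite derivMXaddC !hornerMXaddC hornerD hornerMX.
have -> : p.[u] * u + c - (p.[v] * v + c) - (u - v) * (p.[v] + p^`().[v] * v) =
    u * (p.[u] - p.[v] - (u - v) * p^`().[v]) + (u - v) ^+ 2 * p^`().[v] by ring.
rewrite (le_trans (ler_normD _ _))// [leRHS]mulrDl lerD//.
  rewrite normrM; have/andP[u0 u1] := u01; rewrite (ger0_norm u0).
  by rewrite (le_trans _ (IH u v u01 v01))// ler_piMl.
by rewrite normrM ger0_norm ?sqr_ge0// mulrC ler_wpM2r ?sqr_ge0// C'P.
Qed.

Definition clamp t : R := if t <= 0 then 0 else if 1 <= t then 1 else t.

Lemma clamp_le0 t : t <= 0 -> clamp t = 0.
Proof. by rewrite /clamp => ->. Qed.

Lemma clamp_ge1 t : 1 <= t -> clamp t = 1.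
Proof. by move=> t1; rewrite /clamp t1 leNgt (lt_le_trans ltr01 t1). Qed.

Lemma clamp_id t : 0 <= t <= 1 -> clamp t = t.
Proof.
rewrite /clamp => /andP[t0 t1]; case: ifPn => [tle|_]; first lra.
by case: ifPn => // t1'; lra.
Qed.

Lemma clampP t : 0 <= clamp t <= 1.
Proof.
by rewrite /clamp; case: ifPn => [_|t0]; [|case: ifPn => t1]; lra.
Qed.

Lemma clamp_lipschitz u v : `|clamp u - clamp v| <= `|u - v|.
Proof.
by rewrite /clamp; case: (ltrP u v) => uv;
  case: ifPn => u0; case: ifPn => v0; try case: ifPn => u1;
  try case: ifPn => v1; rewrite ler_norml; lra.
Qed.

Lemma poly_lipschitz p : exists2 C : R, 0 <= C & forall u v,
  0 <= u <= 1 -> 0 <= v <= 1 -> `|p.[u] - p.[v]| <= C * `|u - v|.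
Proof.
have [C C0 CP] := poly_second_order p; have [B B0 BP] := poly_bounded p^`().
exists (C + B) => [|u v u01 v01]; first by rewrite addr_ge0.
have -> : p.[u] - p.[v] =
  (p.[u] - p.[v] - (u - v) * p^`().[v]) + (u - v) * p^`().[v] by ring.
rewrite (le_trans (ler_normD _ _))// [leRHS]mulrDl lerD//.
  rewrite (le_trans (CP u v u01 v01))// ler_wpM2l//.
  rewrite -(real_normK (num_real _)) expr2 ler_piMl//.
  by rewrite ler_norml; lra.
by rewrite normrM mulrC ler_wpM2r// BP.
Qed.

(** Composing with [clamp] a polynomial whose derivative vanishes at both end
    points gives a function on the whole line with one more derivative. *)
Lemma clamp_second_order p : p^`().[0] = 0 -> p^`().[1] = 0 ->
  exists2 C : R, 0 <= C & forall u v,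
  `|p.[clamp u] - p.[clamp v] - (u - v) * p^`().[clamp v]| <= C * (u - v) ^+ 2.
Proof.
move=> p0 p1; have [C C0 CP] := poly_second_order p.
have [L L0 LP] := poly_lipschitz p^`().
exists (C + L) => [|u v]; first by rewrite addr_ge0.
set a := clamp u; set b := clamp v.
have -> : p.[a] - p.[b] - (u - v) * p^`().[b] =
  (p.[a] - p.[b] - (a - b) * p^`().[b]) + ((a - b) - (u - v)) * p^`().[b] by ring.
rewrite (le_trans (ler_normD _ _))// [leRHS]mulrDl lerD//.
  apply: (le_trans (CP a b (clampP u) (clampP v))); rewrite ler_wpM2l//.
  rewrite -(real_normK (num_real (a - b))) -(real_normK (num_real (u - v))).
  by rewrite lerXn2r ?nnegrE ?clamp_lipschitz.
have sq0 : 0 <= L * (u - v) ^+ 2 by rewrite mulr_ge0 ?sqr_ge0.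
have [v0|v0] := lerP v 0; first by rewrite /b clamp_le0// p0 mulr0 normr0.
have [v1|v1] := lerP 1 v; first by rewrite /b clamp_ge1// p1 mulr0 normr0.
have v01 : 0 <= v <= 1 by lra.
rewrite /b clamp_id// /a.
have key (c : R) : p^`().[c] = 0 -> 0 <= c <= 1 -> `|v - c| <= `|u - v| ->
    `|c - v - (u - v)| <= `|u - v| ->
    `|(c - v - (u - v)) * p^`().[v]| <= L * (u - v) ^+ 2.
  move=> pc c01 vc cu; have := LP v c v01 c01; rewrite pc subr0 => H.
  rewrite normrM -(real_normK (num_real (u - v))) expr2 mulrCA.
  apply: ler_pM => //; apply: (le_trans H); rewrite ler_wpM2l//.
have [u0|u0] := lerP u 0.
  rewrite clamp_le0//; apply: key => //; first lra.
    by rewrite subr0 ger0_norm ?ler0_norm; lra.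
  by rewrite ger0_norm ?ler0_norm; lra.
have [u1|u1] := lerP 1 u.
  rewrite clamp_ge1//; apply: key => //; first lra.
    by rewrite ler0_norm ?ger0_norm; lra.
  by rewrite ler0_norm ?ger0_norm; lra.
by rewrite clamp_id ?subrr ?mul0r ?normr0//; lra.
Qed.

Lemma derivn_factor p r a N c : p = r * ('X - a%:P) ^+ N -> (c <= N)%N ->
  exists r', p^`(c) = r' * ('X - a%:P) ^+ (N - c).
Proof.
move=> pr; elim: c => [_|c IH cN]; first by exists r; rewrite derivn0 subn0.
have [r' r'P] := IH (ltnW cN).
exists (r'^`() * ('X - a%:P) + r' *+ (N - c)).
rewrite derivnS r'P derivM deriv_exp derivXsubC mul1r.
rewrite (_ : (N - c)%N = (N - c.+1).+1) /=; last by rewrite subnSK.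
by rewrite exprS -mulr_natr -[in RHS]mulr_natr; ring.
Qed.

Lemma derivn_root p r a N c : p = r * ('X - a%:P) ^+ N -> (c < N)%N ->
  p^`(c).[a] = 0.
Proof.
move=> pr cN; have [r' ->] := derivn_factor pr (ltnW cN).
rewrite hornerM horner_exp hornerXsubC subrr expr0n subn_eq0 leqNgt cN mulr0//.
Qed.

(** The polynomial [3 X^2 - 2 X^3] doubles, by composition, the order of contact
    with the constants 0 at 0 and 1 at 1. *)
Lemma smoothstep (k : nat) : exists p : {poly R}, [/\ p.[0] = 0, p.[1] = 1 &
  forall c, (1 <= c <= k)%N -> p^`(c).[0] = 0 /\ p^`(c).[1] = 0].
Proof.
have [p [r0 p0] [r1 p1]] : exists2 p : {poly R},
    exists r, p = r * ('X - 0%:P) ^+ (2 ^ k) &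
    exists r, p - 1 = r * ('X - 1%:P) ^+ (2 ^ k).
  elim: k => [|k [p [r0 p0] [r1 p1]]].
    exists 'X; exists 1; rewrite mul1r expn0 expr1//.
    by rewrite polyC0 subr0.
  exists (p ^+ 2 * (3%:R - p *+ 2)).
    exists (r0 ^+ 2 * (3%:R - p *+ 2)).
    by rewrite {1}p0 expnS mul2n -addnn exprD; ring.
  exists (- r1 ^+ 2 * (1 + p *+ 2)).
  have -> : p ^+ 2 * (3%:R - p *+ 2) - 1 = - (p - 1) ^+ 2 * (1 + p *+ 2) by ring.
  by rewrite p1 expnS mul2n -addnn exprD; ring.
have k0 : (k < 2 ^ k)%N by exact: ltn_expl.
exists p; split.
- by have := derivn_root p0 (leq_ltn_trans (leq0n k) k0); rewrite derivn0.
- have := derivn_root p1 (leq_ltn_trans (leq0n k) k0); rewrite derivn0.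
  by rewrite hornerD hornerN hornerC => /eqP; rewrite subr_eq0 => /eqP.
- move=> c /andP[c1 ck]; have ck' := leq_ltn_trans ck k0.
  split; first exact: derivn_root p0 ck'.
  have := derivn_root p1 ck'; rewrite derivnB.
  by case: c c1 {ck ck'} => // c _; rewrite [1^`(_)]derivnC /= subr0.
Qed.

(** [th 0] is a bump supported in [[-1, 1]], with derivatives [th c] and with
    integer translates that form a partition of unity. *)
Definition is_bump (k : nat) (th : nat -> R -> R) (C : R) := 0 <= C /\
  [/\ forall c t, (c <= k)%N -> `|th c t| <= C,
      forall c u v, (c <= k)%N -> `|th c u - th c v| <= C * `|u - v|,
      forall c u v, (c < k)%N ->
        `|th c u - th c v - (u - v) * th c.+1 v| <= C * (u - v) ^+ 2,
      forall c t, (c <= k)%N -> 1 <= `|t| -> th c t = 0 &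
      forall c t, (c <= k)%N -> 0 <= t <= 1 ->
        th c t + th c (t - 1) = (c == 0%N)%:R].

(** The difference [s (t + 1) - s t] of two translates of the step [s] obtained
    from [smoothstep] by clamping. *)
Lemma bump_exists (k : nat) : exists th C, is_bump k th C.
Proof.
have [p [p0 p1 pc]] := smoothstep k.
pose s c t : R := p^`(c).[clamp t].
have s0 c t : (c <= k)%N -> t <= 0 -> s c t = 0.
  move=> ck t0; rewrite /s clamp_le0//.
  by case: c ck => [|c ck]; [rewrite derivn0|case: (pc c.+1)].
have s1 c t : (c <= k)%N -> 1 <= t -> s c t = (c == 0%N)%:R.
  move=> ck t0; rewrite /s clamp_ge1//.
  by case: c ck => [|c ck]; [rewrite derivn0|case: (pc c.+1)].
have [C C0 CP] : exists2 C : R, 0 <= C & forall c : 'I_k.+1,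
   [/\ forall t, `|s c t| <= C, forall u v, `|s c u - s c v| <= C * `|u - v| &
     (c < k)%N -> forall u v,
       `|s c u - s c v - (u - v) * s c.+1 v| <= C * (u - v) ^+ 2].
  apply: (@fin_bound R _ (fun (c : 'I_k.+1) C => [/\ forall t, `|s c t| <= C,
     forall u v, `|s c u - s c v| <= C * `|u - v| & (c < k)%N -> forall u v,
       `|s c u - s c v - (u - v) * s c.+1 v| <= C * (u - v) ^+ 2])).
    move=> c C C' CC [H1 H2 H3]; split=> [t|u v|ck u v].
    - exact: le_trans (H1 t) CC.
    - by rewrite (le_trans (H2 u v))// ler_wpM2r.
    - by rewrite (le_trans (H3 ck u v))// ler_wpM2r ?sqr_ge0.
  move=> c; have [C1 C10 C1P] := poly_bounded p^`(c).
  have [C2 C20 C2P] := poly_lipschitz p^`(c).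
  have [C3 C30 C3P] : exists2 C : R, 0 <= C & (c < k)%N -> forall u v,
       `|s c u - s c v - (u - v) * s c.+1 v| <= C * (u - v) ^+ 2.
    have [ck|kc] := ltnP c k; last by exists 0.
    have [//|d0 d1] := pc c.+1.
    have [C C0 CP] := clamp_second_order (p := p^`(c)) d0 d1.
    by exists C => // _ u v; exact: CP.
  exists (C1 + C2 + C3); first by rewrite !addr_ge0.
  split=> [t|u v|ck u v].
  - by rewrite (le_trans (C1P _ (clampP t)))// -addrA lerDl addr_ge0.
  - apply: (le_trans (C2P _ _ (clampP u) (clampP v))).
    apply: (@le_trans _ _ (C2 * `|u - v|)).
      by rewrite ler_wpM2l// clamp_lipschitz.
    by rewrite ler_wpM2r// addrAC lerDr addr_ge0.
  - by rewrite (le_trans (C3P ck u v))// ler_wpM2r ?sqr_ge0// lerDr addr_ge0.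
have CP' c (ck : (c <= k)%N) := CP (Ordinal (ck : (c < k.+1)%N)).
exists (fun c t => s c (t + 1) - s c t), (C * 2); split; first by rewrite mulr_ge0.
split.
- move=> c t ck; have [H _ _] := CP' c ck; move: H => /= H.
  by rewrite (le_trans (ler_normB _ _))// mulr2n mulrDr mulr1 lerD.
- move=> c u v ck; have [_ H _] := CP' c ck; move: H => /= H.
  have -> : s c (u + 1) - s c u - (s c (v + 1) - s c v) =
    (s c (u + 1) - s c (v + 1)) - (s c u - s c v) by ring.
  rewrite (le_trans (ler_normB _ _))// -mulrA mulrC mulr2n mulrDl mul1r.
  rewrite mulrC mulrDr; apply: lerD; last exact: H.
  by have := H (u + 1) (v + 1); rewrite (_ : u + 1 - (v + 1) = u - v)//; ring.
- move=> c u v ck; have [_ _ /(_ ck) /= H] := CP' c (ltnW ck).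
  have -> : s c (u + 1) - s c u - (s c (v + 1) - s c v) -
      (u - v) * (s c.+1 (v + 1) - s c.+1 v) =
    (s c (u + 1) - s c (v + 1) - ((u + 1) - (v + 1)) * s c.+1 (v + 1)) -
    (s c u - s c v - (u - v) * s c.+1 v) by ring.
  rewrite (le_trans (ler_normB _ _))//.
  have uv : u + 1 - (v + 1) = u - v by ring.
  have := H (u + 1) (v + 1); have := H u v; rewrite uv => H1 H2.
  by rewrite mulrAC mulr2n mulrDr mulr1 lerD.
- move=> c t ck; have [t0|t0] := lerP 0 t.
    by rewrite (ger0_norm t0) => t1; rewrite !s1 ?subrr//; lra.
  by rewrite (ltr0_norm t0) => t1; rewrite !s0 ?subrr//; lra.
- move=> c t ck t01; rewrite subrK addrC.
  rewrite [s c (t - 1)]s0// ?[s c (t + 1)]s1//; [|lra|lra].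
  by rewrite subr0 addrC subrK.
Qed.

End Step.

(** * Interpolation on a grid *)

Section Products.
Context {R : realType} {n : nat} {E : lcsType R}.
Implicit Types (x y : 'rV[R]_n) (F : 'rV[R]_n -> E).

Lemma qcont_mul q (al : 'rV[R]_n -> R) F x (B L : R) : continuous_seminorm q ->
  0 <= L -> 0 <= B -> (forall y, `|al y| <= B) ->
  (forall y, `|al y - al x| <= L * `|y - x|) -> qcont q F x ->
  qcont q (fun y => al y *: F y) x.
Proof.
move=> qs L0 B0 alB alL cF e e0; have [|d d0 dP] := cF (e / 2 / (B + 1)).
  by rewrite !divr_gt0//; lra.
have F0 := semi_ge0 qs (F x).
have M0 : 0 < L * q (F x) + 1 by nra.
exists (Num.min d (e / 2 / (L * q (F x) + 1))).
  by rewrite lt_min d0 !divr_gt0.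
move=> y; rewrite lt_min ltr_pdivlMr// => /andP[yd ye].
have -> : al y *: F y - al x *: F x =
    al y *: (F y - F x) + (al y - al x) *: F x by rewrite scalerBl; zmod.
rewrite (le_trans (semi_le qs _ _))// !(semiZ qs).
have := dP y yd; rewrite ler_pdivlMr; last lra.
have := alB y; have := alL y; have := semi_ge0 qs (F y - F x).
move: (q (F y - F x)) (q (F x)) `|al y| `|al y - al x| `|y - x|
  (normr_ge0 (al y)) (normr_ge0 (al y - al x)) (normr_ge0 (y - x)) F0 ye.
move=> a b c d' r c0 d'0 r0 b0 H1 a0 H2 H3 H4.
have : c * a <= B * a by nra.
have : d' * b <= L * r * b by nra.
nra.
Qed.

(** The product rule; the regularity of the scalar factor is given by explicit
    bounds, in the form which [is_bump] provides. *)
Lemma qdiff_mul q (al : 'rV[R]_n -> R) (al' : R) F y x l (B L : R) :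
  continuous_seminorm q -> 0 <= L -> 0 <= B -> (forall u, `|al u| <= B) ->
  (forall s : R, `|al (x + s *: y) - al x| <= L * `|s|) ->
  (forall s : R, `|al (x + s *: y) - al x - s * al'| <= L * s ^+ 2) ->
  qdiff q F y x l -> qdiff q (fun u => al u *: F u) y x (al' *: F x + al x *: l).
Proof.
move=> qs L0 B0 alB alL alD dF e e0; have [|d d0 dP] := dF (e / 3 / (B + 1)).
  by rewrite !divr_gt0//; lra.
have F0 := semi_ge0 qs (F x); have l0 := semi_ge0 qs l.
have M0 : 0 < L * q (F x) + 1 by nra.
have N0 : 0 < L * q l + 1 by nra.
exists (Num.min d (Num.min (e / 3 / (L * q (F x) + 1)) (e / 3 / (L * q l + 1)))).
  by rewrite !lt_min d0 !divr_gt0.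
move=> s; rewrite !lt_min !ltr_pdivlMr// => /andP[sd /andP[s1 s2]].
have -> : al (x + s *: y) *: F (x + s *: y) - al x *: F x -
    s *: (al' *: F x + al x *: l) =
    (al (x + s *: y) *: (F (x + s *: y) - F x - s *: l) +
     (al (x + s *: y) - al x - s * al') *: F x) +
    s *: ((al (x + s *: y) - al x) *: l).
  have -> : s *: ((al (x + s *: y) - al x) *: l) =
      al (x + s *: y) *: (s *: l) - s *: (al x *: l).
    by rewrite scalerBl scalerBr !scalerA [s * al (_ + _)]mulrC.
  by zmod.
rewrite (le_trans (semi_le qs _ _))//.
rewrite (le_trans (lerD (semi_le qs _ _) (lexx _)))// !(semiZ qs).
have := dP s sd; have := alB (x + s *: y); have := alL s; have := alD s.
rewrite -(real_normK (num_real s)).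
move: (q (F (x + s *: y) - F x - s *: l)) (semi_ge0 qs (F (x + s *: y) - F x - s *: l)).
move: `|al (x + s *: y)| (normr_ge0 (al (x + s *: y))).
move: `|al (x + s *: y) - al x| (normr_ge0 (al (x + s *: y) - al x)).
move: `|al (x + s *: y) - al x - s * al'| (normr_ge0 (al (x + s *: y) - al x - s * al')).
move: (q (F x)) (q l) `|s| (normr_ge0 s) F0 l0 M0 N0 s1 s2 {sd dP d0 dF}.
move=> f m r r0 f0 m0 M0 N0 s1 s2 a a0 b b0 c c0 u u0 Ha Hb Hc Hu.
have H1 : c * u <= e / 3 * r.
  have B1 : 0 < B + 1 by lra.
  have : u * (B + 1) <= e / 3 * r.
    by rewrite -ler_pdivlMr// mulrAC.
  have : c * u <= B * u by rewrite ler_wpM2r.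
  by nra.
have H2 : a * f <= e / 3 * r.
  have : a * f <= L * r ^+ 2 * f by rewrite ler_wpM2r.
  have : r * (r * (L * f + 1)) <= r * (e / 3) by rewrite ler_wpM2l//; lra.
  by have := sqr_ge0 r; nra.
have H3 : r * (b * m) <= e / 3 * r.
  rewrite mulrC ler_wpM2r//.
  have : b * m <= L * r * m by rewrite ler_wpM2r.
  by nra.
lra.
Qed.

Lemma qcont_sum_in q (I : eqType) (r : seq I) (F : I -> 'rV[R]_n -> E) x :
  continuous_seminorm q -> (forall i, i \in r -> qcont q (F i) x) ->
  qcont q (fun y => \sum_(i <- r) F i y) x.
Proof.
move=> qs; elim: r => [|i r IH] cF.
  by under eq_fun do rewrite big_nil; exact: qcont_cst.
rewrite (_ : (fun y => _) = fun y => 1 *: F i y + \sum_(j <- r) F j y).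
  apply: qcont_lin => //; first by apply: cF; rewrite mem_head.
  by apply: IH => j jr; apply: cF; rewrite inE jr orbT.
by apply/funext => y; rewrite big_cons scale1r.
Qed.

Lemma qdiff_sum_in q (I : eqType) (r : seq I) (F : I -> 'rV[R]_n -> E) y x l :
  continuous_seminorm q -> (forall i, i \in r -> qdiff q (F i) y x (l i)) ->
  qdiff q (fun y => \sum_(i <- r) F i y) y x (\sum_(i <- r) l i).
Proof.
move=> qs; elim: r => [|i r IH] dF.
  rewrite big_nil (_ : (fun z => _) = fun=> 0); first exact: qdiff_cst.
  by apply/funext => z; rewrite big_nil.
rewrite big_cons -(scale1r (l i)).
rewrite (_ : (fun y => _) = fun y => 1 *: F i y + \sum_(j <- r) F j y).
  apply: qdiff_lin => //; first by apply: dF; rewrite mem_head.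
  by apply: IH => j jr; apply: dF; rewrite inE jr orbT.
by apply/funext => z; rewrite big_cons scale1r.
Qed.

End Products.

Section Interpolation.
Context {R : realType} {n : nat} {E : lcsType R}.
Implicit Types (x y : 'rV[R]_n) (w v : seq 'I_n) (z : int) (i j : 'I_n).
Local Notation fam := (seq 'I_n -> 'rV[R]_n -> E).
Implicit Types (F : 'rV[R]_n -> E) (G : fam) (H : int -> fam).

Local Notation "''e_' i" := (delta_mx 0 i : 'rV[R]_n) (at level 8, i at level 2).

Variables (k : nat) (th : nat -> R -> R) (C : R).
Hypothesis bump : is_bump k th C.

Let C0 : 0 <= C. Proof. by case: bump. Qed.
Let thB c t : (c <= k)%N -> `|th c t| <= C.
Proof. by case: bump => _ [H _ _ _ _]; exact: H. Qed.
Let thL c (u v : R) : (c <= k)%N -> `|th c u - th c v| <= C * `|u - v|.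
Proof. by case: bump => _ [_ H _ _ _]; exact: H. Qed.
Let thD c (u v : R) : (c < k)%N ->
  `|th c u - th c v - (u - v) * th c.+1 v| <= C * (u - v) ^+ 2.
Proof. by case: bump => _ [_ _ H _ _]; exact: H. Qed.
Let th0 c t : (c <= k)%N -> 1 <= `|t| -> th c t = 0.
Proof. by case: bump => _ [_ _ _ H _]; exact: H. Qed.
Let th1 c t : (c <= k)%N -> 0 <= t <= 1 -> th c t + th c (t - 1) = (c == 0%N)%:R.
Proof. by case: bump => _ [_ _ _ _ H]; exact: H. Qed.

Variable lam : R.
Hypothesis lam0 : 0 < lam.

(** The ways to distribute the letters of a word over the two factors of a
    product, the first of which depends on the coordinate [j] only: a number of
    letters [j] for it, and a word for the other one. *)
Fixpoint splits j w : seq (nat * seq 'I_n) := if w is i :: w' then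
    [seq (cv.1, i :: cv.2) | cv <- splits j w'] ++
    (if i == j then [seq (cv.1.+1, cv.2) | cv <- splits j w'] else [::])
  else [:: (0%N, [::])].

Lemma splits_size j w cv : cv \in splits j w -> (cv.1 + size cv.2)%N = size w.
Proof.
elim: w cv => [|i w IH] cv /=; first by rewrite inE => /eqP ->.
rewrite mem_cat => /orP[/mapP[cv' /IH <- ->]|]; first by rewrite /= addnS.
by case: eqP => // _ /mapP[cv' /IH <- ->]; rewrite /= addSn.
Qed.

Lemma size_splits j w : (size (splits j w) <= 2 ^ size w)%N.
Proof.
elim: w => //= i w IH; rewrite size_cat size_map expnS mul2n -addnn leq_add//.
by case: eqP => // _; rewrite size_map.
Qed.

Lemma splits_sum0 j w (g : seq 'I_n -> E) :
  \sum_(cv <- splits j w) (cv.1 == 0%N)%:R *: g cv.2 = g w.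
Proof.
elim: w g => [|i w IH] g /=; first by rewrite big_seq1 scale1r.
rewrite big_cat big_map /= (IH (fun v => g (i :: v))).
case: eqP => _; last by rewrite big_nil addr0.
by rewrite big_map big1 ?addr0// => cv _; rewrite scale0r.
Qed.

(** The [c]-th derivative, in the direction [j], of the weight of the grid
    hyperplane of index [z]. *)
Definition weight j z c x : R := lam ^+ c * th c (lam * x 0 j - z%:~R).

(** The Leibniz rule for the product of [weight j z 0] and [G]. *)
Definition pterm j z G w x : E :=
  \sum_(cv <- splits j w) weight j z cv.1 x *: G cv.2 x.

(** The sum of [pterm j z (H z)] over all integers [z]: at [x] the weights vanish
    except for the two grid hyperplanes next to [x]. *)
Definition interp j H w x : E :=
  let t := Num.floor (lam * x 0 j) in
  pterm j t (H t) w x + pterm j (t + 1) (H (t + 1)) w x.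

Lemma weight_le j z c x : (c <= k)%N -> `|weight j z c x| <= lam ^+ c * C.
Proof.
move=> ck; rewrite normrM ger0_norm ?exprn_ge0 ?(ltW lam0)//.
by rewrite ler_wpM2l ?exprn_ge0 ?(ltW lam0)// thB.
Qed.

Lemma pterm_family D j z G : ck_family D k G -> ck_family D k (pterm j z G).
Proof.
move=> GD q qs x Dx w; have lam_ge0 := ltW lam0.
have lc c : 0 <= lam ^+ c by rewrite exprn_ge0.
have th_lip c y u : (c <= k)%N ->
    `|weight j z c y - weight j z c u| <= lam ^+ c * C * lam * `|y 0 j - u 0 j|.
  move=> ck; rewrite /weight -mulrBr normrM (ger0_norm (lc c)) -!mulrA.
  rewrite ler_wpM2l//; apply: (le_trans (thL _ _ ck)); rewrite ler_wpM2l//.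
  rewrite (_ : _ - _ - _ = lam * (y 0 j - u 0 j)); last by ring.
  by rewrite normrM ger0_norm.
split=> [wk|wk i].
  apply: qcont_sum_in => // cv cvw.
  have sz := splits_size cvw.
  have ck : (cv.1 <= k)%N by rewrite (leq_trans _ wk)// -sz leq_addr.
  apply: (@qcont_mul _ _ _ q _ _ _ (lam ^+ cv.1 * C) (lam ^+ cv.1 * C * lam)) => //.
  - by rewrite !mulr_ge0.
  - by rewrite !mulr_ge0.
  - by move=> y; exact: weight_le.
  - move=> y; rewrite (le_trans (th_lip _ _ _ ck))// ler_wpM2l ?mulr_ge0//.
    by have := coord_le (y - x) j; rewrite !mxE.
  - by apply: (GD q qs x Dx cv.2).1; rewrite (leq_trans _ wk)// -sz leq_addl.
pose l (cv : nat * seq 'I_n) : E :=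
  (if i == j then weight j z cv.1.+1 x else 0) *: G cv.2 x +
  weight j z cv.1 x *: G (i :: cv.2) x.
have -> : pterm j z G (i :: w) x = \sum_(cv <- splits j w) l cv.
  rewrite /pterm /= big_cat big_map big_split /= addrC; congr (_ + _).
  case: eqP => _; first by rewrite big_map.
  by rewrite big_nil big1// => cv _; rewrite scale0r.
apply: qdiff_sum_in => // cv cvw.
have sz := splits_size cvw.
have ck : (cv.1 < k)%N by rewrite (leq_ltn_trans _ wk)// -sz leq_addr.
pose L := lam ^+ cv.1 * C * lam + lam ^+ cv.1 * C * lam ^+ 2.
have coord (s : R) : (x + s *: 'e_i) 0 j = x 0 j + s * (i == j)%:R.
  by rewrite !mxE eqxx /= eq_sym.
apply: (@qdiff_mul _ _ _ q _ _ _ _ _ _ (lam ^+ cv.1 * C) L) => //.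
- by rewrite addr_ge0// !mulr_ge0// exprn_ge0.
- by rewrite !mulr_ge0.
- by move=> y; apply: weight_le; exact: ltnW.
- move=> s; rewrite (le_trans (th_lip _ _ _ (ltnW ck)))//; apply: ler_pM => //.
  + by rewrite !mulr_ge0.
  + by rewrite lerDl !mulr_ge0// exprn_ge0.
  + rewrite coord addrAC subrr add0r normrM.
    by case: (i == j); rewrite ?normr1 ?normr0 ?mulr1 ?mulr0.
- move=> s; rewrite /weight coord; case: (i == j); last first.
    by rewrite !mulr0 addr0 subrr subr0 normr0 mulr_ge0 ?sqr_ge0//
      addr_ge0// !mulr_ge0// exprn_ge0.
  have := thD (lam * (x 0 j + s * 1) - z%:~R) (lam * x 0 j - z%:~R) ck.
  have -> : lam * (x 0 j + s * 1) - z%:~R - (lam * x 0 j - z%:~R) = lam * s by ring.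
  set a := th _ _; set b := th _ (_ - _); set b' := th _.+1 _ => H.
  have -> : lam ^+ cv.1 * a - lam ^+ cv.1 * b - s * (lam ^+ cv.1.+1 * b') =
     lam ^+ cv.1 * (a - b - lam * s * b') by rewrite exprS; ring.
  rewrite normrM (ger0_norm (lc _)).
  apply: (@le_trans _ _ (lam ^+ cv.1 * (C * (lam * s) ^+ 2))).
    by rewrite ler_wpM2l.
  have -> : lam ^+ cv.1 * (C * (lam * s) ^+ 2) =
    lam ^+ cv.1 * C * lam ^+ 2 * s ^+ 2 by ring.
  apply: ler_wpM2r; first exact: sqr_ge0.
  by rewrite /L lerDr !mulr_ge0.
- by apply: (GD q qs x Dx cv.2).2; rewrite (leq_ltn_trans _ wk)// -sz leq_addl.
Qed.

Lemma pterm_far j z G w x : (size w <= k)%N -> 1 <= `|lam * x 0 j - z%:~R| ->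
  pterm j z G w x = 0.
Proof.
move=> wk far; rewrite /pterm big_seq big1// => cv /splits_size cvw.
by rewrite /weight th0 ?mulr0 ?scale0r// (leq_trans _ wk)// -cvw leq_addr.
Qed.

(** The floor is not locally constant, but near [x] it takes at most two
    consecutive values. *)
Lemma interp_local j H w x : (size w <= k)%N ->
  let t := Num.floor (lam * x 0 j) in
  exists2 r : R, 0 < r & forall y, `|y - x| < r -> interp j H w y =
    pterm j (t - 1) (H (t - 1)) w y + pterm j t (H t) w y +
    pterm j (t + 1) (H (t + 1)) w y.
Proof.
move=> wk t; have/andP[t0 t1] := floor_itv (lam * x 0 j); rewrite -/t in t0 t1.
have m0 : 0 < Num.min 1 ((t + 1)%:~R - lam * x 0 j) by rewrite lt_min ltr01 subr_gt0.
exists (Num.min 1 ((t + 1)%:~R - lam * x 0 j) / lam); first by rewrite divr_gt0.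
move=> y; rewrite ltr_pdivlMr// => yx.
have : `|lam * y 0 j - lam * x 0 j| < Num.min 1 ((t + 1)%:~R - lam * x 0 j).
  rewrite -mulrBr normrM gtr0_norm// mulrC (le_lt_trans _ yx)//.
  by rewrite ler_wpM2r ?(ltW lam0)//; have := coord_le (y - x) j; rewrite !mxE.
rewrite lt_min !ltr_norml => /andP[/andP[y1 _] /andP[_ y2]].
rewrite /interp; rewrite intrD in t1 y2.
have [ty|yt] := lerP t%:~R (lam * y 0 j).
  have -> : Num.floor (lam * y 0 j) = t by apply: floor_def; rewrite intrD; lra.
  rewrite (pterm_far (z := t - 1)) ?add0r// intrB.
  by rewrite ger0_norm; lra.
have -> : Num.floor (lam * y 0 j) = t - 1.
  by apply: floor_def; rewrite subrK intrB; lra.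
rewrite subrK (pterm_far (z := t + 1)) ?addr0// intrD.
by rewrite ler0_norm; lra.
Qed.

Lemma interp_family D j H : (forall z, ck_family D k (H z)) ->
  ck_family D k (interp j H).
Proof.
move=> HD q qs x Dx w.
pose t := Num.floor (lam * x 0 j).
pose T w y := pterm j (t - 1) (H (t - 1)) w y + pterm j t (H t) w y +
    pterm j (t + 1) (H (t + 1)) w y.
have TE v y : T v y = 1 *: (1 *: pterm j (t - 1) (H (t - 1)) v y +
    pterm j t (H t) v y) + pterm j (t + 1) (H (t + 1)) v y.
  by rewrite !scale1r.
have Tf v : T v = fun y => 1 *: (1 *: pterm j (t - 1) (H (t - 1)) v y +
    pterm j t (H t) v y) + pterm j (t + 1) (H (t + 1)) v y.
  by apply/funext => y; exact: TE.
have P z := pterm_family j z (HD z).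
split=> [wk|wk i].
  have [r r0 rP] := interp_local j H x wk.
  apply: (@qcont_near _ _ _ q (T w) _ x r) => //; first by move=> y /rP ->.
  rewrite Tf; apply: qcont_lin => //; last exact: (P _ _ qs x Dx w).1.
  by apply: qcont_lin => //; exact: (P _ _ qs x Dx w).1.
have [r r0 rP] := interp_local j H x (ltnW wk).
apply: (@qdiff_near _ _ _ q (T w) _ _ x _ r) => //; first by move=> y /rP ->.
have [r' r'0 r'P] := interp_local j H x (w := i :: w) wk.
rewrite r'P ?subrr ?normr0// -/t -[X in qdiff _ _ _ _ X]/(T (i :: w) x) TE Tf.
apply: qdiff_lin => //; last exact: (P _ _ qs x Dx w).2.
by apply: qdiff_lin => //; exact: (P _ _ qs x Dx w).2.
Qed.

Lemma pterm_le q j z G w x (B : R) : continuous_seminorm q -> (size w <= k)%N ->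
  0 <= B -> (forall v, (size v <= size w)%N -> q (G v x) <= B * lam ^+ size v) ->
  q (pterm j z G w x) <= 2 ^+ k * C * B * lam ^+ size w.
Proof.
move=> qs wk B0 GB; have lam_ge0 := ltW lam0.
rewrite /pterm (le_trans (semi_sum qs _ _ _))//.
apply: (@le_trans _ _ (\sum_(cv <- splits j w) C * B * lam ^+ size w)).
  rewrite big_seq [leRHS]big_seq; apply: ler_sum => cv /splits_size cvw.
  rewrite (semiZ qs) -cvw exprD.
  have ck : (cv.1 <= k)%N by rewrite (leq_trans _ wk)// -cvw leq_addr.
  have -> : C * B * (lam ^+ cv.1 * lam ^+ size cv.2) =
    (lam ^+ cv.1 * C) * (B * lam ^+ size cv.2) by ring.
  apply: ler_pM; rewrite ?(semi_ge0 qs) ?weight_le//.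
  by apply: GB; rewrite -cvw leq_addl.
rewrite big_const_seq count_predT iter_addr_0 -[leLHS]mulr_natl -!mulrA.
rewrite ler_wpM2r ?mulr_ge0 ?exprn_ge0// -natrX ler_nat.
by rewrite (leq_trans (size_splits _ _))// leq_exp2l.
Qed.

Definition interp_cst : R := 2 ^+ k * C * 2.

Lemma interp_cst_ge0 : 0 <= interp_cst.
Proof. by rewrite !mulr_ge0// exprn_ge0. Qed.

Lemma floor_near (r : R) : `|r - (Num.floor r)%:~R| <= 1 /\
  `|r - (Num.floor r + 1)%:~R| <= 1.
Proof.
have/andP[r0 r1] := floor_itv r; rewrite intrD in r1.
by rewrite intrD ger0_norm ?ler0_norm; lra.
Qed.

Lemma interp_le q j H w x (B : R) : continuous_seminorm q -> (size w <= k)%N ->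
  0 <= B -> (forall z, `|lam * x 0 j - z%:~R| <= 1 -> forall v,
     (size v <= size w)%N -> q (H z v x) <= B * lam ^+ size v) ->
  q (interp j H w x) <= interp_cst * B * lam ^+ size w.
Proof.
move=> qs wk B0 HB; rewrite /interp (le_trans (semi_le qs _ _))//.
have [z1 z2] := floor_near (lam * x 0 j).
have -> : interp_cst * B * lam ^+ size w =
  2 ^+ k * C * B * lam ^+ size w + 2 ^+ k * C * B * lam ^+ size w.
  by rewrite /interp_cst; ring.
by apply: lerD; apply: pterm_le => // v vw; apply: HB.
Qed.

Lemma interp_eq j H H' w x :
  (forall z, `|lam * x 0 j - z%:~R| <= 1 -> forall v, H z v x = H' z v x) ->
  interp j H w x = interp j H' w x.
Proof.
move=> HH; have [z1 z2] := floor_near (lam * x 0 j).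
by rewrite /interp; congr (_ + _); apply: eq_bigr => cv _; rewrite HH.
Qed.

(** The weights have the sum 1, and therefore their derivatives have the sum
    0. *)
Lemma interp_const j G w x : (size w <= k)%N -> interp j (fun=> G) w x = G w x.
Proof.
move=> wk; rewrite /interp /pterm -big_split /=.
rewrite -[RHS](splits_sum0 j w (G^~ x)); apply: eq_big_seq => cv /splits_size cvw.
rewrite -scalerDl; congr (_ *: _); rewrite /weight -mulrDr.
have/andP[t0 t1] := floor_itv (lam * x 0 j); rewrite intrD in t1.
rewrite intrD opprD addrA th1; [|by rewrite (leq_trans _ wk)// -cvw leq_addr|lra].
by have [->|_] := eqVneq cv.1 0%N; rewrite ?expr0 ?mul1r ?mulr0.
Qed.

Lemma interp_lin j (r : R) H H' w x :
  interp j (fun t v y => r *: H t v y + H' t v y) w x =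
  r *: interp j H w x + interp j H' w x.
Proof.
have pl z G G' : pterm j z (fun v y => r *: G v y + G' v y) w x =
    r *: pterm j z G w x + pterm j z G' w x.
  rewrite /pterm scaler_sumr -big_split; apply: eq_bigr => cv _ /=.
  by rewrite scalerDr !scalerA mulrC.
by rewrite /interp !pl scalerDr addrACA.
Qed.

Definition upd (z : 'I_n -> int) j (t : int) : 'I_n -> int :=
  fun i => if i == j then t else z i.

(** Interpolation in each of the directions [js] in turn; the coordinates of the
    node in the other directions are those of [z]. *)
Fixpoint grid (js : seq 'I_n) (h : ('I_n -> int) -> fam) (z : 'I_n -> int) : fam :=
  if js is j :: js' then interp j (fun t => grid js' h (upd z j t)) else h z.

Definition near_node x (z : 'I_n -> int) := forall i, `|lam * x 0 i - (z i)%:~R| <= 1.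

Lemma grid_family D js (h : ('I_n -> int) -> fam) (z : 'I_n -> int) :
  (forall z : 'I_n -> int, ck_family D k (h z)) ->
  ck_family D k (grid js h z).
Proof.
move=> hD; elim: js z => [|j js IH] z /=; first exact: hD.
by apply: interp_family => t; exact: IH.
Qed.

Let near_upd x (z : 'I_n -> int) j js (t : int) :
  (forall i, i \notin j :: js -> `|lam * x 0 i - (z i)%:~R| <= 1) ->
  `|lam * x 0 j - t%:~R| <= 1 ->
  forall i, i \notin js -> `|lam * x 0 i - (upd z j t i)%:~R| <= 1.
Proof.
move=> zP tP i ijs; rewrite /upd; case: eqP => [->//|/eqP ij].
by apply: zP; rewrite inE negb_or ij.
Qed.

Lemma grid_le q js (h : ('I_n -> int) -> fam) (z : 'I_n -> int) w x (B : R) :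
  continuous_seminorm q -> (size w <= k)%N ->
  0 <= B -> (forall i, i \notin js -> `|lam * x 0 i - (z i)%:~R| <= 1) ->
  (forall z : 'I_n -> int, near_node x z -> forall v,
     (size v <= size w)%N -> q (h z v x) <= B * lam ^+ size v) ->
  q (grid js h z w x) <= interp_cst ^+ size js * B * lam ^+ size w.
Proof.
move=> qs + B0; elim: js z w => [|j js IH] z w wk zP hB /=.
  by rewrite expr0 mul1r; apply: hB => // i; exact: zP.
rewrite exprS -(mulrA interp_cst); apply: interp_le => //.
  by rewrite mulr_ge0// exprn_ge0// interp_cst_ge0.
move=> t tP v vw; apply: IH; [exact: leq_trans wk|exact: near_upd|].
by move=> z' z'P u uv; apply: hB => //; exact: leq_trans vw.
Qed.

Lemma grid_eq js (h h' : ('I_n -> int) -> fam) (z : 'I_n -> int) w x :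
  (forall i, i \notin js -> `|lam * x 0 i - (z i)%:~R| <= 1) ->
  (forall z : 'I_n -> int, near_node x z -> forall v, h z v x = h' z v x) ->
  grid js h z w x = grid js h' z w x.
Proof.
elim: js z w => [|j js IH] z w zP hh /=; first by apply: hh => i; exact: zP.
by apply: interp_eq => t tP v; apply: IH => //; exact: near_upd.
Qed.

Lemma grid_lin js (r : R) (h h' : ('I_n -> int) -> fam) (z : 'I_n -> int) w x :
  grid js (fun (z : 'I_n -> int) v y => r *: h z v y + h' z v y) z w x =
  r *: grid js h z w x + grid js h' z w x.
Proof.
elim: js z w x => // j js IH z w x /=; rewrite -interp_lin.
by congr (interp j _ w x); apply/funext => t; apply/funext => v; apply/funext => y.
Qed.

Lemma grid_const js G (z : 'I_n -> int) w x : (size w <= k)%N ->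
  grid js (fun=> G) z w x = G w x.
Proof.
elim: js z w => // j js IH z w wk /=.
rewrite -[RHS](interp_const j G x wk).
rewrite /interp; congr (_ + _); apply: eq_big_seq => cv /splits_size cvw;
  by rewrite IH// (leq_trans _ wk)// -cvw leq_addl.
Qed.

End Interpolation.

(** * The extension of a jet *)

Section Extension.
Context {R : realType} {n : nat} {E : lcsType R}.
Variables (A : set 'rV[R]_n) (k : nat) (th : nat -> R -> R) (C : R).
Hypothesis bump : is_bump k th C.
Implicit Types (g : jet A E k) (w v : seq 'I_n) (x y a : 'rV[R]_n) (m : nat).
Local Notation fam := (seq 'I_n -> 'rV[R]_n -> E).

(** The grid of level [m] has mesh [(lev m)^-1]. *)
Definition lev m : R := 4 ^+ m.

Lemma lev_gt0 m : 0 < lev m. Proof. by rewrite exprn_gt0. Qed.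
Lemma lev_ge1 m : 1 <= lev m. Proof. by rewrite exprn_ege1// ler1n. Qed.
Lemma levS m : lev m.+1 = 4 * lev m. Proof. by rewrite /lev exprS. Qed.
Lemma levVS m : (lev m)^-1 = 4 * (lev m.+1)^-1.
Proof. by rewrite levS invfM mulrA divff ?mul1r// pnatr_eq0. Qed.
Lemma levV_gt0 m : 0 < (lev m)^-1. Proof. by rewrite invr_gt0 lev_gt0. Qed.

Definition node m (z : 'I_n -> int) : 'rV[R]_n :=
  (lev m)^-1 *: \row_i (z i)%:~R.

(** The constant 3 allows a node at distance at most one mesh from [x] to be close
    to the points of [A] at distance at most two meshes from [x]
    ([node_selected]). *)
Definition close m (z : 'I_n -> int) a := A a /\ `|node m z - a| <= 3 / lev m.

Definition selected m z := exists a, close m z a.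

Definition anchor m z := xget 0 [set a | close m z a].

Lemma close_anchor m z : selected m z -> close m z (anchor m z).
Proof. by move=> sz; exact: (xgetPex 0 (P := [set a | close m z a])). Qed.

Lemma near_node_le m x z : near_node (lev m) x z -> `|x - node m z| <= (lev m)^-1.
Proof.
move=> xz; apply: norm_le_coord => [|i]; first exact/ltW/levV_gt0.
rewrite !mxE -(@ler_pM2l _ (lev m)) ?lev_gt0// divff ?gt_eqF ?lev_gt0//.
rewrite -[X in X * _]gtr0_norm ?lev_gt0// -normrM mulrBr mulVKf ?gt_eqF ?lev_gt0//.
Qed.

Lemma node_selected m x z a : near_node (lev m) x z -> A a ->
  `|x - a| <= 2 / lev m -> selected m z.
Proof.
move=> /near_node_le xz Aa xa; exists a; split=> //.
have := ler_distD x (node m z) a; rewrite (distrC (node m z) x); lra.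
Qed.

Lemma anchor_near m x z : near_node (lev m) x z -> selected m z ->
  A (anchor m z) /\ `|x - anchor m z| <= 4 / lev m.
Proof.
move=> /near_node_le xz /close_anchor[Ap zp]; split=> //.
have := ler_distD (node m z) x (anchor m z); lra.
Qed.

Definition jval g (b : multinom n) : 'rV[R]_n -> E := valL_ 0 (jcoef g b).

Lemma jval_val g b (x : A) : jval g b (\val x) = jcoef g b x.
Proof. exact: valL0_val. Qed.

Definition jet_taylor g a w x : E := taylor k (fun b => jval g b a) a (word_mnm w) x.

Definition node_fam m g (F : fam) (z : 'I_n -> int) : fam :=
  if `[< selected m z >] then jet_taylor g (anchor m z) else F.

(** Where a node is close to a point of [A], the Taylor polynomial there is used;
    at the other nodes the previous, coarser level is kept. *)
Fixpoint approx m g : fam := grid th (lev m) (enum 'I_n)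
  (node_fam m g (if m is m'.+1 then approx m' g else fun=> fun=> 0)) (fun=> 0).

Definition prev m g : fam := if m is m'.+1 then approx m' g else fun=> fun=> 0.

Lemma approxE m g :
  approx m g = grid th (lev m) (enum 'I_n) (node_fam m g (prev m g)) (fun=> 0).
Proof. by case: m. Qed.

Let notin_enum_le x (z : 'I_n -> int) m i : i \notin enum 'I_n -> `|lev m * x 0 i - (z i)%:~R| <= 1.
Proof. by rewrite mem_enum. Qed.

Lemma cst0_family D : ck_family D k ((fun=> fun=> 0) : fam).
Proof. by move=> q qs x _ w; split=> [_|_ i]; [exact: qcont_cst|exact: qdiff_cst]. Qed.

Lemma approx_family m g : ck_family setT k (approx m g).
Proof.
elim: m => [|m IH]; rewrite approxE; apply: (grid_family bump (lev_gt0 _)) => z;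
  rewrite /node_fam; case: asboolP => _; try exact: taylor_family.
  exact: cst0_family.
exact: IH.
Qed.

Lemma jval_lin (c : R) g h b a : jval (c *: g + h) b a = c *: jval g b a + jval h b a.
Proof.
rewrite /jval -[RHS](congr1 (fun F : 'rV[R]_n -> E => F a)
  (valL0_lin c (jcoef g b) (jcoef h b))).
by congr (valL_ 0 _ a); apply/funext => x; exact: jcoef_lin.
Qed.

Lemma jet_taylor_lin (c : R) g h a w x :
  jet_taylor (c *: g + h) a w x = c *: jet_taylor g a w x + jet_taylor h a w x.
Proof.
rewrite /jet_taylor -taylor_lin; congr (taylor _ _ _ _ _).
by apply/funext => b; exact: jval_lin.
Qed.

Lemma approx_lin m (c : R) g h w x :
  approx m (c *: g + h) w x = c *: approx m g w x + approx m h w x.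
Proof.
elim: m w x => [|m IH] w x; rewrite !approxE -grid_lin; apply: grid_eq;
  rewrite ?lev_gt0//; try (by move=> i; exact: notin_enum_le);
  move=> z _ v; rewrite /node_fam; case: asboolP => _; try exact: jet_taylor_lin.
- by rewrite scaler0 addr0.
- exact: IH.
Qed.

Definition far m x := forall a, A a -> (lev m)^-1 < `|x - a|.

Lemma farS m x : far m x -> far m.+1 x.
Proof. by move=> fx a /fx; rewrite levVS; have := levV_gt0 m.+1; lra. Qed.

Lemma far_near m x : far m x ->
  exists2 r, 0 < r & forall y, `|y - x| < r -> far m.+1 y.
Proof.
move=> fx; exists (lev m.+1)^-1; first exact: levV_gt0.
move=> y yx a /fx; rewrite levVS; have := ler_distD y x a.
by rewrite (distrC x y); have := levV_gt0 m.+1; lra.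
Qed.

Lemma far_notin m x : far m x -> ~ A x.
Proof. by move=> fx /fx; rewrite subrr normr0 ltNge ltW// levV_gt0. Qed.

(** At a point at distance greater than 4 / lev m.+1 from A no node of that
    level which matters is selected. *)
Lemma approxS m g w x : far m x -> (size w <= k)%N ->
  approx m.+1 g w x = approx m g w x.
Proof.
move=> fx wk; rewrite approxE.
rewrite -(grid_const bump (lev m.+1) (enum 'I_n) (approx m g) (fun=> 0) x wk).
apply: grid_eq => [i|z xz v]; first exact: notin_enum_le.
rewrite /node_fam; case: asboolP => // sz.
by have [/fx] := anchor_near xz sz; rewrite levVS => /lt_geF; rewrite -mulrC => ->.
Qed.

Lemma approx_far m m' g w x : (m <= m')%N -> far m x -> (size w <= k)%N ->
  approx m' g w x = approx m g w x /\ far m' x.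
Proof.
move=> /subnKC <- fx wk; elim: (m' - m)%N => [|d [IH fd]]; first by rewrite addn0.
by rewrite addnS approxS//; split=> //; exact: farS.
Qed.

Definition far_level x := xget 0%N [set m | far m x].

(** Outside of [A] the levels are eventually equal ([approx_far]); their common
    value is taken. *)
Definition ext g w x : E :=
  if `[< A x >] then jval g (word_mnm w) x else approx (far_level x) g w x.

Lemma ext_far m g w x : far m x -> (size w <= k)%N -> ext g w x = approx m g w x.
Proof.
move=> fx wk; rewrite /ext; case: asboolP => [|_]; first by have := far_notin fx.
have lx : far (far_level x) x by apply: (xgetPex 0%N (P := [set m | far m x])); exists m.
have [<- _] := approx_far g (leq_maxl m (far_level x)) fx wk.
by have [-> _] := approx_far g (leq_maxr m (far_level x)) lx wk.
Qed.

Lemma ext_in g w x : A x -> ext g w x = jval g (word_mnm w) x.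
Proof. by rewrite /ext; case: asboolP. Qed.

Lemma ext_lin (c : R) g h w x :
  ext (c *: g + h) w x = c *: ext g w x + ext h w x.
Proof. by rewrite /ext; case: asboolP => _; [exact: jval_lin|exact: approx_lin]. Qed.

(** * Comparison with the Taylor polynomials *)

(** A local form, for the maximum norm, of a bound on the second summand of
    [whitney_norm]. *)
Definition tame g q x0 (r M : R) := 0 <= M /\ forall w a b, (size w <= k)%N ->
  A a -> A b -> `|a - x0| <= r -> `|b - x0| <= r ->
  q (jval g (word_mnm w) b - jet_taylor g a w b) <= M * `|b - a| ^+ (k - size w).

Lemma jet_taylor_center g a w : jet_taylor g a w a = jval g (word_mnm w) a.
Proof. exact: taylor_center. Qed.

(** The derivatives at [b] of the difference of the two Taylor polynomials are
    remainders of the jet, and those of order [k] are constant; [seg_bound]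
    carries the bounds from [b] to [x]. *)
Lemma jet_taylor_transfer g q x0 (r M rho : R) a b x w : continuous_seminorm q ->
  tame g q x0 r M -> A a -> A b -> `|a - x0| <= r -> `|b - x0| <= r ->
  `|x - b| <= rho -> `|b - a| <= rho -> (size w <= k)%N ->
  q (jet_taylor g b w x - jet_taylor g a w x) <= n.+1%:R ^+ k * M * rho ^+ (k - size w).
Proof.
move=> qs [M0 gM] Aa Ab ar br xb ba wk.
have rho0 : 0 <= rho by rewrite (le_trans _ xb).
pose H w t := jet_taylor g b w (b + t *: (x - b)) - jet_taylor g a w (b + t *: (x - b)).
have := @seg_bound R n E q k H (x - b) rho M qs M0 xb _ _ _ w 1 wk.
rewrite /H scale1r subrKC => HH.
apply: (@le_trans _ _ (n.+1%:R ^+ (k - size w) * M * rho ^+ (k - size w))); last first.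
  rewrite ler_wpM2r ?exprn_ge0// ler_wpM2r// ler_weXn2l ?leq_subr// ler1n//.
apply: HH; last lra.
- move=> v vk.
  have D c : qder01 q (fun t : R => jet_taylor g c v (b + t *: (x - b)))
      (fun t : R => \sum_i (x - b) 0 i *: jet_taylor g c (i :: v) (b + t *: (x - b))).
    apply: qdiff_qder01 => // t _.
    have := @ck_family_dirderiv R n E setT k _ (x - b) (b + t *: (x - b)) v openT
      (taylor_family k (fun b => jval g b c) c) I vk.
    by move=> /qdiffP; apply.
  have := qder01B qs (D b) (D a); congr (qder01 q _ _).
  apply/funext => t /=; rewrite -sumrB; apply: eq_bigr => i _.
  by rewrite [RHS]scalerBr.
- move=> v vk; rewrite scale0r addr0 jet_taylor_center (le_trans (gM v a b vk Aa Ab ar br))//.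
  by rewrite ler_wpM2l// lerXn2r ?nnegrE.
- move=> v t vk t01; rewrite /jet_taylor !taylor_top ?mdeg_word_mnm//.
  have := gM v a b; rewrite vk leqnn subnn expr0 mulr1 /jet_taylor taylor_top ?mdeg_word_mnm//.
  exact.
Qed.

Definition grid_cst : R := interp_cst k C ^+ n.

Lemma grid_cst_ge0 : 0 <= grid_cst.
Proof. by case: bump => C0 _; rewrite exprn_ge0// !mulr_ge0// exprn_ge0. Qed.

(** The interpolation reproduces [G], so only the nodes next to [x] have to be
    compared with it. *)
Lemma approx_sub_le q m g (G : fam) w x (B : R) : continuous_seminorm q ->
  (size w <= k)%N -> 0 <= B ->
  (forall z, near_node (lev m) x z -> forall v, (size v <= size w)%N ->
    q (node_fam m g (prev m g) z v x - G v x) <= B * lev m ^+ size v) ->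
  q (approx m g w x - G w x) <= grid_cst * B * lev m ^+ size w.
Proof.
move=> qs wk B0 HB.
rewrite approxE -(grid_const bump (lev m) (enum 'I_n) G (fun=> 0) x wk).
rewrite -[X in q X](_ : (-1) *: grid th (lev m) (enum 'I_n) (fun=> G) (fun=> 0) w x +
  grid th (lev m) (enum 'I_n) (node_fam m g (prev m g)) (fun=> 0) w x = _); last first.
  by rewrite scaleN1r addrC.
rewrite -grid_lin /grid_cst -[X in interp_cst k C ^+ X](size_enum_ord n).
apply: (grid_le bump (lev_gt0 m)) => // [i|z xz v vw]; first exact: notin_enum_le.
by rewrite scaleN1r addrC; exact: HB.
Qed.

(** The powers of 20 and 5 come from the distances between the points of [A]
    involved: 20 finest meshes for two anchors, 5 times the distance of [x] to
    [x0] otherwise. *)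
Definition ext_cst : R :=
  n.+1%:R ^+ k * (grid_cst * (1 + grid_cst * 4 ^+ k) * 20 ^+ k + 5 ^+ k).

(** Let [m.+1] be the first level at which [x] is far from [A]. A point [ax] of
    [A] is then within one mesh of level [m], so that at level [m] all nodes next
    to [x] are selected, and the Taylor polynomials at their anchors are close to
    the one at [ax]. A derivative falling on a weight costs a factor [lev m.+1],
    which [jet_taylor_transfer] compensates, and the mesh is smaller than the
    distance of [x] to [x0]. *)
Lemma ext_estimate_out g q x0 (r M : R) x w : continuous_seminorm q ->
  tame g q x0 r M -> A x0 -> (exists m, far m x) -> `|x - x0| < 1 ->
  20 * `|x - x0| <= r -> (size w <= k)%N ->
  q (ext g w x - jet_taylor g x0 w x) <= ext_cst * M * `|x - x0| ^+ (k - size w).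
Proof.
move=> qs gM Ax0 fx x1 xr wk; have M0 := gM.1; have g0 := grid_cst_ge0.
have [m /asboolP fm mmin] : exists2 m, `[< far m x >] &
    forall m', `[< far m' x >] -> (m <= m')%N.
  have ex : exists m, `[< far m x >] by case: fx => m /asboolP ?; exists m.
  by exists (ex_minn ex); case: ex_minnP.
case: m fm mmin => [|m] fm mmin.
  by have := fm x0 Ax0; rewrite /lev expr0 invr1 ltNge (ltW x1).
have [ax [Aax xax]] : exists a, A a /\ `|x - a| <= (lev m)^-1.
  apply: contrapT => H; have : far m x.
    move=> a Aa; rewrite ltNge; apply/negP => xa; apply: H; exists a.
    by split.
  by move=> /asboolP/mmin; rewrite ltnn.
set s := (lev m.+1)^-1; have s0 : 0 < s by exact: levV_gt0.
have mE : (lev m)^-1 = 4 * s by rewrite levVS.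
have sx : s < `|x - x0| by exact: fm.
have near0 p : `|x - p| <= 16 * s -> `|p - x0| <= r.
  move=> xp; have := ler_distD x p x0; rewrite (distrC p x); lra.
have ax0 : `|ax - x0| <= r by apply: near0; lra.
set N := n.+1%:R ^+ k * M; have N0 : 0 <= N by rewrite mulr_ge0// exprn_ge0.
pose B0 := N * 20 ^+ k * s ^+ k.
have B00 : 0 <= B0 by rewrite !mulr_ge0// exprn_ge0// ltW.
have p4 : 0 <= 4 ^+ k :> R by rewrite exprn_ge0.
have g4 : 0 <= 1 + grid_cst * 4 ^+ k by rewrite addr_ge0// mulr_ge0.
have b4 : 0 <= 4 ^+ k * B0 by exact: mulr_ge0.
have gb : 0 <= (1 + grid_cst * 4 ^+ k) * B0 by exact: mulr_ge0.
have lp i j : 0 <= lev i ^+ j by rewrite exprn_ge0// ltW// lev_gt0.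
have sE j : (j <= k)%N -> s ^+ (k - j) = s ^+ k * lev m.+1 ^+ j.
  move=> jk; rewrite -{2}(subnK jk) exprD -mulrA -exprMn /s mulVf ?expr1n ?mulr1//.
  by rewrite gt_eqF// lev_gt0.
have selB p v : A p -> `|x - p| <= 16 * s -> (size v <= k)%N ->
    q (jet_taylor g p v x - jet_taylor g ax v x) <= B0 * lev m.+1 ^+ size v.
  move=> Ap xp vk.
  have := @jet_taylor_transfer g q x0 r M (20 * s) ax p x v qs gM Aax Ap ax0 (near0 p xp).
  move=> /(_ _ _ vk)/le_trans; apply; [lra| |].
    have := ler_distD x p ax; rewrite (distrC p x); lra.
  rewrite exprMn sE// -/N /B0.
  have -> : N * 20 ^+ k * s ^+ k * lev m.+1 ^+ size v =
    N * (20 ^+ k * (s ^+ k * lev m.+1 ^+ size v)) by ring.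
  rewrite ler_wpM2l// ler_wpM2r//.
    by rewrite mulr_ge0// exprn_ge0// ltW// lev_gt0.
  by rewrite ler_weXn2l ?leq_subr// ler1n.
have prevB v : (size v <= k)%N ->
    q (approx m g v x - jet_taylor g ax v x) <= grid_cst * (4 ^+ k * B0) * lev m.+1 ^+ size v.
  move=> vk; apply: (@le_trans _ _ (grid_cst * (4 ^+ k * B0) * lev m ^+ size v)); last first.
    rewrite ler_wpM2l ?(mulr_ge0 g0 b4)// lerXn2r ?nnegrE ?(ltW (lev_gt0 _))//.
    by rewrite levS; have := lev_gt0 m; lra.
  apply: (approx_sub_le (G := fun v x => jet_taylor g ax v x) qs vk b4).
  move=> z xz u uv; have uk := leq_trans uv vk.
  have sz : selected m z.
    by apply: (node_selected xz Aax); have := levV_gt0 m; lra.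
  rewrite /node_fam; case: asboolP => // _.
  have [Ap xp] := anchor_near xz sz.
  apply: (le_trans (selB _ _ Ap _ uk)); first by lra.
  rewrite levS exprMn (mulrC (4 ^+ k) B0) -(mulrA B0) ler_wpM2l// ler_wpM2r//.
  by rewrite ler_weXn2l// ler1n.
have curB : q (approx m.+1 g w x - jet_taylor g ax w x) <=
    grid_cst * ((1 + grid_cst * 4 ^+ k) * B0) * lev m.+1 ^+ size w.
  apply: (approx_sub_le (G := fun v x => jet_taylor g ax v x) qs wk gb).
  move=> z xz u uv; have uk := leq_trans uv wk.
  rewrite /node_fam; case: asboolP => sz.
    have [Ap xp] := anchor_near xz sz.
    apply: (le_trans (selB _ _ Ap _ uk)); first by rewrite -/s in xp; lra.
    by rewrite ler_wpM2r// mulrDl mul1r lerDl -mulrA mulr_ge0.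
  apply: (le_trans (prevB _ uk)); rewrite ler_wpM2r// mulrDl mul1r !mulrA.
  by rewrite lerDr.
rewrite (ext_far g fm wk) (le_trans (semi_tri qs _ (jet_taylor g ax w x) _))//.
have dx0 : 0 <= `|x - x0| by [].
have -> : ext_cst * M * `|x - x0| ^+ (k - size w) =
  grid_cst * ((1 + grid_cst * 4 ^+ k) * (N * 20 ^+ k)) * `|x - x0| ^+ (k - size w) +
  N * (5 ^+ k * `|x - x0| ^+ (k - size w)) by rewrite /ext_cst /N; ring.
apply: lerD.
  rewrite (le_trans curB)// /B0.
  have -> : grid_cst * ((1 + grid_cst * 4 ^+ k) * (N * 20 ^+ k * s ^+ k)) * lev m.+1 ^+ size w =
     grid_cst * ((1 + grid_cst * 4 ^+ k) * (N * 20 ^+ k)) * s ^+ (k - size w).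
    by rewrite sE//; ring.
  rewrite ler_wpM2l ?lerXn2r ?nnegrE ?(ltW sx) ?(ltW s0)//.
  by rewrite (mulr_ge0 g0)// (mulr_ge0 g4)// mulr_ge0// exprn_ge0.
have := @jet_taylor_transfer g q x0 r M (5 * `|x - x0|) x0 ax x w qs gM Ax0 Aax _ ax0.
rewrite subrr normr0 => /(_ _ _ _ wk)/le_trans; apply.
- by lra.
- by rewrite (le_trans xax); lra.
- have := ler_distD x ax x0; rewrite (distrC ax x); lra.
- rewrite exprMn -/N ler_wpM2l// ler_wpM2r ?exprn_ge0//.
  by rewrite ler_weXn2l ?leq_subr// ler1n.
Qed.

Local Notation "''e_' i" := (delta_mx 0 i : 'rV[R]_n) (at level 8, i at level 2).

Definition covered : set 'rV[R]_n := [set x | A x \/ exists m, far m x].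

Lemma ext_cst_ge1 : 1 <= ext_cst.
Proof.
have g0 := grid_cst_ge0; have p m : 0 <= m%:R ^+ k :> R by rewrite exprn_ge0.
have -> : 1 = 1 * (0 + 1) :> R by rewrite add0r mul1r.
apply: ler_pM => //; rewrite ?addr_ge0//; first by rewrite exprn_ege1// ler1n.
apply: lerD; last by rewrite exprn_ege1// ler1n.
by rewrite mulr_ge0// mulr_ge0// addr_ge0// mulr_ge0.
Qed.

Lemma ext_estimate g q x0 (r M : R) x w : continuous_seminorm q ->
  tame g q x0 r M -> A x0 -> covered x -> `|x - x0| < 1 ->
  20 * `|x - x0| <= r -> (size w <= k)%N ->
  q (ext g w x - jet_taylor g x0 w x) <= ext_cst * M * `|x - x0| ^+ (k - size w).
Proof.
move=> qs gM Ax0 [Ax|fx] x1 xr wk; last exact: ext_estimate_out xr wk.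
have [M0 H] := gM; have dx := normr_ge0 (x - x0).
rewrite ext_in// (le_trans (H w x0 x wk Ax0 Ax _ _))//.
- by rewrite subrr normr0; lra.
- by lra.
by rewrite ler_wpM2r ?exprn_ge0// ler_peMl// ext_cst_ge1.
Qed.

(** Near [x0] the extension and the Taylor polynomial at [x0] differ, in each
    order [size w], by a small multiple of the power [k - size w] of the
    distance: so [ext g] inherits continuity and the derivatives from it. *)
Lemma ext_ck_at g q x0 : continuous_seminorm q -> A x0 -> nbhs x0 covered ->
  (forall e : R, 0 < e -> exists2 r, 0 < r & tame g q x0 r e) -> forall w,
  ((size w <= k)%N -> qcont q (ext g w) x0) /\
  ((size w < k)%N -> forall i, qdiff q (ext g w) 'e_i x0 (ext g (i :: w) x0)).
Proof.
move=> qs Ax0 /nbhs_rVP[rho rho0 rhoP] gM w.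
have key (e : R) : 0 < e -> exists2 d, 0 < d <= 1 & forall y, `|y - x0| < d ->
    (size w <= k)%N ->
    q (ext g w y - jet_taylor g x0 w y) <= e * `|y - x0| ^+ (k - size w).
  move=> e0; have c1 := ext_cst_ge1.
  have c0 : 0 < ext_cst by lra.
  have [r r0 gr] := gM (e / ext_cst) (divr_gt0 e0 c0).
  exists (Num.min 1 (Num.min rho (r / 20))).
    by rewrite lt_min ltr01 lt_min rho0 divr_gt0//= ge_min lexx.
  move=> y; rewrite !lt_min => /andP[y1 /andP[yrho yr]] wk.
  have yr' : 20 * `|y - x0| <= r by lra.
  have := ext_estimate qs gr Ax0 (rhoP y yrho) y1 yr' wk.
  by rewrite mulrCA divff ?mulr1// gt_eqF.
have tF := taylor_family k (fun b => jval g b x0) x0 qs (I : setT x0) w.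
have E0 v : ext g v x0 = jet_taylor g x0 v x0 by rewrite ext_in// jet_taylor_center.
split=> [wk|wk i] e e0; have e2 : 0 < e / 2 by rewrite divr_gt0.
  have [d /andP[d0 d1] dP] := key _ e2; have [d' d'0 d'P] := tF.1 wk _ e2.
  exists (Num.min d d'); first by rewrite lt_min d0.
  move=> y; rewrite lt_min => /andP[yd yd'].
  rewrite E0 (le_trans (semi_tri qs _ (jet_taylor g x0 w y) _))// [e]splitr.
  apply: lerD; last exact: d'P.
  rewrite (le_trans (dP y yd wk))// ler_piMr ?(ltW e2)// exprn_ile1//.
  by rewrite (le_trans (ltW yd)).
have [d /andP[d0 d1] dP] := key _ e2; have [d' d'0 d'P] := tF.2 wk i _ e2.
exists (Num.min d d'); first by rewrite lt_min d0.
move=> t; rewrite lt_min => /andP[td td'].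
have tn : `|x0 + t *: delta_mx 0 i - x0| <= `|t|.
  by rewrite addrAC subrr add0r normrZ ler_piMr// norm_delta.
set y := x0 + t *: delta_mx 0 i in tn *.
have -> : ext g w y - ext g w x0 - t *: ext g (i :: w) x0 =
    (ext g w y - jet_taylor g x0 w y) +
    (jet_taylor g x0 w y - jet_taylor g x0 w x0 - t *: jet_taylor g x0 (i :: w) x0).
  by rewrite !E0; zmod.
rewrite (le_trans (semi_le qs _ _))// [e]splitr mulrDl; apply: lerD; last exact: d'P.
have yd : `|y - x0| < d by exact: le_lt_trans td.
rewrite (le_trans (dP y yd (ltnW wk)))// ler_wpM2l ?(ltW e2)//.
rewrite (le_trans _ tn)//; have [j ->] : exists j, (k - size w)%N = j.+1.
  by exists (k - size w).-1; rewrite prednK// subn_gt0.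
by rewrite exprS ler_piMr// exprn_ile1// (le_trans (ltW yd)).
Qed.

Lemma ext_ck_far g q x : continuous_seminorm q -> (exists m, far m x) -> forall w,
  ((size w <= k)%N -> qcont q (ext g w) x) /\
  ((size w < k)%N -> forall i, qdiff q (ext g w) 'e_i x (ext g (i :: w) x)).
Proof.
move=> qs [m fx] w; have [r r0 rP] := far_near fx.
have fam' := approx_family m.+1 g qs (I : setT x) w.
split=> [wk|wk i].
  apply: (@qcont_near _ _ _ q (approx m.+1 g w) _ x r) => //; last exact: fam'.1.
  by move=> y /rP fy; rewrite (ext_far g fy).
rewrite (ext_far (w := i :: w) g (farS fx) wk).
apply: (@qdiff_near _ _ _ q (approx m.+1 g w) _ _ x _ r) => //; last exact: fam'.2.
by move=> y /rP fy; rewrite (ext_far g fy)// ltnW.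
Qed.

Lemma enorm_exp_le (u : 'rV[R]_n) j :
  enorm u ^+ (k - j) <= n.+1%:R ^+ k * `|u| ^+ (k - j).
Proof.
apply: (@le_trans _ _ ((n.+1%:R * `|u|) ^+ (k - j))).
  by rewrite lerXn2r ?nnegrE ?enorm_ge0 ?mulr_ge0// enorm_le.
by rewrite exprMn ler_wpM2r ?exprn_ge0// ler_weXn2l ?leq_subr// ler1n.
Qed.

Definition disc x0 (r : R) : set A := [set x : A | `|\val x - x0| <= r].

Lemma whitney_tame (g : whitney A E k) q x0 (r : R) : continuous_seminorm q ->
  compact (disc x0 r) ->
  tame g q x0 r (n.+1%:R ^+ k * whitney_rem k q (disc x0 r) g).
Proof.
move=> qs cK; split; first by rewrite mulr_ge0 ?exprn_ge0// whitney_rem_ge0.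
move=> w a b wk Aa Ab ar br.
pose a' : A := exist _ a (mem_set Aa); pose b' : A := exist _ b (mem_set Ab).
have := @whitney_rem_ge R n E A k k q (disc x0 r) g (word_mnm w) b' a' (leqnn k).
rewrite mdeg_word_mnm => /(_ wk qs cK br ar).
rewrite remainderE /jet_taylor -(jval_val g _ b').
have -> : (fun b0 => jcoef g b0 a') = (fun b0 => jval g b0 a).
  by apply/funext => c; rewrite -(jval_val g c a').
move=> /le_trans; apply; rewrite [_ ^+ k * _]mulrC -mulrA.
rewrite ler_wpM2l ?whitney_rem_ge0//=.
exact: enorm_exp_le.
Qed.

(** The Whitney condition, for the finitely many components at once. *)
Lemma whitney_small (g : whitney A E k) q x0 (r e : R) : continuous_seminorm q ->
  0 < r -> compact (disc x0 r) -> 0 < e -> exists2 r', 0 < r' & tame g q x0 r' e.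
Proof.
move=> qs r0 cK e0; have n1 : (0 : R) < n.+1%:R ^+ k by rewrite exprn_gt0.
have e1 : 0 < e / n.+1%:R ^+ k by rewrite divr_gt0.
have [d d0 dP] : exists2 d, 0 < d & forall a : bmultinom n k.+1,
    forall x y : A, disc x0 r x -> disc x0 r y ->
      0 < enorm (\val x - \val y) < d -> q (remainder g k a y x) <=
      e / n.+1%:R ^+ k * enorm (\val x - \val y) ^+ (k - mdeg a).
  apply: (@fin_delta R _ (fun (a : bmultinom n k.+1) d =>
    forall x y : A, disc x0 r x -> disc x0 r y ->
      0 < enorm (\val x - \val y) < d -> q (remainder g k a y x) <=
      e / n.+1%:R ^+ k * enorm (\val x - \val y) ^+ (k - mdeg a))).
    move=> a d d' dd H x y Kx Ky /andP[xy0 xyd]; apply: H => //.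
    by rewrite xy0 (lt_le_trans xyd).
  by move=> a; apply: (whitneyP g) => //; rewrite -ltnS bmdeg.
have s0 : 0 < d / (n.+1%:R * 3) by rewrite divr_gt0// mulr_gt0.
exists (Num.min r (d / (n.+1%:R * 3))); first by rewrite lt_min r0.
split; first exact: ltW.
move=> w a b wk Aa Ab; rewrite !le_min => /andP[ar ad] /andP[br bd].
pose a' : A := exist _ a (mem_set Aa); pose b' : A := exist _ b (mem_set Ab).
have -> : jval g (word_mnm w) b - jet_taylor g a w b = remainder g k (word_mnm w) a' b'.
  rewrite remainderE /jet_taylor -(jval_val g _ b').
  by congr (_ - taylor _ _ _ _ _); apply/funext => c; rewrite -(jval_val g c a').
have [ab|ab] := eqVneq b' a'.
  by rewrite ab remainder_diag (semi0 qs) mulr_ge0 ?exprn_ge0// ltW.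
have w' : (mdeg (word_mnm w) < k.+1)%N by rewrite mdeg_word_mnm.
have := dP (BMultinom w') b' a' br ar; rewrite /= mdeg_word_mnm => H.
have {}H := H (_ : _).
rewrite (le_trans (H _))//; last first.
  rewrite -[leRHS](_ : e / n.+1%:R ^+ k * (n.+1%:R ^+ k * `|b - a| ^+ (k - size w)) = _);
    last by rewrite mulrA divfK ?gt_eqF.
  rewrite ler_wpM2l ?(ltW e1)//.
  exact: enorm_exp_le.
rewrite enorm_gt0 (val_sub_neq0 ab)//= (le_lt_trans (enorm_le _))//.
have ba : `|b - a| <= d / (n.+1%:R * 3) * 2.
  by rewrite (le_trans (ler_distD x0 b a))// (distrC x0 a) mulr_natr mulr2n lerD.
have nn : (0 : R) < n.+1%:R by [].
rewrite (le_lt_trans (ler_wpM2l (ltW nn) ba))//.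
have -> : n.+1%:R * (d / (n.+1%:R * 3) * 2) = d * (2 / 3).
  by move: nn; set N : R := n.+1%:R => nn; field; rewrite gt_eqF.
by lra.
Qed.

(** * Bounds for the extension, uniform in the jet *)

(** The integers [b] take five values, numbered from 0 by [b - a + 2]. *)
Lemma int_window (a b : int) : a - 3 < b -> b < a + 3 ->
  (absz (b - a + 2)%R < 5)%N /\ 0 <= b - a + 2.
Proof. by lia. Qed.

Section LocalBounds.
Variable q : E -> R.
Hypothesis qs : continuous_seminorm q.
Implicit Types (F : whitney A E k -> fam).

(** One compact set and one constant serve all jets: this is what continuity of
    the extension operator requires. *)
Definition bdd_on F (K : set A) (B r : R) x := [/\ compact K, 0 <= B, 0 < r &
  forall (g : whitney A E k) w y, (size w <= k)%N -> `|y - x| < r ->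
    q (F g w y) <= B * whitney_norm k q K g].

Definition bdd_at F x := exists K B r, bdd_on F K B r x.

Lemma bdd_on_weak F (K K' : set A) (B B' r r' : R) x : bdd_on F K B r x ->
  compact K' -> K `<=` K' -> B <= B' -> 0 < r' -> r' <= r -> bdd_on F K' B' r' x.
Proof.
move=> [cK B0 r0 FP] cK' KK BB r'0 rr; split=> //; first exact: le_trans BB.
move=> g w y wk yx; rewrite (le_trans (FP g w y wk _)) ?(lt_le_trans yx)//.
apply: ler_pM => //; first exact: whitney_norm_ge0.
exact: whitney_norm_sub.
Qed.

Lemma bdd_fin (I : eqType) (s : seq I) (F : I -> whitney A E k -> fam) x :
  (forall i, bdd_at (F i) x) ->
  exists K B r, [/\ compact K, 0 <= B, 0 < r &
    forall i, i \in s -> bdd_on (F i) K B r x].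
Proof.
move=> Fb; elim: s => [|i s [K [B [r [cK B0 r0 IH]]]]].
  by exists set0, 0, 1; split=> //; exact: compact0.
have [K' [B' [r' FP]]] := Fb i; have [cK' B'0 r'0 _] := FP.
have cU := compactU cK cK'.
exists (K `|` K'), (Num.max B B'), (Num.min r r'); split=> //.
- by rewrite le_max B0.
- by rewrite lt_min r0.
move=> j; rewrite inE => /predU1P[->|/IH jP].
  apply: (bdd_on_weak FP) => //; [by rewrite le_max lexx orbT|
    by rewrite lt_min r0|by rewrite ge_min lexx orbT].
by apply: (bdd_on_weak jP) => //; [by rewrite le_max lexx|
  by rewrite lt_min r0|by rewrite ge_min lexx].
Qed.

Lemma bdd_jet_taylor a x : A a -> bdd_at (fun g : whitney A E k => jet_taylor g a) x.
Proof.
move=> Aa; pose a' : A := exist _ a (mem_set Aa).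
pose K : set A := [set a']; have cK : compact K by exact: compact_set1.
pose rho : R := 1 + `|x - a|; have rho0 : 0 <= rho by rewrite addr_ge0.
have [B B0 BP] : exists2 B, 0 <= B & forall (c : bmultinom n k.+1)
    (g : whitney A E k) y, `|y - x| < 1 ->
    q (taylor k (fun b => jval g b a) a c y) <= B * whitney_norm k q K g.
  apply: (@fin_bound R _ (fun (c : bmultinom n k.+1) B =>
    forall (g : whitney A E k) y, `|y - x| < 1 ->
    q (taylor k (fun b => jval g b a) a c y) <= B * whitney_norm k q K g)).
    move=> c B B' BB H g y yx; rewrite (le_trans (H g y yx))//.
    by rewrite ler_wpM2r// whitney_norm_ge0.
  move=> c; exists (\sum_(b : bmultinom n (k - mdeg c).+1) rho ^+ mdeg b).
    by rewrite sumr_ge0// => b _; rewrite exprn_ge0.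
  move=> g y yx; rewrite /taylor (le_trans (semi_sum qs _ _ _))// mulr_suml.
  apply: ler_sum => b _; rewrite (semiZ qs); apply: ler_pM; rewrite ?(semi_ge0 qs)//.
    rewrite normrM normfV normr_nat ler_pdivrMr ?ltr0n ?mfact_gt0//.
    rewrite (le_trans (norm_mpow _ _))//.
    apply: (@le_trans _ _ (rho ^+ mdeg b)).
      rewrite lerXn2r ?nnegrE//.
      by have := ler_distD x y a; rewrite /rho; lra.
    by rewrite ler_peMr ?exprn_ge0// ler1n mfact_gt0.
  rewrite -[a in jval _ _ a]/(\val a') jval_val whitney_normE.
  apply: (@le_trans _ _ (whitney_sup k q K g)).
    apply: whitney_sup_ge => //.
    by rewrite mdegD; have := bmdeg b; have := bmdeg c; lia.
  by rewrite lerDl whitney_rem_ge0.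
exists K, B, 1; split=> // g w y wk yx.
have w' : (mdeg (word_mnm w) < k.+1)%N by rewrite mdeg_word_mnm.
exact: (BP (BMultinom w')).
Qed.

(** Only finitely many nodes matter near a given point: in each coordinate, the
    five integers [zf] within distance 2 of [t]. *)
Lemma bdd_approx m x : bdd_at (fun g : whitney A E k => approx m g) x.
Proof.
have P0 : bdd_at (fun _ => (fun=> fun=> 0) : fam) x.
  exists set0, 0, 1; split=> // [|g w y _ _]; first exact: compact0.
  by rewrite (semi0 qs) mul0r.
suff H i : bdd_at (fun g : whitney A E k => prev i g) x ->
    bdd_at (fun g : whitney A E k => approx i g) x.
  by elim: m => [|m IH]; exact: H.
move: {m} i => m Pm; pose t i : int := Num.floor (lev m * x 0 i).
pose zf (f : {ffun 'I_n -> 'I_5}) i : int := t i + (f i)%:Z - 2.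
have [f|K [B [r [cK B0 r0 KP]]]] := @bdd_fin _ (enum {ffun 'I_n -> 'I_5})
    (fun f (g : whitney A E k) => node_fam m g (prev m g) (zf f)) x.
  rewrite /node_fam; case: asboolP => // /close_anchor[Ap _].
  exact: bdd_jet_taylor.
have l0 := lev_gt0 m; have l1 := lev_ge1 m; have g0 := grid_cst_ge0.
exists K, (grid_cst * B * lev m ^+ k), (Num.min r (lev m)^-1); split=> //.
- by rewrite !mulr_ge0// exprn_ge0// ltW.
- by rewrite lt_min r0 invr_gt0.
move=> g w y wk; rewrite lt_min => /andP[yr yl].
have N0 : 0 <= B * whitney_norm k q K g by rewrite mulr_ge0// whitney_norm_ge0.
apply: (@le_trans _ _ (grid_cst * (B * whitney_norm k q K g) * lev m ^+ size w)); last first.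
  rewrite -!mulrA ler_wpM2l// !mulrA [leRHS]mulrAC ler_wpM2l//.
  exact: ler_weXn2l.
rewrite approxE /grid_cst -[X in interp_cst k C ^+ X](size_enum_ord n).
apply: (grid_le bump l0) => // [i|z yz v vw]; first exact: notin_enum_le.
suff [f ->] : exists f, z = zf f.
  have [_ _ _ /(_ g v y (leq_trans vw wk) yr) H] := KP f (mem_enum _ f).
  by rewrite (le_trans H)// ler_peMr// exprn_ege1.
have d5 i : (absz (z i - t i + 2)%R < 5)%N /\ 0 <= z i - t i + 2.
  have := yz i; have/andP[t0 t1] := floor_itv (lev m * x 0 i).
  have : `|lev m * y 0 i - lev m * x 0 i| < 1.
    rewrite -mulrBr normrM gtr0_norm// -(@divff _ (lev m)) ?gt_eqF//.
    rewrite ltr_pM2l// (le_lt_trans _ yl)//.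
    by have := coord_le (y - x) i; rewrite !mxE.
  rewrite ltr_norml ler_norml => /andP[y1 y2] /andP[z1 z2].
  have H1 : (t i - 3)%:~R < (z i)%:~R :> R by rewrite intrB; lra.
  have H2 : (z i)%:~R < (t i + 3)%:~R :> R by move: t1; rewrite !intrD; lra.
  by rewrite !ltr_int in H1 H2; exact: int_window.
exists [ffun i => Ordinal (d5 i).1]; apply/funext => i.
by rewrite /zf ffunE /= gez0_abs ?(d5 i).2//; ring.
Qed.

(** At a point of [A], [ext_estimate] is used with the constant [whitney_rem]; at
    the other points [ext] is locally one of the approximations. *)
Lemma bdd_ext x : nbhs x covered ->
  (A x -> exists2 r : R, 0 < r & compact (disc x r)) ->
  bdd_at (fun g : whitney A E k => ext g) x.
Proof.
move=> nx dx; have [Ax|[m fx]] := nbhs_singleton nx; last first.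
  have [r1 r10 fP] := far_near fx.
  have [K' [B [r2 [cK' B0 r20 KP]]]] := bdd_approx m.+1 x.
  exists K', B, (Num.min r1 r2); split=> //; first by rewrite lt_min r10.
  move=> g w y wk; rewrite lt_min => /andP[yr1 yr2].
  by rewrite (ext_far g (fP y yr1) wk) KP.
have [r r0 cK] := dx Ax; have [rho rho0 rhoP] := (nbhs_rVP x covered).1 nx.
have [K' [B [r2 [cK' B0 r20 KP]]]] := bdd_jet_taylor x Ax.
have cU := compactU cK cK'; have c1 := ext_cst_ge1.
have n0 : 0 <= n.+1%:R ^+ k :> R by rewrite exprn_ge0.
exists (disc x r `|` K'), (ext_cst * n.+1%:R ^+ k + B),
  (Num.min (Num.min 1 (r / 20)) (Num.min rho r2)); split=> //.
- by rewrite addr_ge0// mulr_ge0//; lra.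
- by rewrite !lt_min ltr01 rho0 r20 divr_gt0.
move=> g w y wk; rewrite !lt_min => /andP[/andP[y1 yr] /andP[yrho yr2]].
have yr' : 20 * `|y - x| <= r by lra.
have H := ext_estimate qs (whitney_tame g qs cK) Ax (rhoP y yrho) y1 yr' wk.
rewrite (le_trans (semi_sub qs _ (jet_taylor g x w y)))// addrC mulrDl; apply: lerD.
  have N0 : 0 <= whitney_norm k q (disc x r `|` K') g by exact: whitney_norm_ge0.
  rewrite (le_trans H)// mulrA -mulrA; apply: ler_pM => //.
  - by rewrite mulr_ge0//; lra.
  - by rewrite mulr_ge0 ?exprn_ge0// whitney_rem_ge0.
  apply: (@le_trans _ _ (whitney_rem k q (disc x r) g)).
    by rewrite ler_piMr ?whitney_rem_ge0// exprn_ile1// ltW.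
  apply: (@le_trans _ _ (whitney_norm k q (disc x r) g)).
    by rewrite whitney_normE lerDr whitney_sup_ge0.
  by apply: whitney_norm_sub => // u; left.
rewrite (le_trans (KP g w y wk yr2))// ler_wpM2l//.
by apply: whitney_norm_sub => // u; right.
Qed.

End LocalBounds.

End Extension.

(** * The extension operator *)

Section ExtensionOperator.
Context {R : realType} {n : nat} {E : lcsType R}.
Variables (U A : set 'rV[R]_n) (AU : A `<=` U) (k : nat).
Hypotheses (lcU : locally_convex_subset U) (dU : dense_interior U).
Hypothesis clA : closed (\val @^-1` A : set U).
Hypothesis lcA : locally_compact [set: A].
Variables (th : nat -> R -> R) (C : R).
Hypothesis bump : is_bump k th C.
Implicit Types (g : whitney A E k) (x y a : 'rV[R]_n).

Lemma disc_compact x : A x -> exists2 r : R, 0 < r & compact (disc x r : set A).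
Proof.
move=> Ax; pose x' : A := exist _ x (mem_set Ax).
have [V] := lcA (I : [set: A] x'); rewrite withinET => /nbhs_setP[d d0 dV] [cV _].
exists (d / 2); first by rewrite divr_gt0.
apply: (subclosed_compact _ cV); last first.
  by move=> y yx; apply: dV => /=; rewrite /disc /= in yx; lra.
have -> : (disc x (d / 2) : set A) = \val @^-1` [set y : 'rV[R]_n | `|y - x| <= d / 2] by [].
apply: closed_comp => [y _|]; first exact: initial_continuous.
rewrite (_ : [set y | _] = [set y | `|x - y| <= d / 2]).
  exact: (@closed_closed_ball_ _ 'rV[R]_n).
by apply/funext => y; rewrite /= distrC.
Qed.

Lemma far_exists y (d : R) : 0 < d -> (forall a, A a -> d <= `|y - a|) ->
  exists m, far A m y.
Proof.
move=> d0 dP; pose m := Num.bound d^-1; exists m => a /dP; apply: lt_le_trans.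
rewrite invf_plt ?posrE ?lev_gt0//.
have : d^-1 < m%:R by apply: archi_boundP; rewrite invr_ge0 ltW.
move=> /lt_le_trans; apply; rewrite /lev -natrX ler_nat.
exact: ltnW (ltn_expl _ _).
Qed.

(** Outside of A, relative closedness keeps a point of U at a positive distance
    from A; near a point of A, this follows from local compactness. *)
Lemma sub_covered : U `<=` (covered A)°.
Proof.
move=> x Ux; have [Ax|nAx] := pselect (A x); last first.
  pose x' : U := exist _ x (mem_set Ux).
  have /nbhs_setP[d d0 dP] : nbhs x' (~` (\val @^-1` A : set U)).
    by apply: open_nbhs_nbhs; split=> //; exact: closed_openC.
  have [m fx] : exists m, far A m x.
    apply: (far_exists d0) => a Aa; rewrite leNgt distrC; apply/negP => ax.
    exact: (dP (exist _ a (mem_set (AU Aa))) ax).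
  have [r r0 rP] := far_near fx; apply/nbhs_rVP; exists r => // y /rP fy.
  by right; exists m.+1.
have [r r0 cK] := disc_compact Ax.
pose K : set 'rV[R]_n := [set \val a | a in (disc x r : set A)].
have clK : closed K.
  by apply: compact_closed; [exact: norm_hausdorff|exact: compact_val_image].
apply/nbhs_rVP; exists (r / 2) => [|y yx]; first by rewrite divr_gt0.
have [Ay|nAy] := pselect (A y); first by left.
right; have /nbhs_rVP[d d0 dP] : nbhs y (~` K).
  apply: open_nbhs_nbhs; split; first exact: closed_openC.
  by move=> [a _ ay]; apply: nAy; rewrite -ay; exact: set_valP.
apply: (@far_exists y (Num.min d (r / 2))); first by rewrite lt_min d0 divr_gt0.
move=> a Aa; rewrite ge_min; have [ar|ra] := lerP `|a - x| r; apply/orP.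
  left; rewrite leNgt distrC; apply/negP => /dP; apply.
  by exists (exist _ a (mem_set Aa)).
by right; have := ler_distD y a x; rewrite (distrC a y); lra.
Qed.

Lemma ext_ck_family g : ck_family (covered A)° k (ext th g).
Proof.
move=> q qs x Dx w; have [Ax|fx] := nbhs_singleton Dx; last first.
  exact: (ext_ck_far bump g qs fx).
apply: (ext_ck_at bump qs Ax Dx) => e e0; have [r r0 cK] := disc_compact Ax.
exact: (whitney_small g qs r0 cK e0).
Qed.

Lemma extension_Ck g : is_Ck k (fun x : U => ext th g [::] (\val x)).
Proof. exact: (is_Ck_family sub_covered (ext_ck_family g)). Qed.

Definition extension g : Ck U E k := MkCk (asboolT (extension_Ck g)).

Lemma partial_extension g (a : multinom n) (x : U) : (mdeg a <= k)%N ->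
  partial a (extension g) x = ext th g (mnm_word a) (\val x).
Proof.
move=> ak; exact: (partial_family sub_covered (ext_ck_family g) _ dU).
Qed.

Fact extension_linear : linear extension.
Proof.
move=> c f g; apply/val_inj/funext => x.
have fgE : whitney_jet (c *: f + g) = c *: whitney_jet f + whitney_jet g by [].
change (ext th (whitney_jet (c *: f + g)) [::] (\val x) =
  c *: ext th f [::] (\val x) + ext th g [::] (\val x)).
by rewrite fgE; exact: ext_lin.
Qed.

HB.instance Definition _ := GRing.isLinear.Build R (whitney A E k) (Ck U E k) _
  extension extension_linear.

Lemma extensionK g : restriction AU lcU dU (extension g) = g.
Proof.
apply/val_inj/funext => a; apply/funext => x.
have ak : (mdeg a <= k)%N by rewrite -ltnS bmdeg.
rewrite /= /restriction_jet partial_extension// (ext_in th g (mnm_word a) (set_valP x)).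
rewrite mnm_wordK /= -[\val x]/(\val x) jval_val /jcoef.
by rewrite valK.
Qed.

(** The local bounds are combined over a finite cover of [K]. *)
Lemma extension_bound l q (K : set U) : (l <= k)%N -> continuous_seminorm q ->
  compact K -> exists K' B, [/\ compact K', 0 <= B & forall g,
    Ck_norm l q K (extension g) <= B * whitney_norm k q K' g].
Proof.
move=> lk qs cK.
have [|||x Kx|K' [B [cK' B0 KP]]] := @compact_ind U K (fun S => exists K' B,
  [/\ compact K', 0 <= B & forall g (a : multinom n) (x : U), S x ->
    (mdeg a <= k)%N -> q (partial a (extension g) x) <=
    B * whitney_norm k q K' g]) cK.
- by exists set0, 0; split=> //; exact: compact0.
- move=> S S' [K1 [B1 [cK1 B10 H1]]] [K2 [B2 [cK2 B20 H2]]].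
  have cU := compactU cK1 cK2.
  exists (K1 `|` K2), (Num.max B1 B2); split=> //; first by rewrite le_max B10.
  move=> g a x [Sx|Sx] ak.
    apply: (le_trans (H1 g a x Sx ak)).
    apply: ler_pM; rewrite ?whitney_norm_ge0 ?le_max ?lexx//.
    by apply: whitney_norm_sub => // u; left.
  apply: (le_trans (H2 g a x Sx ak)).
  apply: ler_pM; rewrite ?whitney_norm_ge0 ?le_max ?lexx ?orbT//.
  by apply: whitney_norm_sub => // u; right.
- move=> S S' SS [K' [B [cK' B0 H]]]; exists K', B; split=> // g a x /SS.
  exact: H.
- have Dx := sub_covered (set_valP x).
  have [K' [B [r [cK' B0 r0 H]]]] := bdd_ext bump qs Dx (@disc_compact (\val x)).
  exists [set y : U | `|\val y - \val x| < r]; first by apply/nbhs_setP; exists r.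
  exists K', B; split=> // g a y yx ak; rewrite partial_extension//.
  by apply: H => //; rewrite size_mnm_word.
exists K', B; split=> // g; apply: Ck_norm_le => [|a x al Kx].
  by rewrite mulr_ge0// whitney_norm_ge0.
by apply: KP => //; exact: leq_trans lk.
Qed.

Lemma extension_continuous : continuous extension.
Proof.
apply: (@seminorm_continuous R (whitney A E k) (Ck U E k)
  (@whitney_seminorms R n A E k) (@Ck_seminorms R n U E k)
  (extension : {linear _ -> _}) erefl erefl).
  by move=> _ [l [q [K [lk qs cK ->]]]] f g; exact: Ck_normD.
move=> _ [l [q [K [lk qs cK ->]]]].
have [K' [B [cK' B0 BP]]] := extension_bound lk qs cK.
exists (whitney_norm k q K'), B; split=> //; first by exists k, q, K'.
- exact: whitney_norm0.
- by move=> g; exact: whitney_norm_ge0.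
Qed.

End ExtensionOperator.

Theorem mainTheorem1 (R : realType) (E : lcsType R) (n k : nat)
    (U A : set 'rV[R]_n) (AU : A `<=` U) :
  (0 < n)%N ->
  locally_convex_subset U -> dense_interior U ->
  closed (\val @^-1` A : set (set_type U)) -> locally_compact [set: set_type A] ->
  exists rho : {linear Ck U E k -> whitney A E k},
    [/\ continuous rho,
        (forall (f : Ck U E k) (a : bmultinom n k.+1) (x : A),
           whitney_jet (rho f) a x = partial a f (set_incl AU x)) &
        exists Phi : {linear whitney A E k -> Ck U E k},
          continuous Phi /\ forall g, rho (Phi g) = g].
Proof.
move=> _ lcU dU clA lcA; have [th [C bump]] := @bump_exists R k.
exists (restriction AU lcU dU : {linear _ -> _}); split=> //.
  exact: restriction_continuous.
exists (extension AU clA lcA bump : {linear _ -> _}); split.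
  exact: extension_continuous.
exact: extensionK.
Qed.
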